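(* Let $(X,\mathcal B,\mu,T)$ be an ergodic system. (1) If $T$ is Bernoulli then $C^\infty(T)=\bigcup_{n\ge1}C(T^n)$ is dense in ${\rm Aut}(X,\mathcal B,\mu)$. (2) If $T$ is a $K$-system then $J^\infty(T)=\bigcup_{n\ge1}\{\xi\in C_2(\mu):\widetilde T^n\xi=\xi\}$ (the set of periodic points of the lens) is dense in $C_2(\mu)$; hence $(C_2(\mu),\widetilde T)$ is a $P$-system.
   Context: ${\rm Aut}(X,\mathcal B,\mu)$ carries the weak topology; $C(R)=\{S\in{\rm Aut}(\mu):SR=RS\}$ is the centralizer of $R$. $C_2(\mu)$: probability measures on $X\times X$ with both marginals $\mu$, topologized by $\rho_n\to\rho$ iff $\rho_n(A\times B)\to\rho(A\times B)$ for all measurable $A,B$; the topological lens is $\widetilde T(\rho)(A\times B)=\rho(T^{-1}A\times T^{-1}B)$. Its fixed points under $\widetilde T^n$ are exactly the $T^n\times T^n$-invariant couplings. A topological system $(Y,S)$ is a $P$-system (chaotic in the sense of Devaney) if it is topologically transitive and its set of periodic points is dense. *)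

(* Defs.v *)
From HB Require Import structures.
From mathcomp Require Import all_boot all_order all_algebra.
From mathcomp Require Import all_classical all_reals all_analysis.
Set Implicit Arguments. Unset Strict Implicit. Unset Printing Implicit Defensive.
Import Order.TTheory GRing.Theory Num.Theory.
Local Open Scope classical_set_scope.
Local Open Scope ring_scope.

Section Defs.
Context {d : measure_display} {X : measurableType d} {R : realType}.

Definition standard_Borel : Prop :=
  exists f : X -> R, injective f /\ measurable_fun setT f /\
    (forall A : set X, measurable A -> measurable (f @` A)).

Definition symdiff (A B : set X) : set X := (A `\` B) `|` (B `\` A).

Definition isAut (mu : probability X R) (S : X -> X) : Prop :=
  [/\ bijective S, measurable_fun setT S,
      (forall A, measurable A -> measurable (S @` A)) &
      (forall A, measurable A -> mu (S @^-1` A) = mu A)].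

Definition ergodic (mu : probability X R) (T : X -> X) : Prop :=
  forall A, measurable A -> T @^-1` A = A -> (mu A = 0%E \/ mu A = 1%E).

Definition timg (T : X -> X) (z : int) (A : set X) : set X :=
  match z with
  | Posz n => iter n T @` A
  | Negz n => iter n.+1 T @^-1` A
  end.

Definition sub_sigma (P0 : set (set X)) : Prop :=
  sigma_algebra setT P0 /\ P0 `<=` measurable.

Definition generates_mod0 (mu : probability X R) (G : set (set X)) : Prop :=
  forall B, measurable B -> exists A, <<s G >> A /\ mu (symdiff A B) = 0%E.

(** T is Bernoulli: there is an independent generating sub-sigma-algebra P0,
    i.e. the sigma-algebras T^z P0 (z in Z) are independent and together
    generate B mod mu (equivalently (X,mu,T) is isomorphic to a Bernoulli
    shift over a standard state space). *)
Definition Bernoulli (mu : probability X R) (T : X -> X) : Prop :=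
  exists P0 : set (set X), sub_sigma P0 /\
    (forall (n : nat) (f : nat -> int) (A : nat -> set X),
        {in [pred i | (i < n)%N] &, injective f} ->
        (forall i, P0 (A i)) ->
        fine (mu (\bigcap_(i in [set i | (i < n)%N]) timg T (f i) (A i)))
        = \prod_(i < n) fine (mu (A i))) /\
    generates_mod0 mu [set E | exists z A, P0 A /\ E = timg T z A].

Definition Ksystem (mu : probability X R) (T : X -> X) : Prop :=
  exists K : set (set X), sub_sigma K /\
    (forall A, K A -> K (T @^-1` A)) /\
    generates_mod0 mu [set E | exists (n : nat) A, K A /\ E = iter n T @` A] /\
    (forall E, (forall n : nat, exists A, K A /\ E = iter n T @^-1` A) ->
       mu E = 0%E \/ mu E = 1%E).

Definition centralizer (mu : probability X R) (R0 : X -> X) : set (X -> X) :=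
  [set S | isAut mu S /\ {ae mu, forall x, S (R0 x) = R0 (S x)}].

Definition Cinfty (mu : probability X R) (T : X -> X) : set (X -> X) :=
  [set S | exists n : nat, (1 <= n)%N /\ centralizer mu (iter n T) S].

Definition aut_open (mu : probability X R) (U : set (X -> X)) : Prop :=
  U `<=` isAut mu /\
  forall S, U S -> exists (k : nat) (A : nat -> set X) (e : R),
    0 < e /\ (forall i, measurable (A i)) /\
    [set S' | isAut mu S' /\ forall i, (i < k)%N ->
        fine (mu (symdiff (S' @` A i) (S @` A i))) < e] `<=` U.

Definition aut_dense (mu : probability X R) (D : set (X -> X)) : Prop :=
  forall U, aut_open mu U -> U !=set0 -> (U `&` D) !=set0.

Definition coupling (mu : probability X R) (rho : probability (X * X)%type R)
  : Prop :=
  (forall A, measurable A -> rho (A `*` setT) = mu A) /\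
  (forall B, measurable B -> rho (setT `*` B) = mu B).

Definition cval (rho : probability (X * X)%type R) (A B : set X) : R :=
  fine (rho (A `*` B)).

Definition c2_open (mu : probability X R) (U : set (probability (X * X)%type R))
  : Prop :=
  U `<=` coupling mu /\
  forall rho, U rho -> exists (k : nat) (A B : nat -> set X) (e : R),
    0 < e /\ (forall i, measurable (A i) /\ measurable (B i)) /\
    [set xi | coupling mu xi /\ forall i, (i < k)%N ->
        `| cval xi (A i) (B i) - cval rho (A i) (B i) | < e] `<=` U.

Definition c2_dense (mu : probability X R)
  (D : set (probability (X * X)%type R)) : Prop :=
  forall U, c2_open mu U -> U !=set0 -> (U `&` D) !=set0.

(** lens_iter T n rho xi  <->  xi = \tilde T^n rho, where
    \tilde T(rho)(A x B) = rho(T^-1 A x T^-1 B) *)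
Definition lens_iter (T : X -> X) (n : nat)
  (rho xi : probability (X * X)%type R) : Prop :=
  forall A B, measurable A -> measurable B ->
    xi (A `*` B) = rho ((iter n T @^-1` A) `*` (iter n T @^-1` B)).

Definition Jinfty (mu : probability X R) (T : X -> X)
  : set (probability (X * X)%type R) :=
  [set xi | coupling mu xi /\ exists n : nat, (1 <= n)%N /\ lens_iter T n xi xi].

Definition lens_transitive (mu : probability X R) (T : X -> X) : Prop :=
  forall U V, c2_open mu U -> c2_open mu V -> U !=set0 -> V !=set0 ->
    exists n : nat, (1 <= n)%N /\
      exists rho xi, U rho /\ V xi /\ lens_iter T n rho xi.

(** (C_2(mu), \tilde T) is a P-system (chaotic in the sense of Devaney) *)
Definition lens_Psystem (mu : probability X R) (T : X -> X) : Prop :=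
  lens_transitive mu T /\ c2_dense mu (Jinfty mu T).

End Defs.

(* Main.v *)
(* Bernoulli case. Approximate the given sets and their images by sets that depend
   on a finite independent partition seen through a window, cut the time axis into
   long blocks of such windows, and permute the windows of each block according to
   the word that the block carries. This commutes with a power of T, preserves the
   measure because an i.i.d. process is exchangeable, and by the law of large
   numbers the permutations can be chosen so that, off a set of small measure, the
   window at time 0 is moved as prescribed.

   K case. Call bimeasure a finitely additive function of rectangles with both
   marginals mu; on a standard Borel space every bimeasure is a coupling. By
   K-mixing a finite partition is almost independent of its far past under T^n, so
   prescribed couplings of the partition with itself can be realised
   simultaneously, up to a small error independent of the number of steps, at the
   times 0, n, 2n, .... Two steps give transitivity of the lens; a limit of Cesaro
   averages gives a coupling that is invariant under T^n. *)

Require Import Defs.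
From HB Require Import structures.
From mathcomp Require Import all_boot all_order all_fingroup all_algebra.
From mathcomp Require Import all_classical all_reals all_analysis.
From mathcomp Require Import measurable_realfun.
From mathcomp Require Import ring lra zify.
Set Implicit Arguments. Unset Strict Implicit. Unset Printing Implicit Defensive.
Import Order.TTheory GRing.Theory Num.Theory numFieldNormedType.Exports.
Local Open Scope classical_set_scope.
Local Open Scope ring_scope.

(** * Sets modulo null sets *)

(** Finite additivity suffices for bimeasures because the marginals dominate each section by [mu],
    which makes it Lipschitz for the measure of symmetric differences. This survives limits, and the
    coupling is then the law of a pair of maps on the unit interval that read binary digits.

    Errors do not pile up along a chain because the coupling of names keeps exact marginals: each
    new pair of letters is drawn conditionally on the complete names already coupled. Mixing is
    uniform over all sets of a remote sigma-algebra, so the conditional laws of a letter are close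
    in mean to its law however many names there are.

    In the Bernoulli case the given automorphism preserves [mu], so a pattern of the sets and the
    same pattern of their images are equally frequent, and a typical word carries about as many
    windows of one kind as of the other. Reordering the windows keeps the probability of a word, so
    a bijection inside each class of reorderings can match nearly everything. Codes determine points
    only up to null sets, whereas an automorphism is a bijection everywhere; this has to be repaired
    at the end. *)

Section prob.
Context {d : measure_display} {X : measurableType d} {R : realType}.
Variable mu : probability X R.

Definition pr (A : set X) : R := fine (mu A).

Lemma prE A : measurable A -> mu A = (pr A)%:E.
Proof. by move=> mA; rewrite /pr fineK// fin_num_measure. Qed.

Lemma pr_ge0 A : 0 <= pr A.
Proof. by rewrite /pr fine_ge0. Qed.

Lemma pr0 : pr set0 = 0.
Proof. by rewrite /pr measure0. Qed.

Lemma prT : pr setT = 1.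
Proof. by rewrite /pr probability_setT. Qed.

Lemma prU A B : measurable A -> measurable B -> A `&` B = set0 ->
  pr (A `|` B) = pr A + pr B.
Proof.
move=> mA mB AB; apply: EFin_inj; rewrite -prE; last exact: measurableU.
by rewrite measureU// EFinD -!prE.
Qed.

Lemma prDI A B : measurable A -> measurable B ->
  pr A = pr (A `&` B) + pr (A `\` B).
Proof.
move=> mA mB; rewrite -prU; first by rewrite setUIDK.
- exact: measurableI.
- exact: measurableD.
- by apply/seteqP; split => // x [[_ ?] []].
Qed.

Lemma prC A : measurable A -> pr (~` A) = 1 - pr A.
Proof. by move=> mA; rewrite -prT (@prDI setT A)// setTI setTD addrAC subrr add0r. Qed.

Lemma le_pr A B : measurable A -> measurable B -> A `<=` B -> pr A <= pr B.
Proof.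
move=> mA mB AB; rewrite (@prDI B A)// setIidr// lerDl; exact: pr_ge0.
Qed.

Lemma pr_le1 A : measurable A -> pr A <= 1.
Proof. by move=> mA; rewrite -prT; apply: le_pr. Qed.

Lemma prU_le A B : measurable A -> measurable B -> pr (A `|` B) <= pr A + pr B.
Proof.
move=> mA mB; rewrite -{1}(setUIDK B A) setUA (setUidl (@subIsetr _ B A)).
rewrite prU//; last 2 first.
- exact: measurableD.
- by apply/seteqP; split => // x [? []].
by rewrite lerD2l; apply: le_pr; [exact: measurableD|by []|exact: subDsetl].
Qed.

Lemma pr_eq0P A : measurable A -> (mu A = 0%E <-> pr A = 0).
Proof. by move=> mA; rewrite prE//; split => [[]//|->]. Qed.

Lemma measurable_symdiff (A B : set X) :
  measurable A -> measurable B -> measurable (symdiff A B).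
Proof. by move=> mA mB; apply: measurableU; apply: measurableD. Qed.

Definition dist (A B : set X) : R := pr (symdiff A B).

Lemma symdiffC (A B : set X) : symdiff A B = symdiff B A.
Proof. by rewrite /symdiff setUC. Qed.

Lemma symdiffxx (A : set X) : symdiff A A = set0.
Proof. by rewrite /symdiff setDv setU0. Qed.

Lemma symdiff_sub (A B C : set X) : symdiff A C `<=` symdiff A B `|` symdiff B C.
Proof.
move=> x [[Ax nCx]|[Cx nAx]]; case: (pselect (B x)) => Bx;
by [left; left|left; right|right; left|right; right].
Qed.

Lemma symdiffCC (A B : set X) : symdiff (~` A) (~` B) = symdiff A B.
Proof. by rewrite /symdiff !setDE !setCK [X in X `|` _]setIC [X in _ `|` X]setIC setUC. Qed.

Lemma symdiffU_sub (A B C D : set X) :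
  symdiff (A `|` C) (B `|` D) `<=` symdiff A B `|` symdiff C D.
Proof.
move=> x [[[Ax|Cx] /not_orP[nB nD]]|[[Bx|Dx] /not_orP[nA nC]]];
by [left; left|right; left|left; right|right; right].
Qed.

Lemma distC (A B : set X) : dist A B = dist B A.
Proof. by rewrite /dist symdiffC. Qed.

Lemma distxx (A : set X) : dist A A = 0.
Proof. by rewrite /dist symdiffxx pr0. Qed.

Lemma dist_ge0 (A B : set X) : 0 <= dist A B. Proof. exact: pr_ge0. Qed.

Lemma dist_triangle B A C : measurable A -> measurable B -> measurable C ->
  dist A C <= dist A B + dist B C.
Proof.
move=> mA mB mC.
apply: le_trans (prU_le (measurable_symdiff mA mB) (measurable_symdiff mB mC)).
apply: le_pr; [exact: measurable_symdiff| |exact: symdiff_sub].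
by apply: measurableU; exact: measurable_symdiff.
Qed.

Lemma distCC (A B : set X) : dist (~` A) (~` B) = dist A B.
Proof. by rewrite /dist symdiffCC. Qed.

Lemma distU A B C D : measurable A -> measurable B -> measurable C ->
  measurable D -> dist (A `|` C) (B `|` D) <= dist A B + dist C D.
Proof.
move=> mA mB mC mD.
apply: le_trans (prU_le (measurable_symdiff mA mB) (measurable_symdiff mC mD)).
apply: le_pr; last exact: symdiffU_sub.
- by apply: measurable_symdiff; exact: measurableU.
- by apply: measurableU; exact: measurable_symdiff.
Qed.

Lemma distI A B C D : measurable A -> measurable B -> measurable C ->
  measurable D -> dist (A `&` C) (B `&` D) <= dist A B + dist C D.
Proof.
move=> mA mB mC mD; rewrite -distCC !setCI -(distCC A) -(distCC C).
by apply: distU; exact: measurableC.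
Qed.

Lemma bigcup_ltn_measurable (F : nat -> set X) n : (forall k, measurable (F k)) ->
  measurable (\bigcup_(k in [set k | (k < n)%N]) F k).
Proof. by move=> mF; exact: bigcup_measurable. Qed.

Lemma bigcup_ltnS (F : nat -> set X) n :
  \bigcup_(k in [set k | (k < n.+1)%N]) F k =
  \bigcup_(k in [set k | (k < n)%N]) F k `|` F n.
Proof.
apply/seteqP; split => x.
  move=> [k /=]; rewrite ltnS leq_eqVlt => /orP[/eqP->|kn Fk]; first by right.
  by left; exists k.
by move=> [[k /= kn Fk]|Fn]; [exists k => //=; exact: ltnW|exists n => /=].
Qed.

Lemma pr_bigcup_approx (F : nat -> set X) (e : R) :
  (forall k, measurable (F k)) -> 0 < e ->
  exists n, pr (\bigcup_k F k) < pr (\bigcup_(k in [set k | (k < n)%N]) F k) + e.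
Proof.
move=> mF e0; pose G n := \bigcup_(k in [set k | (k < n)%N]) F k.
have mG n : measurable (G n) by exact: bigcup_ltn_measurable.
have UG : \bigcup_n G n = \bigcup_k F k.
  apply/seteqP; split => x; first by move=> [n _ [k _ Fk]]; exists k.
  by move=> [k _ Fk]; exists k.+1 => //; exists k => //=.
have mUG : measurable (\bigcup_n G n) by rewrite UG; exact: bigcup_measurable.
have ndG : {homo G : n m / (n <= m)%N >-> (n <= m)%O}.
  move=> n m nm; apply/subsetPset => x [k /= kn Fk]; exists k => //=.
  exact: leq_trans nm.
have : (mu \o G) x @[x --> \oo] --> (pr (\bigcup_k F k))%:E.
  by rewrite -prE -?UG//; exact: nondecreasing_cvg_mu.
move=> /fine_cvgP[_] /cvgrPdist_lt /(_ _ e0) [n _ /(_ n (leqnn n))] /= h.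
exists n; move: h; rewrite -/(G n) -/(pr (G n)) -/(pr _) => /ltr_normlP[_].
by rewrite ltrBlDl.
Qed.

Lemma pr_bigcap_approx (F : nat -> set X) (e : R) :
  (forall k, measurable (F k)) -> (forall k, F k.+1 `<=` F k) -> 0 < e ->
  exists n, pr (F n) < pr (\bigcap_k F k) + e.
Proof.
move=> mF Fd e0.
have mI : measurable (\bigcap_n F n) by exact: bigcap_measurable.
have niF : {homo F : n m / (n <= m)%N >-> (m <= n)%O}.
  move=> n m /subnK <-; elim: (m - n)%N => // k ih.
  apply: le_trans ih; apply/subsetPset; rewrite addSn; exact: Fd.
have F0 : (mu (F 0%N) < +oo)%E by rewrite prE// ltry.
have : (mu \o F) x @[x --> \oo] --> (pr (\bigcap_k F k))%:E.
  by rewrite -prE//; exact: nonincreasing_cvg_mu.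
move=> /fine_cvgP[_] /cvgrPdist_lt /(_ _ e0) [n _ /(_ n (leqnn n))] /= h.
by exists n; move: h => /ltr_normlP[+ _]; rewrite opprB ltrBlDl.
Qed.

Lemma pr_fin_partition (W : finType) (u : X -> W) A : measurable A ->
  (forall w, measurable (u @^-1` [set w])) ->
  pr A = \sum_w pr (A `&` u @^-1` [set w]).
Proof.
move=> mA mu_; suff H (s : seq W) : uniq s ->
    pr (A `&` [set x | u x \in s]) = \sum_(w <- s) pr (A `&` u @^-1` [set w]).
  rewrite -[RHS]big_enum/= -H ?enum_uniq//; congr pr.
  by apply/seteqP; split => [x Ax|x []//]; split => //=; rewrite mem_enum.
have ms (t : seq W) : measurable [set x | u x \in t].
  elim: t => [|w t ih]; first by rewrite (_ : [set _ | _] = set0)// -subset0.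
  rewrite (_ : [set _ | _] = u @^-1` [set w] `|` [set x | u x \in t]).
    exact: measurableU.
  apply/seteqP; split => x /=; rewrite inE; first by move=> /orP[/eqP|]; auto.
  by move=> [|] ->; rewrite ?eqxx ?orbT.
elim: s => [_|w s ih /= /andP[ws us]].
  by rewrite big_nil -[RHS]pr0; congr pr; rewrite -subset0 => x [].
rewrite big_cons -ih// -prU; first congr pr.
- apply/seteqP; split => x /=; rewrite inE.
    by move=> [Ax /orP[/eqP|]]; auto.
  by move=> [[Ax ->]|[Ax ->]]; rewrite ?eqxx ?orbT.
- exact: measurableI.
- exact: measurableI.
- by rewrite -subset0 => x [[_ /= ->] [_]]; rewrite (negbTE ws).
Qed.

End prob.

(** * Approximation of a generated sigma-algebra by an algebra *)

Section approximation.
Context {d : measure_display} {X : measurableType d} {R : realType}.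
Variable mu : probability X R.

(** The approximable sets form a sigma-algebra: a countable union is truncated to a finite one,
    whose pieces are approximated with errors halved at each step. *)
Lemma sigma_algebra_approx (G : set (set X)) B (e : R) :
  G `<=` measurable -> G set0 -> (forall A, G A -> G (~` A)) ->
  (forall A B, G A -> G B -> G (A `|` B)) ->
  <<s G >> B -> 0 < e -> measurable B /\ exists2 A, G A & dist mu A B < e.
Proof.
move=> Gm G0 GC GU GB e0.
pose H := [set B | measurable B /\
  forall e : R, 0 < e -> exists2 A, G A & dist mu A B < e].
suff : H B by case=> mB /(_ _ e0).
apply: GB; split; last first.
  by move=> A GA; split=> [|r r0]; [exact: Gm|exists A; rewrite ?distxx].
split.
- by split => // r r0; exists set0; rewrite ?distxx.
- move=> A [mA HA]; rewrite setTD; split; first exact: measurableC.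
  by move=> r r0; have [C GC' CA] := HA _ r0; exists (~` C); [exact: GC|rewrite distCC].
- move=> F HF; have mF k : measurable (F k) by case: (HF k).
  have mU : measurable (\bigcup_k F k) by exact: bigcup_measurable.
  split => // r r0; have r20 : 0 < r / 2 by rewrite divr_gt0.
  have [n hn] := pr_bigcup_approx mu mF r20.
  suff [A GA dA] : exists2 A, G A &
      dist mu A (\bigcup_(k in [set k | (k < n)%N]) F k) < r / 2.
    exists A => //; have mV := bigcup_ltn_measurable n mF.
    apply: le_lt_trans (dist_triangle mu (Gm _ GA) mV mU) _.
    rewrite [ltRHS](splitr r) ltrD// /dist /symdiff.
    have VU : \bigcup_(k in [set k | (k < n)%N]) F k `<=` \bigcup_k F k.
      by move=> x [k _ Fk]; exists k.
    have -> : \bigcup_(k in [set k | (k < n)%N]) F k `\` \bigcup_k F k = set0.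
      by rewrite setD_eq0.
    rewrite set0U.
    move: hn; rewrite [X in X < _](prDI mu mU mV) setIidr//.
    by rewrite ltrD2l.
  elim: n {hn} (r / 2) r20 => [|n ih] s s0.
    exists set0 => //; rewrite (_ : \bigcup_(_ in _) _ = set0) ?distxx//.
    by rewrite -subset0 => x [].
  have s20 : 0 < s / 2 by rewrite divr_gt0.
  have [A GA dA] := ih _ s20; have [C GC' dC] := (HF n).2 _ s20.
  exists (A `|` C); first exact: GU.
  rewrite bigcup_ltnS; apply: le_lt_trans (distU mu _ _ _ _) _; rewrite ?[ltRHS](splitr s) ?ltrD//;
    [exact: Gm|exact: bigcup_ltn_measurable|exact: Gm].
Qed.

Lemma generates_approx (G0 G : set (set X)) B (e : R) :
  G `<=` measurable -> G set0 -> (forall A, G A -> G (~` A)) ->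
  (forall A B, G A -> G B -> G (A `|` B)) -> G0 `<=` G ->
  generates_mod0 mu G0 -> measurable B -> 0 < e ->
  exists2 A, G A & dist mu A B < e.
Proof.
move=> Gm G0' GC GU G0G gen mB e0.
have [C [sC CB]] := gen _ mB.
have /(sigma_algebra_approx Gm G0' GC GU)/(_ e0)[mC [A GA dA]] : <<s G >> C.
  by apply: sub_sigma_algebra2 sC.
exists A => //; apply: le_lt_trans (dist_triangle mu (Gm _ GA) mC mB) _.
have -> : dist mu C B = 0 by apply/pr_eq0P => //; exact: measurable_symdiff.
by rewrite addr0.
Qed.

End approximation.

Section null_sets.
Context {d : measure_display} {X : measurableType d} {R : realType}.
Variable mu : probability X R.

Lemma pr_sub0 A B : measurable A -> measurable B -> A `<=` B -> pr mu B = 0 ->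
  pr mu A = 0.
Proof.
by move=> mA mB AB B0; apply/eqP; rewrite eq_le pr_ge0 andbT -B0; exact: le_pr.
Qed.

Lemma prU0 A B : measurable A -> measurable B -> pr mu A = 0 -> pr mu B = 0 ->
  pr mu (A `|` B) = 0.
Proof.
move=> mA mB A0 B0; apply/eqP; rewrite eq_le pr_ge0 andbT.
by apply: le_trans (prU_le mu mA mB) _; rewrite A0 B0 addr0.
Qed.

Lemma pr_bigcup0 (F : nat -> set X) : (forall k, measurable (F k)) ->
  (forall k, pr mu (F k) = 0) -> pr mu (\bigcup_k F k) = 0.
Proof.
move=> mF F0; apply/eqP; rewrite eq_le pr_ge0 andbT; apply/ler_addgt0Pr => e e0.
have [n /ltW] := pr_bigcup_approx mu mF e0.
suff -> : pr mu (\bigcup_(k in [set k | (k < n)%N]) F k) = 0 by [].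
elim: n => [|n ih].
  by rewrite (_ : \bigcup_(_ in _) _ = set0) ?pr0// -subset0 => x [].
by rewrite bigcup_ltnS prU0//; exact: bigcup_ltn_measurable.
Qed.

(** Turns a family indexed by rationals into a sequence; numbers that code no rational get the empty
    set, which changes no union. *)
Definition rat_seq (Z : Type) (F : rat -> set Z) (k : nat) : set Z :=
  if unpickle k is Some q then F q else set0.

Lemma bigcup_rat_seq (Z : Type) (F : rat -> set Z) :
  \bigcup_k rat_seq F k = \bigcup_q F q.
Proof.
apply/seteqP; split => x.
  by move=> [k _]; rewrite /rat_seq; case: unpickle => // q Fq; exists q.
by move=> [q _ Fq]; exists (pickle q); [exact: Logic.I|rewrite /rat_seq pickleK].
Qed.

Lemma measurable_rat_seq (F : rat -> set X) : (forall q, measurable (F q)) ->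
  forall k, measurable (rat_seq F k).
Proof. by move=> mF k; rewrite /rat_seq; case: unpickle. Qed.

Lemma pr_bigcup_rat0 (F : rat -> set X) : (forall q, measurable (F q)) ->
  (forall q, pr mu (F q) = 0) -> pr mu (\bigcup_q F q) = 0.
Proof.
move=> mF F0; rewrite -bigcup_rat_seq; apply: pr_bigcup0.
  exact: measurable_rat_seq.
by move=> k; rewrite /rat_seq; case: unpickle => // *; exact: pr0.
Qed.

Lemma pr_dist_le A B : measurable A -> measurable B ->
  `|pr mu A - pr mu B| <= dist mu A B.
Proof.
move=> mA mB; rewrite /dist prU; last 3 first.
- exact: measurableD.
- exact: measurableD.
- by rewrite -subset0 => x [[? ?] []].
have /= := prDI mu mA mB; have /= := prDI mu mB mA; rewrite setIC => -> ->.
have := pr_ge0 mu (A `\` B); have := pr_ge0 mu (B `\` A).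
by rewrite ler_norml => *; apply/andP; split; lra.
Qed.

Lemma dist0_pr A B : measurable A -> measurable B -> dist mu A B = 0 ->
  pr mu A = pr mu B.
Proof.
move=> mA mB AB; apply/eqP; rewrite -subr_eq0 -normr_le0 -AB.
exact: pr_dist_le.
Qed.

End null_sets.

(** * Uniqueness of image measures *)

Section preimage_unique.
Context {d1 d2 d3 : measure_display} {Y1 : measurableType d1}
  {Y2 : measurableType d2} {Z : measurableType d3} {R : realType}.
Variables (P1 : probability Y1 R) (P2 : probability Y2 R).
Variables (u1 : Y1 -> Z) (u2 : Y2 -> Z).
Hypotheses (mu1 : measurable_fun setT u1) (mu2 : measurable_fun setT u2).

Lemma measurable_preimage d (Y : measurableType d) (u : Y -> Z) S :
  measurable_fun setT u -> measurable S -> measurable (u @^-1` S).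
Proof. by move=> mu_ mS; rewrite -[X in measurable X]setTI; exact: mu_. Qed.

Lemma preimage_unique (G : set (set Z)) : @measurable _ Z = <<s G >> ->
  setI_closed G -> (forall S, G S -> pr P1 (u1 @^-1` S) = pr P2 (u2 @^-1` S)) ->
  forall S, measurable S -> pr P1 (u1 @^-1` S) = pr P2 (u2 @^-1` S).
Proof.
move=> GE GI agree S; rewrite GE; move: S.
have m1 S : measurable S -> measurable (u1 @^-1` S).
  by move=> mS; exact: measurable_preimage.
have m2 S : measurable S -> measurable (u2 @^-1` S).
  by move=> mS; exact: measurable_preimage.
apply: (@dynkin_induction _ _ G
  (fun S => pr P1 (u1 @^-1` S) = pr P2 (u2 @^-1` S))) => //.
- by rewrite !preimage_setT !prT.
- move=> S mS e.
  have -> : u1 @^-1` (~` S) = ~` (u1 @^-1` S) by [].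
  have -> : u2 @^-1` (~` S) = ~` (u2 @^-1` S) by [].
  by rewrite (prC P1 (m1 _ mS)) (prC P2 (m2 _ mS)) e.
- move=> F mF tF e; rewrite !preimage_bigcup.
  rewrite /pr !measure_semi_bigcup.
  + congr fine; apply: eq_eseriesr => k _.
    rewrite -[LHS]fineK ?fin_num_measure//; last exact: m1.
    rewrite -[RHS]fineK ?fin_num_measure//; last exact: m2.
    by congr EFin; exact: e.
  + by move=> k; exact: m2.
  + apply/trivIsetP => i j _ _ ij; rewrite -preimage_setI.
    by move/trivIsetP : tF => -> //; rewrite preimage_set0.
  + by apply: bigcup_measurable => k _; exact: m2.
  + by move=> k; exact: m1.
  + apply/trivIsetP => i j _ _ ij; rewrite -preimage_setI.
    by move/trivIsetP : tF => -> //; rewrite preimage_set0.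
  + by apply: bigcup_measurable => k _; exact: m1.
Qed.

End preimage_unique.

Section rational_cuts.
Context {R : realType}.

(* Both families are increasing up to null sets, so their unions over rationals
   below [t] are exhausted by single members. *)
Lemma pr_cut_le d1 d2 (Y1 : measurableType d1) (Y2 : measurableType d2)
    (P1 : probability Y1 R) (P2 : probability Y2 R)
    (D1 : rat -> set Y1) (D2 : rat -> set Y2) (t : R) :
  (forall q, measurable (D1 q)) -> (forall q, measurable (D2 q)) ->
  (forall q q', q <= q' -> pr P1 (D1 q `\` D1 q') = 0) ->
  (forall q, pr P1 (D1 q) = pr P2 (D2 q)) ->
  pr P1 (\bigcup_(q in [set q | ratr q < t]) D1 q) <=
  pr P2 (\bigcup_(q in [set q | ratr q < t]) D2 q).
Proof.
move=> m1 m2 mono e12.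
pose F q := if ratr q < t then D1 q else set0.
have FE : \bigcup_(q in [set q | ratr q < t]) D1 q = \bigcup_q F q.
  apply/seteqP; split => y.
    by move=> [q /= qt Dq]; exists q => //; rewrite /F qt.
  by move=> [q _]; rewrite /F; case: ifP => // qt Dq; exists q.
have mF q : measurable (F q) by rewrite /F; case: ifP.
have mFs := measurable_rat_seq mF.
have mU2 : measurable (\bigcup_(q in [set q | ratr q < t]) D2 q).
  rewrite bigcup_mkcond; apply: bigcupT_measurable_rat => q.
  by case: ifP.
rewrite FE -bigcup_rat_seq; apply/ler_addgt0Pr => e e0.
have [n /ltW h] := pr_bigcup_approx P1 mFs e0.
apply: le_trans h _; rewrite lerD2r.
set V := \bigcup_(_ in _) _.
have mV : measurable V by exact: bigcup_ltn_measurable.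
suff : V = set0 \/ exists2 q, ratr q < t & pr P1 (V `\` D1 q) = 0.
  move=> [->|[q qt V0]]; first by rewrite pr0 pr_ge0.
  rewrite (prDI P1 mV (m1 q)) V0 addr0.
  apply: (@le_trans _ _ (pr P1 (D1 q))).
    by apply: le_pr => //; exact: measurableI.
  by rewrite e12; apply: le_pr => // y Dy; exists q.
have {mV} mV n' := bigcup_ltn_measurable n' mFs.
rewrite {}/V; elim: n => [|n [ih|[q qt ih]]].
- by left; rewrite -subset0 => x [].
- rewrite bigcup_ltnS ih set0U /rat_seq; case: unpickle => [q|]; last by left.
  rewrite /F; case: ifPn => qt; last by left.
  by right; exists q => //; rewrite setDv pr0.
- right; rewrite bigcup_ltnS /rat_seq; case: unpickle => [q'|]; last first.
    by exists q => //; rewrite setU0.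
  rewrite /F; case: ifPn => q't; last by exists q => //; rewrite setU0.
  have mVD p : measurable (\bigcup_(k in [set k | (k < n)%N]) rat_seq F k `\` D1 p).
    exact: measurableD.
  have mDD p p' : measurable (D1 p `\` D1 p') by exact: measurableD.
  have [qq'|q'q] := leP q q'.
    exists q' => //; rewrite setDUl setDv setU0.
    apply: (@pr_sub0 _ _ _ _ _ ((\bigcup_(k in [set k | (k < n)%N]) rat_seq F k
      `\` D1 q) `|` (D1 q `\` D1 q'))) => //.
    + exact: measurableU.
    + move=> y [Vy Dy]; case: (pselect (D1 q y)) => Dq; by [right|left].
    + by apply: prU0 => //; exact: mono.
  by exists q => //; rewrite setDUl prU0//; apply: mono; exact: ltW.
Qed.

End rational_cuts.

(** * Standard Borel spaces *)

Section standard.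
Context {d : measure_display} {X : measurableType d} {R : realType}.
Variable f : X -> R.
Hypotheses (finj : injective f) (mf : measurable_fun setT f).
Hypothesis fim : forall A : set X, measurable A -> measurable (f @` A).

Definition ray (q : rat) : set X := [set x | f x < ratr q].

Lemma measurable_ray q : measurable (ray q).
Proof.
rewrite (_ : ray q = f @^-1` `]-oo, ratr q[).
  by apply: measurable_preimage => //; exact: measurable_itv.
by apply/seteqP; split => x; rewrite /ray /= in_itv.
Qed.

Lemma ray_mono q q' : q <= q' -> ray q `<=` ray q'.
Proof. by move=> qq' x /= /lt_le_trans; apply; rewrite ler_rat. Qed.

Lemma bigcup_rays (t : R) :
  [set x | f x < t] = \bigcup_(q in [set q | ratr q < t]) ray q.
Proof.
apply/seteqP; split => x /=.
  move=> xt; have [q] := rat_in_itvoo xt; rewrite in_itv /= => /andP[fq qt].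
  by exists q.
by move=> [q /= qt /lt_trans]; exact.
Qed.

(** By injectivity of [f] a measurable set is the preimage of its image, which is Borel by [fim];
    Borel sets pull back into the sigma-algebra of the rays because every open half-line is a
    countable union of half-lines with rational ends. *)
Lemma rays_generate : @measurable _ X = <<s [set ray q | q in setT] >>.
Proof.
set G := [set ray q | q in setT]; apply/seteqP; split; last first.
  apply: smallest_sub; first exact: sigma_algebra_measurable.
  by move=> _ [q _ <-]; exact: measurable_ray.
move=> A mA.
have sG := smallest_sigma_algebra setT G.
have H : @measurable _ R `<=` [set B : set R | <<s G >> (f @^-1` B)].
  have -> : @measurable _ R = <<s @RGenInftyO.G R >>.
    exact: RGenInftyO.measurableE.
  apply: smallest_sub.
    case: sG => s0 sD sU; split => /=.
    - by rewrite preimage_set0.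
    - move=> B sB; rewrite (_ : f @^-1` _ = setT `\` f @^-1` B) //; exact: sD.
    - by move=> F sF; rewrite preimage_bigcup; exact: sU.
  move=> _ [t ->] /=.
  rewrite (_ : _ @^-1` _ = [set x | f x < t]); last first.
    by apply/seteqP; split => x /=; rewrite in_itv.
  rewrite bigcup_rays bigcup_mkcond -bigcup_rat_seq; case: sG => s0 sD sU.
  apply: sU => k; rewrite /rat_seq; case: unpickle => // q.
  by case: ifP => // _; apply: sub_sigma_algebra; exists q.
have := H _ (fim mA); congr (<<s _ >> _).
by apply/seteqP; split => x /=; [move=> [y Ay /finj <-]|exists x].
Qed.

Lemma rays_setI_closed : setI_closed [set ray q | q in setT].
Proof.
move=> _ _ [q _ <-] [q' _ <-]; exists (Num.min q q') => //.
apply/seteqP; split => x /=.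
  by case: (leP q q') => h xq; split => //; apply: ray_mono xq => //; exact: ltW.
by case: (leP q q') => _ [].
Qed.

Variable mu : probability X R.

(** Events that behave like the rays come from a random point of [X]: the infimum of the rationals
    [q] with [D q y] plays the part of the number [f (h y)]. It has the law of [f] under [mu], so
    almost surely it lies in the range of [f] and can be pulled back. *)
Lemma decode dY (Y : measurableType dY) (nu : probability Y R)
    (D : rat -> set Y) :
  (forall q, measurable (D q)) -> (forall q, pr nu (D q) = pr mu (ray q)) ->
  (forall q q', q <= q' -> pr nu (D q `\` D q') = 0) ->
  exists h : Y -> X, [/\ measurable_fun setT h,
    forall A, measurable A -> pr nu (h @^-1` A) = pr mu A &
    forall q, dist nu (D q) (h @^-1` ray q) = 0].
Proof.
move=> mD Dray Dmono; have x0 : X := point.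
(* Extended real values cover the points that lie in no [D q], or in [D q] for arbitrarily low
   [q]. *)
pose g y := ereal_inf [set (ratr q : R)%:E | q in [set q | D q y]].
have gE t : [set y | (g y < t%:E)%E] = \bigcup_(q in [set q | ratr q < t]) D q.
  apply/seteqP; split => y /=.
    by move=> /ereal_inf_lt[_ [q /= Dq <-]]; rewrite lte_fin => qt; exists q.
  move=> [q /= qt Dq]; apply: (@le_lt_trans _ _ (ratr q)%:E); last by rewrite lte_fin.
  by apply: ereal_inf_lbound; exists q.
have mgt t : measurable [set y | (g y < t%:E)%E].
  rewrite gE bigcup_mkcond; apply: bigcupT_measurable_rat => q.
  by case: ifP.
have mg : measurable_fun setT g.
  apply: (measurability _ (ErealGenInftyO.measurableE R)).
  move=> _ [_ [t ->] <-]; rewrite setTI (_ : _ @^-1` _ = [set y | (g y < t%:E)%E]).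
    exact: mgt.
  by apply/seteqP; split => y /=; rewrite in_itv.
have mEf : measurable_fun setT (EFin \o f) by exact/measurable_EFinP.
have ragree (t : R) : pr nu (g @^-1` `]-oo, t%:E[) = pr mu ((EFin \o f) @^-1` `]-oo, t%:E[).
  have -> : g @^-1` `]-oo, t%:E[ = \bigcup_(q in [set q | ratr q < t]) D q.
    by rewrite -gE; apply/seteqP; split => y /=; rewrite in_itv.
  have -> : (EFin \o f) @^-1` `]-oo, t%:E[ = \bigcup_(q in [set q | ratr q < t]) ray q.
    by rewrite -bigcup_rays; apply/seteqP; split => y /=; rewrite in_itv /= lte_fin.
  apply/eqP; rewrite eq_le; apply/andP; split.
    by apply: pr_cut_le => //; exact: measurable_ray.
  apply: pr_cut_le => //; first exact: measurable_ray.
  move=> q q' qq'; rewrite (_ : _ `\` _ = set0) ?pr0//.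
  by rewrite setD_eq0; exact: ray_mono.
have agree S : measurable S -> pr nu (g @^-1` S) = pr mu ((EFin \o f) @^-1` S).
  apply: (preimage_unique mg mEf (ErealGenInftyO.measurableE R)).
    move=> _ _ [s ->] [t ->]; exists (Num.min s t).
    apply/seteqP; split => y /=; rewrite !in_itv /= EFin_min lt_min.
      by move=> [-> ->].
    by move=> /andP[-> ->].
  by move=> _ [t ->]; exact: ragree.
(* The event that the infimum is the [f]-value of a point of [A]; [gi setT] has full measure. *)
pose gi A := g @^-1` (EFin @` (f @` A)).
have mgi A : measurable A -> measurable (gi A).
  by move=> mA; apply: measurable_preimage => //; apply: measurable_image_EFin; exact: fim.
have pgi A : measurable A -> pr nu (gi A) = pr mu A.
  move=> mA; rewrite agree; last by apply: measurable_image_EFin; exact: fim.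
  congr pr; apply/seteqP; split => x /=; last by move=> Ax; exists (f x) => //; exists x.
  by move=> [_ [y Ay <-]] [/finj <-].
(* Points whose infimum misses the range of [f] go to the default [x0]; they form a null set. *)
pose h y := xget x0 [set x | g y = (f x)%:E].
have hE y x : g y = (f x)%:E -> h y = x.
  move=> gx; rewrite /h; case: xgetP => [x' _ /= gx'|/(_ x)]; last by rewrite /= gx.
  by apply: finj; move: gx'; rewrite gx => -[].
have hN y : ~ gi setT y -> h y = x0.
  move=> ny; rewrite /h; case: xgetP => // x _ /= gx.
  by exfalso; apply: ny; rewrite /gi /=; exists (f x); [exists x|].
have hpre A : h @^-1` A = gi A `|` (if x0 \in A then ~` gi setT else set0).
  apply/seteqP; split => y /=.
    case: (pselect (gi setT y)) => [[_ [x _ <-] gx]|ny].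
      by rewrite (hE _ _ (esym gx)) => Ax; left; exists (f x) => //; exists x.
    by rewrite hN// => Ax0; right; rewrite mem_set.
  move=> [[_ [x Ax <-] gx]|]; first by rewrite (hE _ _ (esym gx)).
  by case: ifPn => // /set_mem Ax0 ny; rewrite hN.
have mjunk A : measurable (if x0 \in A then ~` gi setT else set0).
  by case: ifP => // _; apply: measurableC; exact: mgi.
have junk0 A : pr nu (if x0 \in A then ~` gi setT else set0) = 0.
  case: ifP => _; last exact: pr0.
  by rewrite (prC nu (mgi _ measurableT)) (pgi _ measurableT) prT subrr.
have mh A : measurable A -> measurable (h @^-1` A).
  by move=> mA; rewrite hpre; apply: measurableU => //; exact: mgi.
exists h; split.
- by move=> _ A mA; rewrite setTI; exact: mh.
- move=> A mA; rewrite hpre prU//; last 2 first.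
  + exact: mgi.
  + rewrite -subset0 => y [[_ [x Ax <-] gx]]; case: ifP => // _; apply.
    by exists (f x) => //; exists x.
  by rewrite junk0 addr0; exact: pgi.
- move=> q; set C := \bigcup_(q' in [set q' | ratr q' < (ratr q : R)]) D q'.
  have CE : gi (ray q) `<=` C.
    rewrite /C -gE => y [_ [x xq <-] gy] /=; rewrite -gy lte_fin; exact: xq.
  have mC : measurable C by rewrite /C -gE.
  have C0 : pr nu (C `\` D q) = 0.
    rewrite /C bigcup_mkcond setD_bigcupl; apply: pr_bigcup_rat0 => q'.
      by apply: measurableD => //; case: ifP.
    case: ifPn => [|_]; last by rewrite set0D pr0.
    by rewrite inE /= ltr_rat => /ltW; exact: Dmono.
  have mgq := mgi _ (measurable_ray q).
  have gq0 : pr nu (gi (ray q) `\` D q) = 0.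
    apply: (pr_sub0 _ _ _ C0); [exact: measurableD|exact: measurableD|].
    by move=> y [gy nD]; split => //; exact: CE.
  (* Both sets have the measure of [ray q], so inclusion modulo null sets in one direction gives the
     other. *)
  have Dg0 : pr nu (D q `\` gi (ray q)) = 0.
    have := prDI nu (mD q) mgq; have := prDI nu mgq (mD q).
    rewrite gq0 addr0 setIC (pgi _ (measurable_ray q)) => <-.
    by rewrite Dray -[LHS]addr0 => /addrI.
  have mhq := mh _ (measurable_ray q).
  apply: (@pr_sub0 _ _ _ _ _ ((D q `\` gi (ray q)) `|` (gi (ray q) `\` D q) `|`
    (if x0 \in ray q then ~` gi setT else set0))).
  + exact: measurable_symdiff.
  + by apply: measurableU => //; apply: measurableU; exact: measurableD.
  + rewrite hpre => y [[Dy /not_orP[ny _]]|[[gy|jy] nD]].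
    * by left; left.
    * by left; right.
    * by right.
  + apply: prU0 => //; last apply: prU0 => //; try exact: measurableD.
    by apply: measurableU; exact: measurableD.
Qed.

(** The countably many rational rays separate points, so the exceptional set is a countable union of
    null sets. *)
Lemma rays_ae_eq (U V : X -> X) :
  measurable_fun setT U -> measurable_fun setT V ->
  (forall q, dist mu (U @^-1` ray q) (V @^-1` ray q) = 0) ->
  exists N, [/\ measurable N, pr mu N = 0 & forall x, ~ N x -> U x = V x].
Proof.
move=> mU mV UV; exists (\bigcup_q symdiff (U @^-1` ray q) (V @^-1` ray q)).
have mr (W : X -> X) q : measurable_fun setT W -> measurable (W @^-1` ray q).
  by move=> mW; apply: measurable_preimage => //; exact: measurable_ray.
have ms q : measurable (symdiff (U @^-1` ray q) (V @^-1` ray q)).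
  by apply: measurable_symdiff; exact: mr.
split; first exact: bigcupT_measurable_rat.
  exact: pr_bigcup_rat0.
move=> x nx; apply: finj; apply/eqP; case: ltgtP => // uv; exfalso; apply: nx.
  have [q] := rat_in_itvoo uv; rewrite in_itv /= => /andP[h1 h2].
  by exists q => //; left; split => //=; apply/negP; rewrite -leNgt ltW.
have [q] := rat_in_itvoo uv; rewrite in_itv /= => /andP[h1 h2].
by exists q => //; right; split => //=; apply/negP; rewrite -leNgt ltW.
Qed.

End standard.

(** * Bimeasures and couplings *)

Lemma push_probability d1 d2 (Y : measurableType d1) (Z : measurableType d2)
    (R : realType) (nu : probability Y R) (H : Y -> Z) :
  measurable_fun setT H ->
  exists P : probability Z R, forall A, P A = nu (H @^-1` A).
Proof.
move=> mH.
pose M : {mfun Y >-> Z} := HB.pack H (isMeasurableFun.Build _ _ _ _ H mH).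
by exists (distribution nu M).
Qed.

Section uniform01.
Context {R : realType}.
Local Notation RT := (measurableTypeR R).

(** The source of randomness for couplings. The restricted Lebesgue measure already has mass 1;
    normalising it only supplies the structure of a probability. *)
Lemma unit_interval_probability : exists P : probability RT R,
  forall A, P A = lebesgue_measure (A `&` `[0%R, 1%R[%classic).
Proof.
have m01 : measurable (`[0%R, 1%R[%classic : set RT) by exact: measurable_itv.
have [m mE] : exists m : {measure set RT -> \bar R},
    forall A, m A = lebesgue_measure (A `&` `[0%R, 1%R[%classic).
  by exists (mrestr lebesgue_measure m01).
have m1 : m setT = 1%E.
  by rewrite mE setTI lebesgue_measure_itv /= lte_fin ltr01 oppr0 adde0.
exists (mnormalize m (\d_(0 : RT))) => A; rewrite /= -mE /mnormalize /=.
set e := m _; have -> : e = 1%E by exact: m1.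
by rewrite onee_eq0 /= invr1 mule1.
Qed.

End uniform01.

(** * Finitely additive set functions dominated by a probability *)

Section dominated.
Context {d : measure_display} {X : measurableType d} {R : realType}.
Variable mu : probability X R.

(** Domination stands in for countable additivity: it makes [phi] 1-Lipschitz for [dist mu], hence
    continuous along increasing unions. *)
Definition dominated_additive (phi : set X -> R) : Prop :=
  (forall A, measurable A -> 0 <= phi A <= pr mu A) /\
  (forall A B, measurable A -> measurable B -> A `&` B = set0 ->
    phi (A `|` B) = phi A + phi B).

Variable phi : set X -> R.
Hypothesis hphi : dominated_additive phi.

Lemma domDI A B : measurable A -> measurable B ->
  phi A = phi (A `&` B) + phi (A `\` B).
Proof.
move=> mA mB; rewrite -hphi.2; first by rewrite setUIDK.
- exact: measurableI.
- exact: measurableD.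
- by rewrite -subset0 => x [[_ ?] []].
Qed.

Lemma dom0 : phi set0 = 0.
Proof.
by apply/eqP; rewrite eq_le andbC; have := hphi.1 _ measurable0; rewrite pr0.
Qed.

Lemma dom_dist A B : measurable A -> measurable B ->
  `|phi A - phi B| <= dist mu A B.
Proof.
move=> mA mB; rewrite /dist prU; last 3 first.
- exact: measurableD.
- exact: measurableD.
- by rewrite -subset0 => x [[? ?] []].
have := domDI mA mB; have := domDI mB mA; rewrite setIC => -> ->.
have /andP[] := hphi.1 _ (measurableD mA mB).
have /andP[] := hphi.1 _ (measurableD mB mA).
by rewrite ler_norml => *; apply/andP; split; lra.
Qed.

Lemma dom_bigcup_approx (F : nat -> set X) (e : R) :
  (forall k, measurable (F k)) -> 0 < e -> exists N, forall n, (N <= n)%N ->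
  `|phi (\bigcup_k F k) - phi (\bigcup_(k in [set k | (k < n)%N]) F k)| < e.
Proof.
move=> mF e0; have [N hN] := pr_bigcup_approx mu mF e0.
exists N => n Nn; have mU : measurable (\bigcup_k F k) by exact: bigcup_measurable.
have mV m := bigcup_ltn_measurable m mF.
apply: le_lt_trans (dom_dist mU (mV n)) _; rewrite /dist /symdiff.
have VU m : \bigcup_(k in [set k | (k < m)%N]) F k `<=` \bigcup_k F k.
  by move=> x [k _ Fk]; exists k.
have -> : \bigcup_(k in [set k | (k < n)%N]) F k `\` \bigcup_k F k = set0.
  by rewrite setD_eq0.
rewrite setU0; move: hN; rewrite (prDI mu mU (mV N)) setIidr// ltrD2l.
apply: le_lt_trans; apply: le_pr; [exact: measurableD|exact: measurableD|].
move=> x [Ux nV]; split => // -[k /= kN Fk]; apply: nV; exists k => //=.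
exact: leq_trans Nn.
Qed.

End dominated.

(** Dynkin induction in which a disjoint countable union is reached through its finite truncations,
    by the continuity that domination provides. *)
Lemma dominated_unique d (X : measurableType d) (R : realType)
    (mu : probability X R) (phi psi : set X -> R) (G : set (set X)) :
  dominated_additive mu phi -> dominated_additive mu psi ->
  @measurable _ X = <<s G >> -> setI_closed G -> phi setT = psi setT ->
  (forall A, G A -> phi A = psi A) ->
  forall A, measurable A -> phi A = psi A.
Proof.
move=> hp hs GE GI eT eG A; rewrite GE; move: A.
apply: (@dynkin_induction _ _ G (fun A => phi A = psi A)) => //.
- move=> A mA e; have := domDI hp (@measurableT _ X) mA.
  by rewrite eT (domDI hs (@measurableT _ X) mA) !setTI !setTD e => /addrI ->.
- move=> F mF tF e.
  have eV n : phi (\bigcup_(k in [set k | (k < n)%N]) F k) =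
              psi (\bigcup_(k in [set k | (k < n)%N]) F k).
    elim: n => [|n ih].
      rewrite (_ : \bigcup_(_ in _) _ = set0); last by rewrite -subset0 => x [].
      by rewrite (dom0 hp) (dom0 hs).
    have dis : \bigcup_(k in [set k | (k < n)%N]) F k `&` F n = set0.
      rewrite -subset0 => x [[k /= kn Fk] Fn].
      move/trivIsetP : tF => /(_ k n Logic.I Logic.I).
      by rewrite neq_ltn kn => /(_ isT)/seteqP[/(_ x) h _]; apply: h.
    have mV := bigcup_ltn_measurable n mF.
    by rewrite bigcup_ltnS hp.2// hs.2// ih e.
  apply/eqP; rewrite -subr_eq0 -normr_le0; apply/ler_addgt0Pr => r r0; rewrite add0r.
  have r20 : 0 < r / 2 by rewrite divr_gt0.
  have [N1 h1] := dom_bigcup_approx hp mF r20.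
  have [N2 h2] := dom_bigcup_approx hs mF r20.
  have := h1 _ (leq_maxl N1 N2); have := h2 _ (leq_maxr N1 N2); rewrite eV.
  set a := psi _; set b := psi _; set c := phi _ => hb hc.
  rewrite (_ : c - a = (c - b) - (a - b)); last by ring.
  by apply: le_trans (ler_normB _ _) _; rewrite (splitr r) lerD// ltW.
Qed.

Section bimeasure.
Context {d : measure_display} {X : measurableType d} {R : realType}.
Variable mu : probability X R.

(** All clauses are equalities or weak inequalities between finitely many values, so they pass to
    averages and to limits along an ultrafilter. *)
Definition bimeasure (beta : set X -> set X -> R) : Prop :=
  [/\ forall A B, measurable A -> measurable B -> 0 <= beta A B,
   forall A A' B, measurable A -> measurable A' -> measurable B ->
     A `&` A' = set0 -> beta (A `|` A') B = beta A B + beta A' B,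
   forall A B B', measurable A -> measurable B -> measurable B' ->
     B `&` B' = set0 -> beta A (B `|` B') = beta A B + beta A B',
   forall A, measurable A -> beta A setT = pr mu A &
   forall B, measurable B -> beta setT B = pr mu B].

Variable beta : set X -> set X -> R.
Hypothesis hb : bimeasure beta.

Lemma bimeasure_domr A : measurable A -> dominated_additive mu (beta A).
Proof.
case: hb => b0 bl br bml bmr mA; split; last by move=> B B' *; exact: br.
move=> B mB; rewrite b0//= -bmr// -(setUv A) bl//.
- by rewrite lerDl b0//; exact: measurableC.
- exact: measurableC.
- exact: setICr.
Qed.

Lemma bimeasure_doml B : measurable B -> dominated_additive mu (beta ^~ B).
Proof.
case: hb => b0 bl br bml bmr mB; split; last by move=> A A' *; exact: bl.
move=> A mA; rewrite b0//= -bml// -(setUv B) br//.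
- by rewrite lerDl b0//; exact: measurableC.
- exact: measurableC.
- exact: setICr.
Qed.

Lemma bimeasure_dist A A' B B' : measurable A -> measurable A' ->
  measurable B -> measurable B' ->
  `|beta A B - beta A' B'| <= dist mu A A' + dist mu B B'.
Proof.
move=> mA mA' mB mB'.
rewrite (_ : _ - _ = (beta A B - beta A' B) + (beta A' B - beta A' B')); last by ring.
apply: le_trans (ler_normD _ _) _; apply: lerD.
  exact: (dom_dist (bimeasure_doml mB)).
exact: (dom_dist (bimeasure_domr mA')).
Qed.

End bimeasure.

(** * Realisation of a bimeasure on the unit interval *)

Section realization.
Context {d : measure_display} {X : measurableType d} {R : realType}.
Variables (mu : probability X R) (beta : set X -> set X -> R).
Hypothesis hb : bimeasure mu beta.
Variable E : nat -> set X.
Hypothesis mE : forall k, measurable (E k).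

Local Notation RT := (measurableTypeR R).

(* Words list the most recent bit first: bit [2 k] decides [x \in E k] and bit
   [2 k + 1] decides [y \in E k]. *)
Definition cut (b : bool) (k : nat) : set X := if b then E k else ~` E k.

Fixpoint cellx (t : seq bool) : set X :=
  if t is b :: t' then
    if odd (size t') then cellx t' else cellx t' `&` cut b (size t')./2
  else setT.

Fixpoint celly (t : seq bool) : set X :=
  if t is b :: t' then
    if odd (size t') then celly t' `&` cut b (size t')./2 else celly t'
  else setT.

Lemma measurable_cut b k : measurable (cut b k).
Proof. by case: b => //=; exact: measurableC. Qed.

Lemma measurable_cellx t : measurable (cellx t).
Proof.
elim: t => //= b t ih; case: ifP => // _; apply: measurableI => //.
exact: measurable_cut.
Qed.

Lemma measurable_celly t : measurable (celly t).
Proof.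
elim: t => //= b t ih; case: ifP => // _; apply: measurableI => //.
exact: measurable_cut.
Qed.

Lemma cut_split (A : set X) k :
  A = (A `&` cut true k) `|` (A `&` cut false k).
Proof. by rewrite -setIUr /cut setUv setIT. Qed.

Lemma cut_disj (A : set X) k : (A `&` cut true k) `&` (A `&` cut false k) = set0.
Proof. by rewrite -subset0 => x [[_ /= h] [_ /(_ h)]]. Qed.

Lemma beta_split A B t : measurable A -> measurable B ->
  beta (A `&` cellx t) (B `&` celly t) =
  beta (A `&` cellx (true :: t)) (B `&` celly (true :: t)) +
  beta (A `&` cellx (false :: t)) (B `&` celly (false :: t)).
Proof.
move=> mA mB; have [_ bl br _ _] := hb.
have mx := measurableI _ _ mA (measurable_cellx t).
have my := measurableI _ _ mB (measurable_celly t).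
have mc Z b k : measurable Z -> measurable (Z `&` cut b k).
  by move=> mZ; apply: measurableI => //; exact: measurable_cut.
rewrite /=; case: ifP => _.
  rewrite [in LHS](cut_split (B `&` celly t) (size t)./2) !setIA br//.
  - by apply: mc.
  - by apply: mc.
  - exact: cut_disj.
rewrite [in LHS](cut_split (A `&` cellx t) (size t)./2) !setIA bl//.
- by apply: mc.
- by apply: mc.
- exact: cut_disj.
Qed.

Definition mass t := beta (cellx t) (celly t).

Lemma mass_split t : mass t = mass (true :: t) + mass (false :: t).
Proof.
have := beta_split t measurableT measurableT.
by rewrite !setTI.
Qed.

Lemma mass_ge0 t : 0 <= mass t.
Proof.
case: hb => b0 _ _ _ _; apply: b0; [exact: measurable_cellx|exact: measurable_celly].
Qed.

(** The words of each length cut [0, 1[ into consecutive half-open intervals of lengths [mass t];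
    this is the left end of the interval of [t]. The child [true] takes the left part of its
    parent. *)
Fixpoint start (t : seq bool) : R :=
  if t is b :: t' then start t' + (if b then 0 else mass (true :: t')) else 0.

Fixpoint code (n : nat) (u : R) : seq bool :=
  if n is n'.+1 then
    let t := code n' u in (u < start t + mass (true :: t)) :: t
  else [::].

Lemma size_code n u : size (code n u) = n.
Proof. by elim: n => //= n ->. Qed.

Lemma start_ge0 t : 0 <= start t.
Proof.
elim: t => //= b t ih; apply: addr_ge0 => //; case: b => //; exact: mass_ge0.
Qed.

Lemma start_mass_le1 t : start t + mass t <= 1.
Proof.
elim: t => [|b t ih].
  by rewrite /= add0r /mass /=; case: hb => _ _ _ -> //; rewrite prT.
apply: le_trans ih; rewrite (mass_split t); case: b => /=.
  by rewrite addr0 lerD2l lerDl mass_ge0.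
by rewrite addrA.
Qed.

Lemma codeP t u : 0 <= u < 1 ->
  code (size t) u = t <-> start t <= u < start t + mass t.
Proof.
move=> u01; elim: t => [|b t ih].
  split => //= _; rewrite add0r (_ : mass _ = 1) //.
  by rewrite /mass /=; case: hb => _ _ _ -> //; rewrite prT.
have m0 := mass_ge0 (true :: t); have m1 := mass_ge0 (false :: t).
have ms := mass_split t.
split=> [/= [hb' ht]|/andP[h1 h2]].
  move: hb'; rewrite ht => hb'; move/ih : ht => /andP[a1 a2].
  case: b hb' => /= h; first by rewrite addr0 a1.
  by move: h => /negbT; rewrite -leNgt => ->; rewrite -addrA -ms.
have ht : code (size t) u = t.
  apply/ih; rewrite ms; case: b h1 h2 => /= h1 h2; apply/andP; split; lra.
rewrite /= ht; congr (_ :: _); case: b h1 h2 => /= h1 h2; last by rewrite ltNge h1.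
by move: h2; rewrite addr0.
Qed.

Lemma measurable_ltr (c : R) : measurable ([set u | u < c] : set RT).
Proof.
rewrite (_ : [set _ | _] = `]-oo, c[%classic); first exact: measurable_itv.
by apply/seteqP; split => x; rewrite /= in_itv.
Qed.

Lemma code_consE b t : [set u | code (size t).+1 u = b :: t] =
  [set u | code (size t) u = t] `&`
  (if b then [set u | u < start t + mass (true :: t)]
   else ~` [set u | u < start t + mass (true :: t)]).
Proof.
apply/seteqP; split => u /=.
  by move=> [h ht]; rewrite ht in h; split => //; case: b h => //= /negbT /negP.
by move=> [-> h]; congr (_ :: _); case: b h => // /negP/negbTE.
Qed.

Lemma measurable_code t : measurable ([set u | code (size t) u = t] : set RT).
Proof.
elim: t => [|b t ih] /=; first by rewrite (_ : [set _ | _] = setT)// -subTset.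
have h := code_consE b t; rewrite /= in h; rewrite h; apply: measurableI => //.
by case: b {h}; [|apply: measurableC]; exact: measurable_ltr.
Qed.

Lemma measurable_code_pred n (p : pred (seq bool)) :
  measurable ([set u | p (code n u)] : set RT).
Proof.
elim: n p => [|n ih] p /=.
  by case: (p [::]); [rewrite (_ : [set _ | _] = setT)// -subTset|
    rewrite (_ : [set _ | _] = set0)// -subset0].
have mt t : size t = n ->
    measurable ([set u | code n u = t /\ u < start t + mass (true :: t)] : set RT).
  move=> <-; have -> : [set u | code (size t) u = t /\ u < start t + mass (true :: t)]
    = [set u | code (size t) u = t] `&` [set u | u < start t + mass (true :: t)] by [].
  by apply: measurableI; [exact: measurable_code|exact: measurable_ltr].
have mC : measurable ([set u | u < start (code n u) + mass (true :: code n u)] : set RT).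
  rewrite (_ : [set _ | _] = \bigcup_(t in [set: n.-tuple bool])
     [set u | code n u = t /\ u < start t + mass (true :: tval t)]).
    apply: fin_bigcup_measurable; first exact: finite_finset.
    by move=> t _; apply: mt; rewrite size_tuple.
  apply/seteqP; split => u /=; last by move=> [t _ /= [-> ]].
  move=> h; have sz : size (code n u) == n by rewrite size_code.
  by exists (Tuple sz).
rewrite (_ : [set _ | _] =
  ([set u | p (true :: code n u)] `&`
     [set u | u < start (code n u) + mass (true :: code n u)]) `|`
  ([set u | p (false :: code n u)] `\`
     [set u | u < start (code n u) + mass (true :: code n u)])).
  apply: measurableU; [apply: measurableI|apply: measurableD] => //.
  - exact: (ih (fun t => p (true :: t))).
  - exact: (ih (fun t => p (false :: t))).
apply/seteqP; split => u /=.
  by case: ltP => h ph; [left|right; split].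
by move=> [[h ->]|[h /negP/negbTE ->]].
Qed.

Variable nu : probability RT R.
Hypothesis nuE : forall A, nu A = lebesgue_measure (A `&` `[0%R, 1%R[%classic).

Lemma pr_code t : pr nu [set u | code (size t) u = t] = mass t.
Proof.
rewrite /pr nuE (_ : _ `&` _ = `[start t, start t + mass t[%classic).
  rewrite lebesgue_measure_itv /= lte_fin ltrDl; case: ltP => m0 /=.
    by rewrite addrAC subrr add0r.
  by apply/eqP; rewrite eq_sym eq_le m0 mass_ge0.
apply/seteqP; split => u /=; rewrite !in_itv /=.
  by move=> [h u01]; apply/codeP.
move=> h; have u01 : 0 <= u < 1.
  have := start_ge0 t; have := start_mass_le1 t; case/andP: h => *.
  by apply/andP; split; lra.
by split => //; apply/codeP.
Qed.

(** The product cells of the words of length [N] partition the plane, and [p] marks those that fill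
    the rectangle. The induction is on the number of bits still to be read: a full word contributes
    its mass or 0, and additivity of [beta] joins the two children of a word. *)
Lemma pr_code_pred N A B (p : pred (seq bool)) : measurable A -> measurable B ->
  (forall t, size t = N -> if p t then cellx t `<=` A /\ celly t `<=` B
     else A `&` cellx t = set0 \/ B `&` celly t = set0) ->
  pr nu [set u | p (code N u)] = beta A B.
Proof.
move=> mA mB dec.
have H m t : (size t + m = N)%N ->
    beta (A `&` cellx t) (B `&` celly t) =
    pr nu ([set u | code (size t) u = t] `&` [set u | p (code N u)]).
  elim: m t => [|m ih] t szt.
    move: szt; rewrite addn0 => szt; have := dec _ szt; case: ifPn => pt.
      move=> [sx sy]; rewrite (setIidr sx) (setIidr sy) -[LHS]/(mass t) -pr_code.
      congr pr; apply/seteqP; split => u /=; last by case.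
      by move=> ct; split => //; rewrite -szt ct.
    have -> : [set u | code (size t) u = t] `&` [set u | p (code N u)] = set0.
      rewrite -subset0 => u [/= h]; rewrite -szt h; exact/negP.
    rewrite pr0; move=> [->|->].
      by rewrite (dom0 (bimeasure_doml hb (measurableI _ _ mB (measurable_celly t)))).
    by rewrite (dom0 (bimeasure_domr hb (measurableI _ _ mA (measurable_cellx t)))).
  rewrite beta_split// !ih /= ?addSnnS//.
  have mc b := measurable_code (b :: t); have mp := measurable_code_pred N p.
  rewrite -prU; [congr pr| | |].
  - rewrite -setIUl; congr (_ `&` _).
    have e1 := code_consE true t; have e2 := code_consE false t.
    by rewrite /= in e1 e2; rewrite e1 e2 -setIUr setUv setIT.
  - by apply: measurableI => //; exact: (mc true).
  - by apply: measurableI => //; exact: (mc false).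
  - by rewrite -subset0 => u [[/= [h1 h2] _] [[h3 _] _]]; rewrite h2 in h1 h3; rewrite h1 in h3.
have := H N [::] (erefl _); rewrite /= !setIT => ->; congr pr.
by apply/seteqP; split => u //= -[].
Qed.

Definition bit n u := head false (code n.+1 u).

(** Codes grow at the head, which reverses positions: the bit written at stage [n] sits at
    [N - n.+1] in a code of length [N]. *)
Lemma nth_code n N u : (n < N)%N -> nth false (code N u) (N - n.+1) = bit n u.
Proof.
elim: N => // N ih; rewrite ltnS leq_eqVlt => /orP[/eqP ->|nN].
  by rewrite subnn.
by rewrite subSS -(subnSK nN) /= ih.
Qed.

Lemma cellx_nth t k : (k.*2 < size t)%N ->
  cellx t `<=` cut (nth false t (size t - k.*2.+1)) k.
Proof.
elim: t => //= b t ih; rewrite ltnS leq_eqVlt => /orP[/eqP kt|kt].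
  rewrite -kt subnn /= odd_double doubleK; exact: subIsetr.
rewrite subSS; have := ih kt.
rewrite -(subnSK kt) /= => h; case: ifP => // _; apply: subset_trans h.
exact: subIsetl.
Qed.

Lemma celly_nth t k : (k.*2.+1 < size t)%N ->
  celly t `<=` cut (nth false t (size t - k.*2.+2)) k.
Proof.
elim: t => //= b t ih; rewrite ltnS leq_eqVlt => /orP[/eqP kt|kt].
  rewrite -kt subnn /= odd_double /= uphalf_double; exact: subIsetr.
rewrite subSS; have := ih kt.
rewrite -(subnSK kt) /= => h; case: ifP => // _; apply: subset_trans h.
exact: subIsetl.
Qed.

End realization.

Section realize.
Context {d : measure_display} {X : measurableType d} {R : realType}.
Variables (mu : probability X R) (beta : set X -> set X -> R).
Hypothesis hb : bimeasure mu beta.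
Variable f : X -> R.
Hypotheses (finj : injective f) (mf : measurable_fun setT f).
Hypothesis fim : forall A : set X, measurable A -> measurable (f @` A).
Local Notation RT := (measurableTypeR R).
Local Notation ray := (ray f).

(** [D1 q] and [D2 q] are the events that the first, respectively the second, coordinate lies in
    [ray q], read off the bits of index [2 k q] and [2 k q + 1]. Every relation between two of them
    is decided by words long enough to contain both bits. *)
Lemma bits_of_bimeasure (E : nat -> set X) (k : rat -> nat)
    (nu : probability RT R) : (forall n, measurable (E n)) ->
  (forall q, E (k q) = ray q) ->
  (forall A, nu A = lebesgue_measure (A `&` `[0%R, 1%R[%classic)) ->
  exists D1 D2 : rat -> set RT,
  [/\ forall q, measurable (D1 q) /\ measurable (D2 q),
   forall q, pr nu (D1 q) = pr mu (ray q) /\ pr nu (D2 q) = pr mu (ray q),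
   forall q q', q <= q' -> pr nu (D1 q `\` D1 q') = 0 /\ pr nu (D2 q `\` D2 q') = 0 &
   forall q q', pr nu (D1 q `&` D2 q') = beta (ray q) (ray q')].
Proof.
move=> mE Ek nuE; have [_ _ _ bml bmr] := hb.
pose bt n u := bit beta E n u.
pose w N n (t : seq bool) := nth false t (N - n.+1).
have wE N n u : (n < N)%N -> w N n (code beta E N u) = bt n u.
  by move=> nN; exact: nth_code.
have decx N t q : ((k q).*2 < N)%N -> size t = N ->
    if w N (k q).*2 t then cellx E t `<=` ray q else cellx E t `<=` ~` ray q.
  move=> kN szt; have := @cellx_nth _ _ E t (k q); rewrite szt => /(_ kN).
  by rewrite /cut Ek -/(w N (k q).*2 t); case: ifP.
have decy N t q : ((k q).*2.+1 < N)%N -> size t = N ->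
    if w N (k q).*2.+1 t then celly E t `<=` ray q else celly E t `<=` ~` ray q.
  move=> kN szt; have := @celly_nth _ _ E t (k q); rewrite szt => /(_ kN).
  by rewrite /cut Ek -/(w N (k q).*2.+1 t); case: ifP.
have disj (A C : set X) : C `<=` ~` A -> A `&` C = set0.
  by move=> CA; rewrite -subset0 => x [Ax /CA].
have mr q : measurable (ray q) by exact: measurable_ray.
have b0x B : measurable B -> beta set0 B = 0.
  by move=> mB; exact: (dom0 (bimeasure_doml hb mB)).
have b0y A : measurable A -> beta A set0 = 0.
  by move=> mA; exact: (dom0 (bimeasure_domr hb mA)).
have mono q q' : q <= q' -> ray q `\` ray q' = set0.
  by move=> qq'; rewrite setD_eq0; exact: ray_mono.
have mb n : measurable ([set u | bt n u] : set RT).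
  exact: (measurable_code_pred beta E n.+1 (head false)).
exists (fun q => [set u | bt (k q).*2 u]), (fun q => [set u | bt (k q).*2.+1 u]).
split.
- by [].
- move=> q; split.
  + rewrite -bml//; pose N := (k q).*2.+1.
    rewrite -(pr_code_pred hb mE nuE (N := N) (p := w N (k q).*2)) //.
    * by congr pr; apply/seteqP; split => u /=; rewrite wE.
    * by move=> t /(decx _ _ q (ltnSn _)); case: ifP => // _ /disj; left.
  + rewrite -bmr//; pose N := (k q).*2.+2.
    rewrite -(pr_code_pred hb mE nuE (N := N) (p := w N (k q).*2.+1)) //.
    * by congr pr; apply/seteqP; split => u /=; rewrite wE.
    * by move=> t /(decy _ _ q (ltnSn _)); case: ifP => // _ /disj; right.
- move=> q q' qq'; pose N := (maxn (k q).*2.+2 (k q').*2.+2).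
  have l1 : ((k q).*2.+1 < N)%N by rewrite leq_max leqnn.
  have l2 : ((k q').*2.+1 < N)%N by rewrite leq_max leqnn orbT.
  have l3 := ltnW l1; have l4 := ltnW l2.
  split.
  + rewrite -(b0x _ (@measurableT _ X)) -(mono _ _ qq').
    rewrite -(pr_code_pred hb mE nuE (N := N)
      (p := fun t => w N (k q).*2 t && ~~ w N (k q').*2 t)) //.
    * congr pr; apply/seteqP; split => u /=; rewrite !wE//.
        by move=> [-> /negP].
      by move=> /andP[-> /negP].
    * exact: measurableD.
    * move=> t szt; have := decx _ _ q l3 szt; have := decx _ _ q' l4 szt.
      case: ifP => _ h'; case: ifP => _ h //=.
      - by left; rewrite -subset0 => x [[_ nr] /h'].
      - by left; rewrite -subset0 => x [[rx _] /h].
      - by split => // x cx; split; [exact: h|exact: h'].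
      - by left; rewrite -subset0 => x [[rx _] /h].
  + rewrite -(b0y _ (@measurableT _ X)) -(mono _ _ qq').
    rewrite -(pr_code_pred hb mE nuE (N := N)
      (p := fun t => w N (k q).*2.+1 t && ~~ w N (k q').*2.+1 t)) //.
    * congr pr; apply/seteqP; split => u /=; rewrite !wE//.
        by move=> [-> /negP].
      by move=> /andP[-> /negP].
    * exact: measurableD.
    * move=> t szt; have := decy _ _ q l1 szt; have := decy _ _ q' l2 szt.
      case: ifP => _ h'; case: ifP => _ h //=.
      - by right; rewrite -subset0 => x [[_ nr] /h'].
      - by right; rewrite -subset0 => x [[rx _] /h].
      - by split => // x cx; split; [exact: h|exact: h'].
      - by right; rewrite -subset0 => x [[rx _] /h].
- move=> q q'; pose N := (maxn (k q).*2.+2 (k q').*2.+2).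
  have l1 : ((k q).*2.+1 < N)%N by rewrite leq_max leqnn.
  have l2 : ((k q').*2.+1 < N)%N by rewrite leq_max leqnn orbT.
  have l3 := ltnW l1.
  rewrite -(pr_code_pred hb mE nuE (N := N)
      (p := fun t => w N (k q).*2 t && w N (k q').*2.+1 t)) //.
  + congr pr; apply/seteqP; split => u /=; rewrite !wE//.
      by move=> [-> ->].
    by move=> /andP[].
  + move=> t szt; have := decx _ _ q l3 szt; have := decy _ _ q' l2 szt.
    by case: ifP => _ h'; case: ifP => _ h //=; [left|right|left]; exact: disj.
Qed.

(** The bits are decoded once for each coordinate, and the coupling is the joint law of the two
    decoded points. Agreement with [beta] on pairs of rays extends to rectangles one argument at a
    time. *)
Lemma bimeasure_realization : exists xi : probability (X * X)%type R,
  forall A B, measurable A -> measurable B -> cval xi A B = beta A B.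
Proof.
have [nu nuE] := @unit_interval_probability R.
have mr q : measurable (ray q) by exact: measurable_ray.
have := @bits_of_bimeasure (rat_seq ray) pickle nu (measurable_rat_seq mr) _ nuE.
case; first by move=> q; rewrite /rat_seq pickleK.
move=> D1 [D2 [mD Dray Dmono D12]].
have [h1 [mh1 ph1 dh1]] := decode finj mf fim (fun q => (mD q).1)
  (fun q => (Dray q).1) (fun q q' qq' => (Dmono q q' qq').1).
have [h2 [mh2 ph2 dh2]] := decode finj mf fim (fun q => (mD q).2)
  (fun q => (Dray q).2) (fun q q' qq' => (Dmono q q' qq').2).
have mH : measurable_fun setT (fun u => (h1 u, h2 u)).
  exact: measurable_fun_pair.
have [xi xiE] := push_probability nu mH.
exists xi => A B mA mB.
have -> : cval xi A B = pr nu (h1 @^-1` A `&` h2 @^-1` B).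
  by rewrite /cval xiE.
have [_ _ _ bml bmr] := hb.
have m1 C : measurable C -> measurable (h1 @^-1` C) by move=> *; exact: measurable_preimage.
have m2 C : measurable C -> measurable (h2 @^-1` C) by move=> *; exact: measurable_preimage.
have GE := rays_generate finj mf fim.
have GI : setI_closed [set ray q | q in setT] by exact: rays_setI_closed.
have dr C : measurable C ->
    dominated_additive mu (fun A => pr nu (h1 @^-1` A `&` h2 @^-1` C)).
  move=> mC; split => [Z mZ|Z Z' mZ mZ' ZZ'].
    rewrite pr_ge0 /= -ph1//; apply: le_pr; [|exact: m1|exact: subIsetl].
    by apply: measurableI; [exact: m1|exact: m2].
  rewrite preimage_setU setIUl prU//.
  - by apply: measurableI; [exact: m1|exact: m2].
  - by apply: measurableI; [exact: m1|exact: m2].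
  - rewrite -subset0 => u [[z _] [z' _]].
    by have : (Z `&` Z') (h1 u) by []; rewrite ZZ'.
have dl C : measurable C ->
    dominated_additive mu (fun B => pr nu (h1 @^-1` C `&` h2 @^-1` B)).
  move=> mC; split => [Z mZ|Z Z' mZ mZ' ZZ'].
    rewrite pr_ge0 /= -ph2//; apply: le_pr; [|exact: m2|exact: subIsetr].
    by apply: measurableI; [exact: m1|exact: m2].
  rewrite preimage_setU setIUr prU//.
  - by apply: measurableI; [exact: m1|exact: m2].
  - by apply: measurableI; [exact: m1|exact: m2].
  - rewrite -subset0 => u [[_ z] [_ z']].
    by have : (Z `&` Z') (h2 u) by []; rewrite ZZ'.
apply: (dominated_unique (dl _ mA) (bimeasure_domr hb mA) GE GI _ _ mB).
  by rewrite preimage_setT setIT bml// ph1.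
move=> _ [q' _ <-].
apply: (dominated_unique (dr _ (mr q')) (bimeasure_doml hb (mr q')) GE GI _ _ mA).
  by rewrite preimage_setT setTI bmr// ph2.
move=> _ [q _ <-]; rewrite -D12.
have mD1 q0 := (mD q0).1; have mD2 q0 := (mD q0).2.
apply: dist0_pr.
- by apply: measurableI; [exact: m1|exact: m2].
- exact: measurableI.
apply/eqP; rewrite eq_le dist_ge0 andbT.
apply: le_trans (distI nu _ _ _ _) _ => //; [exact: m1|exact: m2|].
by rewrite (distC nu _ (D1 q)) (distC nu _ (D2 q')) dh1 dh2 addr0.
Qed.

End realize.

(** * Mixing of K-systems *)

Section tail.
Context {d : measure_display} {X : measurableType d} {R : realType}.
Variables (mu : probability X R) (F : nat -> set (set X)).
Hypotheses (sF : forall n, sigma_algebra setT (F n))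
  (Fm : forall n, F n `<=` measurable) (Fdec : forall n, F n.+1 `<=` F n)
  (Ftail : forall E, (forall n, F n E) -> pr mu E = 0 \/ pr mu E = 1).

Let F0 n : F n set0.
Proof. by case: (sF n). Qed.

Let FC n A : F n A -> F n (~` A).
Proof. by case: (sF n) => _ + _ FA => /(_ _ FA); rewrite setTD. Qed.

Let FU n (G : nat -> set X) : (forall k, F n (G k)) -> F n (\bigcup_k G k).
Proof. by case: (sF n) => _ _; exact. Qed.

Let FI n A B : F n A -> F n B -> F n (A `&` B).
Proof.
move=> FA FB; rewrite -[A `&` B]setCK setCI; apply: FC.
by rewrite -bigcup2E; apply: FU => -[|[|k]] /=; [exact: FC|exact: FC|exact: F0].
Qed.

Let Fle n m : (n <= m)%N -> F m `<=` F n.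
Proof.
move=> /subnK <-; elim: (m - n)%N => // k ih A; rewrite addSn => /Fdec; exact: ih.
Qed.

Variable A : set X.
Hypothesis mA : measurable A.

Definition covar (B : set X) : R := pr mu (A `&` B) - pr mu A * pr mu B.

Lemma covarC B : measurable B -> covar (~` B) = - covar B.
Proof.
move=> mB; rewrite /covar prC// -setDE.
by have := prDI mu mA mB => e; rewrite mulrBr mulr1; lra.
Qed.

Lemma covarUI B C : measurable B -> measurable C ->
  covar (B `|` C) = covar B + covar C - covar (B `&` C).
Proof.
have H D E : measurable D -> measurable E ->
    pr mu (D `|` E) = pr mu D + pr mu E - pr mu (D `&` E).
  move=> mD mE; have -> : D `|` E = D `|` (E `\` D).
    apply/seteqP; split => x; last by move=> [|[]]; by [left|right].
    by case: (pselect (D x)) => Dx [] ?; by [left|right].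
  rewrite prU//; last 2 first.
  - exact: measurableD.
  - by rewrite -subset0 => x [? []].
  by rewrite (prDI mu mE mD) setIC; lra.
move=> mB mC; rewrite /covar (H B C)// setIUr (H (A `&` B) (A `&` C)).
- have -> : A `&` B `&` (A `&` C) = A `&` (B `&` C) by rewrite setIACA setIid.
  by rewrite !mulrDr mulrN; lra.
- exact: measurableI.
- exact: measurableI.
Qed.

Lemma covar_dist B C : measurable B -> measurable C ->
  `|covar B - covar C| <= 2 * dist mu B C.
Proof.
move=> mB mC; rewrite /covar.
have h1 := pr_dist_le mu (measurableI _ _ mA mB) (measurableI _ _ mA mC).
have h2 := distI mu mA mA mB mC; rewrite distxx add0r in h2.
have h3 := pr_dist_le mu mB mC.
have h4 := pr_ge0 mu A; have h5 := pr_le1 mu mA.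
rewrite (_ : _ - _ = (pr mu (A `&` B) - pr mu (A `&` C)) -
  pr mu A * (pr mu B - pr mu C)); last by ring.
apply: le_trans (ler_normB _ _) _; rewrite normrM (ger0_norm h4).
rewrite mulr_natl mulr2n; apply: lerD; first exact: le_trans h1 h2.
by apply: le_trans h3; rewrite ler_piMl.
Qed.

Lemma covar_ub B : measurable B -> covar B <= 1.
Proof.
move=> mB; rewrite /covar; have := pr_le1 mu (measurableI _ _ mA mB).
by have := mulr_ge0 (pr_ge0 mu A) (pr_ge0 mu B); lra.
Qed.

(* If near-maximisers [B n] of [covar] over [F n] stayed above [e], then adding
   them to later ones would lose at most their defect, because the intersection
   is still in [F n]; so [limsup B n] would be a tail set with positive [covar]. *)
Lemma tail_mixing (e : R) : 0 < e ->
  exists n, forall B, F n B -> `|covar B| <= e.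
Proof.
move=> e0; apply/not_existsP => H.
have {}H n : exists2 B, F n B & e < covar B.
  have /existsNP[B /not_implyP[FB /negP]] := H n; rewrite -ltNge ltr_normr.
  move=> /orP[|] h; first by exists B.
  by exists (~` B); [exact: FC|rewrite covarC//; exact: Fm FB].
(* These defects add up to [2 * ep 0 = e / 2], so half of [e] survives all the unions. *)
pose ep n : R := e / 4 / 2 ^+ n.
have ep0 n : 0 < ep n by rewrite /ep divr_gt0 ?divr_gt0 ?exprn_gt0.
have epS n : ep n + 2 * ep n.+1 = 2 * ep n.
  rewrite /ep exprS; field; exact/lt0r_neq0/exprn_gt0.
have : forall n, exists B, F n B /\ forall C, F n C -> covar C <= covar B + ep n.
  move=> n; pose S := [set covar B | B in F n].
  have hS : has_sup S.
    split; first by have [B FB _] := H n; exists (covar B); exists B.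
    by exists 1 => _ [B FB <-]; apply: covar_ub; exact: Fm FB.
  have [_ [B FB <-] hB] := sup_adherent (ep0 n) hS.
  exists B; split => // C FC'; apply: (@le_trans _ _ (sup S)).
    by apply: sup_ubound; [case: hS|exists C].
  by rewrite -lerBlDr ltW.
move=> /choice[B /all_and2[FB Bmax]].
have mB n : measurable (B n) by exact: Fm (FB n).
pose V n m := \bigcup_(k in [set k | (k < m)%N]) B (n + k)%N.
have mV n m : measurable (V n m).
  by apply: (bigcup_ltn_measurable (F := fun k => B (n + k)%N)).
have VS n m : V n m.+1 = B n `|` V n.+1 m.
  apply/seteqP; split => x.
    move=> [[|k] /= km Bx]; first by left; rewrite addn0 in Bx.
    by right; exists k => //; rewrite addSnnS.
  move=> [Bx|[k /= km Bx]]; first by exists 0%N => //; rewrite addn0.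
  by exists k.+1 => //; rewrite -addSnnS.
have FV n m : F n (V n m).
  rewrite /V bigcup_mkcond; apply: FU => k; case: ifP => _.
    by apply: Fle (FB (n + k)%N); exact: leq_addr.
  exact: F0.
have cV m n : e - 2 * ep n <= covar (V n m.+1).
  elim: m n => [|m ih] n.
    rewrite VS (_ : V n.+1 0%N = set0) ?setU0; last by rewrite -subset0 => x [].
    have [C FC' eC] := H n; have := Bmax _ _ FC'; have := ep0 n; lra.
  rewrite VS covarUI//.
  have := Bmax n _ (FI (FB n) (Fdec (FV n.+1 m.+1))).
  have := ih n.+1; have := epS n; lra.
pose C n := \bigcup_k B (n + k)%N.
have mC n : measurable (C n) by exact: bigcup_measurable.
have FCn n : F n (C n).
  by apply: FU => k; apply: Fle (FB (n + k)%N); exact: leq_addr.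
have Cdec n : C n.+1 `<=` C n.
  by move=> x [k _ Bx]; exists k.+1 => //; rewrite -addSnnS.
have ep_le n : ep n <= e / 4.
  rewrite /ep ler_pdivrMr ?exprn_gt0// ler_peMr//; first by rewrite ltW// divr_gt0.
  by rewrite exprn_ege1// ler1n.
have cC n : e / 2 <= covar (C n).
  apply/ler_addgt0Pr => r r0; have r20 : 0 < r / 2 by rewrite divr_gt0.
  have [m hm] := pr_bigcup_approx mu (F := fun k => B (n + k)%N)
    (fun k => mB _) r20.
  have VC : V n m.+1 `<=` C n by move=> x [k _ Bx]; exists k.
  have VV : V n m `<=` V n m.+1.
    by move=> x [k /= km Bx]; exists k => //; exact: ltnW.
  have h1 := covar_dist (mC n) (mV n m.+1).
  have h2 : dist mu (C n) (V n m.+1) < r / 2.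
    rewrite /dist /symdiff (_ : V n m.+1 `\` C n = set0) ?setU0; last first.
      by rewrite setD_eq0.
    have := prDI mu (mC n) (mV n m.+1); rewrite (setIidr VC).
    have := le_pr mu (mV n m) (mV n m.+1) VV.
    by move: hm; rewrite -/(V n m) -/(C n); lra.
  have h3 := cV m n; have h4 := ep_le n.
  move: h1; rewrite ler_norml => /andP[h1 _]; lra.
pose L := \bigcap_n C n.
have mL : measurable L by exact: bigcap_measurable.
(* The [C k] decrease, so their intersection is unchanged when only the indices from [n] on are
   kept. *)
have FL n : F n L.
  have -> : L = ~` \bigcup_k ~` C (n + k)%N.
    rewrite -setC_bigcap setCK; apply/seteqP; split => x Lx k _; first exact: Lx.
    have := Lx k Logic.I; rewrite addnC; elim: n {Lx} => [|n ih].
      by rewrite addn0.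
    by rewrite addnS => /Cdec /ih.
  apply: FC; apply: FU => k; apply: FC.
  by apply: Fle (FCn (n + k)%N); exact: leq_addr.
have cL : e / 2 <= covar L.
  apply/ler_addgt0Pr => r r0; have r20 : 0 < r / 2 by rewrite divr_gt0.
  have [n hn] := pr_bigcap_approx mu mC Cdec r20.
  have LC : L `<=` C n by move=> x; exact.
  have h1 := covar_dist (mC n) mL.
  have h2 : dist mu (C n) L < r / 2.
    rewrite /dist /symdiff (_ : L `\` C n = set0) ?setU0; last by rewrite setD_eq0.
    have := prDI mu (mC n) mL; rewrite (setIidr LC).
    by move: hn; rewrite -/L; lra.
  have h3 := cC n.
  move: h1; rewrite ler_norml => /andP[_ h1]; lra.
move: cL; rewrite /covar; have [L0|L1] := Ftail FL.
  rewrite L0 mulr0 (pr_sub0 (measurableI _ _ mA mL) mL _ L0) //; lra.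
have : pr mu (A `\` L) = 0.
  apply: (@pr_sub0 _ _ _ mu _ (~` L)).
  - exact: measurableD.
  - exact: measurableC.
  - by move=> x [].
  - by rewrite prC// L1 subrr.
have := prDI mu mA mL; rewrite L1 mulr1; lra.
Qed.

End tail.

(** * Couplings of finite distributions with perturbed marginals *)

Section nearby_coupling.
Context {R : realType} {J : finType}.
Variables (p p1 p2 : J -> R) (r : J -> J -> R).
Hypotheses (r0 : forall a b, 0 <= r a b) (rl : forall a, \sum_b r a b = p a)
  (rr : forall b, \sum_a r a b = p b) (psum : \sum_a p a = 1).
Hypotheses (p10 : forall a, 0 <= p1 a) (p1sum : \sum_a p1 a = 1)
  (p20 : forall a, 0 <= p2 a) (p2sum : \sum_a p2 a = 1).

Let p0 a : 0 <= p a. Proof. by rewrite -rl sumr_ge0. Qed.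

(* Shrink [r] until both marginals fit under [p1] and [p2], then distribute the
   missing mass as a product. *)
Lemma nearby_coupling : exists k : J -> J -> R,
  [/\ forall a b, 0 <= k a b, forall a, \sum_b k a b = p1 a,
      forall b, \sum_a k a b = p2 b &
      \sum_a \sum_b `|k a b - r a b| <=
        2 * (\sum_a `|p1 a - p a| + \sum_b `|p2 b - p b|)].
Proof.
(* The factor by which the row or column of [a] shrinks to fit under [q]. If [p a = 0], that row and
   column of [r] are zero, so the conventional quotient is harmless. *)
pose s (q : J -> R) a := Num.min 1 (q a / p a).
have s01 q a : (forall a, 0 <= q a) -> 0 <= s q a <= 1.
  by move=> q0; rewrite le_min ler01 ge_min lexx /= andbT divr_ge0.
have ps q a : (forall a, 0 <= q a) -> p a * s q a <= q a.
  move=> q0; have [pa|pa] := eqVneq (p a) 0; first by rewrite pa mul0r.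
  rewrite /s; have pa0 : 0 < p a by rewrite lt_neqAle eq_sym pa p0.
  apply: (@le_trans _ _ (p a * (q a / p a))).
    by rewrite ler_wpM2l// ge_min lexx orbT.
  by rewrite mulrCA divff// mulr1.
have ps' q a : (forall a, 0 <= q a) -> p a * (1 - s q a) <= `|q a - p a|.
  move=> q0; have [pa|pa] := eqVneq (p a) 0; first by rewrite pa mul0r.
  have pa0 : 0 < p a by rewrite lt_neqAle eq_sym pa p0.
  rewrite /s; case: (leP 1 (q a / p a)) => h.
    by rewrite subrr mulr0.
  by rewrite mulrBr mulr1 mulrCA divff// mulr1 distrC ler_norm.
pose r' a b := r a b * (s p1 a * s p2 b).
have s1 a := s01 p1 a p10; have s2 b := s01 p2 b p20.
have r'0 a b : 0 <= r' a b.
  by case/andP: (s1 a) => ? _; case/andP: (s2 b) => ? _; rewrite !mulr_ge0.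
have r'r a b : r' a b <= r a b.
  case/andP: (s1 a) => ? ?; case/andP: (s2 b) => ? ?.
  by rewrite ler_piMr// mulr_ile1.
pose e1 a := p1 a - \sum_b r' a b; pose e2 b := p2 b - \sum_a r' a b.
have e10 a : 0 <= e1 a.
  rewrite subr_ge0; apply: le_trans (ps p1 a p10); rewrite -rl mulr_suml.
  apply: ler_sum => b _; rewrite ler_wpM2l//.
  by case/andP: (s1 a) => ? _; case/andP: (s2 b) => _ ?; rewrite ler_piMr.
have e20 b : 0 <= e2 b.
  rewrite subr_ge0; apply: le_trans (ps p2 b p20); rewrite -rr mulr_suml.
  apply: ler_sum => a _; rewrite ler_wpM2l//.
  by case/andP: (s1 a) => _ ?; case/andP: (s2 b) => ? _; rewrite ler_piMl.
pose m := 1 - \sum_a \sum_b r' a b.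
have e1s : \sum_a e1 a = m by rewrite sumrB p1sum.
have e2s : \sum_b e2 b = m by rewrite sumrB p2sum exchange_big.
(* If [m = 0], all the deficits vanish, so the division by zero in [k] adds nothing. *)
have e1m a : e1 a * (m / m) = e1 a.
  have [m0|m0] := eqVneq m 0; last by rewrite divff// mulr1.
  have /eqP := e1s; rewrite m0 psumr_eq0// => /allP /(_ a).
  by rewrite mem_index_enum => /(_ isT) /eqP ->; rewrite mul0r.
have e2m b : m * e2 b / m = e2 b.
  have [m0|m0] := eqVneq m 0; last by rewrite mulrAC divff// mul1r.
  have /eqP := e2s; rewrite m0 psumr_eq0// => /allP /(_ b).
  by rewrite mem_index_enum => /(_ isT) /eqP ->; rewrite mulr0 mul0r.
have m0 : 0 <= m by rewrite -e1s sumr_ge0.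
pose k a b := r' a b + e1 a * e2 b / m.
have kr' a b : r' a b <= k a b by rewrite lerDl divr_ge0// mulr_ge0.
have kl a : \sum_b k a b = p1 a.
  rewrite big_split /= -mulr_suml -mulr_sumr e2s -mulrA e1m.
  by rewrite /e1 addrCA subrr addr0.
have kr b : \sum_a k a b = p2 b.
  rewrite big_split /= -mulr_suml -mulr_suml e1s e2m.
  by rewrite /e2 addrCA subrr addr0.
exists k; split => //; first by move=> a b; exact: le_trans (kr' a b).
(* Both [k] and [r] dominate [r'] and have total mass 1, so each exceeds it by [m] in total. *)
apply: (@le_trans _ _ (2 * m)).
  apply: (@le_trans _ _ (\sum_a \sum_b ((k a b - r' a b) + (r a b - r' a b)))).
    apply: ler_sum => a _; apply: ler_sum => b _; have := kr' a b; have := r'r a b.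
    by rewrite ler_norml => *; apply/andP; split; lra.
  under eq_bigr do rewrite big_split /= !sumrB kl rl.
  by rewrite big_split /= !sumrB p1sum psum /m mulr_natl mulr2n.
(* The lost mass [m] is estimated by [1 - x * y <= (1 - x) + (1 - y)] for factors in [0, 1]. *)
rewrite ler_wpM2l//; apply: (@le_trans _ _
   (\sum_a \sum_b (r a b * (1 - s p1 a) + r a b * (1 - s p2 b)))).
  rewrite /m -[X in X - _]psum; under [X in X - _]eq_bigr do rewrite -rl.
  rewrite -sumrB; apply: ler_sum => a _; rewrite -sumrB; apply: ler_sum => b _.
  rewrite -mulrDr -[X in X - _]mulr1 -mulrBr ler_wpM2l//.
  case/andP: (s1 a) => h1 h2; case/andP: (s2 b) => h3 h4.
  have : 0 <= (1 - s p1 a) * (1 - s p2 b) by rewrite mulr_ge0 ?subr_ge0.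
  by move: (s p1 a) (s p2 b) h1 h2 h3 h4 => x y *; nra.
under eq_bigr do rewrite big_split /= -mulr_suml rl.
rewrite big_split /=; apply: lerD.
  by apply: ler_sum => a _; exact: ps'.
rewrite exchange_big /=; apply: ler_sum => b _; rewrite -mulr_suml rr.
exact: ps'.
Qed.

End nearby_coupling.

Section pair_sums.
Context {R : realType} {J W : finType}.

Lemma sum_pair (F : J * W -> R) : \sum_z F z = \sum_a \sum_w F (a, w).
Proof. by rewrite pair_bigA /=; apply: eq_bigr => -[]. Qed.

Lemma sum_pair1 (F : J * W -> R) a : \sum_(z | z.1 == a) F z = \sum_w F (a, w).
Proof.
rewrite big_mkcond sum_pair (bigD1 a)//= [X in _ + X]big1 ?addr0.
  by apply: eq_bigr => w _; rewrite eqxx.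
by move=> a' /negbTE a'a; apply: big1 => w _; rewrite /= a'a.
Qed.

Lemma sum_pair2 (F : J * W -> R) (Q : pred W) :
  \sum_(z | Q z.2) F z = \sum_a \sum_(w | Q w) F (a, w).
Proof.
rewrite big_mkcond sum_pair; apply: eq_bigr => a _.
by rewrite [RHS]big_mkcond.
Qed.

End pair_sums.

(** * Joint laws of names with prescribed pairs of letters *)

Section chain.
Context {d : measure_display} {X : measurableType d} {R : realType}.
Variables (mu : probability X R) (J : finType) (P : X -> J) (S : X -> X).
Variable C : set (set X).
Hypotheses (Cm : C `<=` measurable) (CI : forall A B, C A -> C B -> C (A `&` B))
  (CU : forall A B, C A -> C B -> C (A `|` B)) (C0 : C set0) (CT : C setT)
  (CS : forall A, C A -> C (S @^-1` A)) (CP : forall a, C (P @^-1` [set a])).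
Hypothesis Spr : forall A, measurable A -> pr mu (S @^-1` A) = pr mu A.
Variable eta : R.
Hypothesis mix : forall a B, C B ->
  `|covar mu (P @^-1` [set a]) (S @^-1` B)| <= eta.

Let mP a : measurable (P @^-1` [set a]). Proof. exact: Cm. Qed.

Lemma pr_fin_preimage (W : finType) (u : X -> W) (Z : set X) (Q : pred W) :
  measurable Z -> (forall w, measurable (u @^-1` [set w])) ->
  pr mu (Z `&` [set x | Q (u x)]) = \sum_(w | Q w) pr mu (Z `&` u @^-1` [set w]).
Proof.
move=> mZ mu_; have mQ : measurable [set x | Q (u x)].
  rewrite (_ : [set _ | _] = \bigcup_(w in [set w | Q w]) u @^-1` [set w]).
    by apply: fin_bigcup_measurable => //; exact: finite_finset.
  apply/seteqP; split => x /=; first by move=> Qx; exists (u x).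
  by move=> [w /= Qw ->].
rewrite (pr_fin_partition mu (measurableI _ _ mZ mQ) mu_) [RHS]big_mkcond.
apply: eq_bigr => w _; case: ifPn => Qw.
  congr pr; apply/seteqP; split => x /=; first by move=> [[]].
  by move=> [Zx uw]; rewrite /= uw.
rewrite -[RHS](pr0 mu); congr pr; rewrite -subset0 => x [[_ /= Qu] uw].
by move: Qu; rewrite uw; exact/negP.
Qed.

Lemma C_fin_preimage (W : finType) (u : X -> W) (Q : pred W) :
  (forall w, C (u @^-1` [set w])) -> C [set x | Q (u x)].
Proof.
move=> Cu; suff H (s : seq W) : C [set x | u x \in s].
  have := H (enum Q); congr C; apply/seteqP; split => x /=; rewrite mem_enum //.
elim: s => [|w s ih]; first by rewrite (_ : [set _ | _] = set0)// -subset0.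
rewrite (_ : [set _ | _] = u @^-1` [set w] `|` [set x | u x \in s]); first exact: CU.
apply/seteqP; split => x /=; rewrite inE; first by move=> /orP[/eqP|]; auto.
by move=> [|] ->; rewrite ?eqxx ?orbT.
Qed.

(** The cells where the covariance has a given sign unite to a single set of [C], to which mixing
    applies once. The bound is therefore free of the number of cells. *)
Lemma sum_covar_le (W : finType) (u : X -> W) a :
  (forall w, C (u @^-1` [set w])) ->
  \sum_w `|covar mu (P @^-1` [set a]) (S @^-1` (u @^-1` [set w]))| <= 2 * eta.
Proof.
move=> Cu; pose c w := covar mu (P @^-1` [set a]) (S @^-1` (u @^-1` [set w])).
rewrite -[leLHS]/(\sum_w `|c w|).
have mSu w : measurable ((u \o S) @^-1` [set w]) by exact: Cm (CS (Cu w)).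
have H Q : \sum_(w | Q w) c w =
    covar mu (P @^-1` [set a]) (S @^-1` [set x | Q (u x)]).
  rewrite /covar /c /covar sumrB -mulr_sumr; congr (_ - _ * _).
    by rewrite -(pr_fin_preimage (u := u \o S) Q).
  have := pr_fin_preimage (u := u \o S) Q measurableT mSu; rewrite setTI => ->.
  by apply: eq_bigr => w _; rewrite setTI.
rewrite (bigID (fun w => 0 <= c w)) /= mulr_natl mulr2n; apply: lerD.
  rewrite (eq_bigr c); last by move=> w cw; rewrite ger0_norm.
  rewrite H; apply: le_trans (ler_norm _) _; apply: mix.
  exact: (C_fin_preimage (fun w => 0 <= c w) Cu).
rewrite (eq_bigr (fun w => - c w)); last first.
  by move=> w; rewrite -ltNge => cw; rewrite ltr0_norm.
rewrite sumrN H; apply: le_trans (ler_norm _) _; rewrite normrN; apply: mix.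
exact: (C_fin_preimage (fun w => ~~ (0 <= c w)) Cu).
Qed.

(** [c] is a joint law of the names of two points, and [pi_ k] reads the letter at time [k] from a
    name. The marginals of [c] are exact; only the law of the pair of letters at each time is
    approximate, with a bound free of [L]. *)
Definition chain_matrix (L : nat) (r : nat -> J -> J -> R) (W : finType)
    (u : X -> W) (pi_ : nat -> W -> J) (c : W -> W -> R) : Prop :=
  [/\ (forall w, C (u @^-1` [set w])) /\
      (forall k x, (k < L)%N -> P (iter k S x) = pi_ k (u x)),
   forall w w', 0 <= c w w',
   forall w, \sum_w' c w w' = pr mu (u @^-1` [set w]),
   forall w', \sum_w c w w' = pr mu (u @^-1` [set w']) &
   forall k, (k < L)%N -> \sum_a \sum_b
     `|\sum_(w | pi_ k w == a) \sum_(w' | pi_ k w' == b) c w w' - r k a b| <=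
     8 * #|J|%:R * eta].

(** Induction on [L], adding a letter at time 0. Given the names [w] and [w'] of the images under
    [S], the new letters are coupled with marginals their conditional laws. By mixing these are
    close in mean to the law of [P], so [nearby_coupling] keeps the pair close to [r 0]. Summing out
    the new letters returns [c], so the errors at the other times are inherited unchanged. *)
Lemma chain_exists L (r : nat -> J -> J -> R) :
  (forall k a b, 0 <= r k a b) ->
  (forall k a, \sum_b r k a b = pr mu (P @^-1` [set a])) ->
  (forall k b, \sum_a r k a b = pr mu (P @^-1` [set b])) ->
  exists (W : finType) (u : X -> W) (pi_ : nat -> W -> J) (c : W -> W -> R),
    chain_matrix L r u pi_ c.
Proof.
pose p a := pr mu (P @^-1` [set a]).
have psum : \sum_a p a = 1.
  rewrite -(prT mu) (pr_fin_partition mu measurableT mP).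
  by apply: eq_bigr => a _; rewrite setTI.
have x0 : X := point.
elim: L r => [|L ih] r r0 rl rr.
  exists unit, (fun=> tt), (fun _ _ => P x0), (fun _ _ => 1).
  have uT w : (fun=> tt) @^-1` [set w] = [set: X].
    by case: w; apply/seteqP; split.
  split => //; first by split => // w; rewrite uT.
  - by move=> w; rewrite uT prT big_const card_unit /= addr0.
  - by move=> w; rewrite uT prT big_const card_unit /= addr0.
have [W [u [pi_ [c [[Cu piE] c0 cl cr cb]]]]] :=
  ih _ (fun k => r0 k.+1) (fun k => rl k.+1) (fun k => rr k.+1).
pose D w := S @^-1` (u @^-1` [set w]).
have mD w : measurable (D w) by exact/Cm/CS/Cu.
have prD w : pr mu (D w) = pr mu (u @^-1` [set w]) by apply: Spr; exact/Cm/Cu.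
pose v w := pr mu (D w).
(* The conditional law of the first letter given the name of the image under [S]. For null names it
   is 0 by convention, but there [c] vanishes too. *)
pose q w a := pr mu (P @^-1` [set a] `&` D w) / v w.
have q0 w a : 0 <= q w a by rewrite divr_ge0// pr_ge0.
have qsum w : v w != 0 -> \sum_a q w a = 1.
  move=> v0; rewrite -mulr_suml -[RHS](divff v0); congr (_ / _).
  rewrite /v (pr_fin_partition mu (mD w) mP).
  by apply: eq_bigr => a _; rewrite setIC.
have cv w w' : c w w' != 0 -> v w != 0 /\ v w' != 0.
  move=> cn0; have cp : 0 < c w w' by rewrite lt_neqAle eq_sym cn0 c0.
  split; rewrite lt0r_neq0// /v prD; apply: lt_le_trans cp _.
    by rewrite -cl (bigD1 w')//= lerDl sumr_ge0.
  by rewrite -cr (bigD1 w)//= lerDl sumr_ge0.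
pose dv w := \sum_a `|q w a - p a|.
have : forall ww : W * W, exists k : J -> J -> R, (forall a b, 0 <= k a b) /\
    (c ww.1 ww.2 != 0 -> [/\ forall a, \sum_b k a b = q ww.1 a,
      forall b, \sum_a k a b = q ww.2 b &
      \sum_a \sum_b `|k a b - r 0%N a b| <= 2 * (dv ww.1 + dv ww.2)]).
  move=> [w w'] /=; have [cz|cn0] := eqVneq (c w w') 0.
    by exists (fun _ _ => 0).
  have [v0 v0'] := cv _ _ cn0.
  have [k [k0 kl kr kd]] := nearby_coupling (r0 0%N) (rl 0%N) (rr 0%N) psum
    (q0 w) (qsum _ v0) (q0 w') (qsum _ v0').
  by exists k.
move=> /choice[kk /all_and2[kk0 kkc]].
pose c' (z z' : J * W) := c z.2 z'.2 * kk (z.2, z'.2) z.1 z'.1.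
exists (J * W)%type, (fun x => (P x, u (S x))),
  (fun k z => if k is k'.+1 then pi_ k' z.2 else z.1), c'.
have pre z : (fun x => (P x, u (S x))) @^-1` [set z] =
    P @^-1` [set z.1] `&` D z.2.
  apply/seteqP; split => x /=; first by move=> <-.
  by case: z => a w /= [-> <-].
have csum : \sum_w \sum_w' c w w' = 1.
  under eq_bigr do rewrite cl.
  rewrite -(prT mu) (pr_fin_partition mu measurableT (fun w => Cm (Cu w))).
  by apply: eq_bigr => a _; rewrite setTI.
have cq w a : v w * q w a = pr mu (P @^-1` [set a] `&` D w).
  rewrite /q; have [v0|v0] := eqVneq (v w) 0; last by rewrite mulrC divfK.
  rewrite v0 mul0r; apply/esym.
  by apply: (pr_sub0 (measurableI _ _ (mP a) (mD w)) (mD w)).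
have kksum w w' : c w w' * \sum_a \sum_b kk (w, w') a b = c w w'.
  have [->|cn0] := eqVneq (c w w') 0; first by rewrite mul0r.
  have [kl _ _] := kkc (w, w') cn0; under eq_bigr do rewrite kl.
  by rewrite qsum ?mulr1//; case: (cv _ _ cn0).
split.
- split; first by move=> z; rewrite pre; apply: CI => //; exact/CS/Cu.
  move=> [|k] x //=; rewrite ltnS => kL.
  by rewrite -iterS iterSr piE.
- by move=> z z'; rewrite mulr_ge0.
- move=> [a w]; rewrite pre /= -cq /v prD -cl mulr_suml sum_pair exchange_big /=.
  apply: eq_bigr => w' _; rewrite /c' /= -mulr_sumr.
  have [->|cn0] := eqVneq (c w w') 0; first by rewrite !mul0r.
  by have [kl _ _] := kkc (w, w') cn0; rewrite kl.
- move=> [b w']; rewrite pre /= -cq /v prD -cr mulr_suml sum_pair exchange_big /=.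
  apply: eq_bigr => w _; rewrite /c' /= -mulr_sumr.
  have [->|cn0] := eqVneq (c w w') 0; first by rewrite !mul0r.
  by have [_ kr _] := kkc (w, w') cn0; rewrite kr.
move=> [_|k kL].
- under eq_bigr => a _ do under eq_bigr => b _ do
    (rewrite sum_pair1; under eq_bigr do rewrite sum_pair1).
  rewrite /c' /=.
  apply: (@le_trans _ _ (\sum_w \sum_w' c w w' *
      \sum_a \sum_b `|kk (w, w') a b - r 0%N a b|)).
    have H a b : `|\sum_w \sum_w' c w w' * kk (w, w') a b - r 0%N a b| <=
        \sum_w \sum_w' c w w' * `|kk (w, w') a b - r 0%N a b|.
      rewrite -{1}[r 0%N a b]mul1r -csum mulr_suml -sumrB.
      apply: le_trans (ler_norm_sum _ _ _) _; apply: ler_sum => w _.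
      rewrite mulr_suml -sumrB.
      apply: le_trans (ler_norm_sum _ _ _) _; apply: ler_sum => w' _.
      by rewrite -mulrBr normrM ger0_norm.
    apply: le_trans (ler_sum _ (fun a _ => ler_sum _ (fun b _ => H a b))) _.
    under eq_bigr do (rewrite exchange_big /=; under eq_bigr do rewrite exchange_big /=).
    rewrite exchange_big /=; apply: ler_sum => w _.
    rewrite exchange_big /=; apply: ler_sum => w' _.
    by rewrite mulr_sumr; apply: ler_sum => a _; rewrite mulr_sumr.
  apply: (@le_trans _ _ (\sum_w \sum_w' (c w w' * (2 * dv w) + c w w' * (2 * dv w')))).
    apply: ler_sum => w _; apply: ler_sum => w' _; rewrite -mulrDr -mulrDr.
    have [->|cn0] := eqVneq (c w w') 0; first by rewrite !mul0r.
    by rewrite ler_wpM2l//; have [_ _] := kkc (w, w') cn0.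
  (* The mean L1 distance of the conditional laws from [p]. The final constant is [8 = 2 * 2 * 2]:
     two points, the factor of [nearby_coupling], and the two signs in [sum_covar_le]. *)
  have vdv : \sum_w v w * dv w <= 2 * #|J|%:R * eta.
    have -> : \sum_w v w * dv w = \sum_a \sum_w
        `|covar mu (P @^-1` [set a]) (S @^-1` (u @^-1` [set w]))|.
      rewrite exchange_big /=; apply: eq_bigr => w _; rewrite mulr_sumr.
      apply: eq_bigr => a _; rewrite -[v w in LHS]ger0_norm ?pr_ge0// -normrM.
      by rewrite mulrBr cq /covar [v w * _]mulrC.
    apply: (@le_trans _ _ (\sum_(a in J) 2 * eta)).
      by apply: ler_sum => a _; exact: sum_covar_le.
    by rewrite sumr_const -[leLHS]mulr_natr mulrAC.
  have E1 : \sum_w \sum_w' c w w' * (2 * dv w) = 2 * \sum_w v w * dv w.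
    rewrite mulr_sumr; apply: eq_bigr => w _; rewrite -mulr_suml cl /v prD.
    by rewrite mulrCA.
  have E2 : \sum_w \sum_w' c w w' * (2 * dv w') = 2 * \sum_w v w * dv w.
    rewrite exchange_big mulr_sumr; apply: eq_bigr => w _; rewrite -mulr_suml cr /v prD.
    by rewrite mulrCA.
  under eq_bigr do rewrite big_split /=.
  rewrite big_split /= E1 E2; lra.
- apply: le_trans (cb k kL).
  apply: ler_sum => a _; apply: ler_sum => b _.
  rewrite (_ : \sum_(w | pi_ k w.2 == a) _ =
    \sum_(w | pi_ k w == a) \sum_(w' | pi_ k w' == b) c w w')//.
  rewrite (sum_pair2 _ (fun w => pi_ k w == a)) exchange_big /=.
  apply: eq_bigr => w _.
  under eq_bigr do rewrite (sum_pair2 _ (fun w => pi_ k w == b)) exchange_big /=.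
  rewrite exchange_big /=; apply: eq_bigr => w' _.
  by rewrite -[RHS]kksum mulr_sumr; apply: eq_bigr => a' _; rewrite mulr_sumr.
Qed.

End chain.

Section matrix_bimeasure.
Context {d : measure_display} {X : measurableType d} {R : realType}.
Variable mu : probability X R.

Lemma dom_fin_preimage (phi : set X -> R) (W : finType) (u : X -> W) (Q : pred W) :
  dominated_additive mu phi -> (forall w, measurable (u @^-1` [set w])) ->
  phi [set x | Q (u x)] = \sum_(w | Q w) phi (u @^-1` [set w]).
Proof.
move=> hp mu_; suff H (s : seq W) : uniq s ->
    measurable [set x | u x \in s] /\
    phi [set x | u x \in s] = \sum_(w <- s) phi (u @^-1` [set w]).
  have [_ {H}] := H _ (enum_uniq Q); rewrite big_enum_cond /=.
  rewrite (_ : [set _ | _] = [set x | Q (u x)]).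
    by move=> ->; apply: eq_bigl => w; rewrite andbT.
  by apply/seteqP; split => x /=; rewrite mem_enum.
elim: s => [_|w s ih /= /andP[ws us]].
  rewrite big_nil (_ : [set _ | _] = set0); last by rewrite -subset0.
  by rewrite (dom0 hp).
have [ms es] := ih us.
rewrite big_cons -es (_ : [set _ | _] = u @^-1` [set w] `|` [set x | u x \in s]).
  split; first exact: measurableU.
  by rewrite hp.2// -subset0 => x [/= ->]; rewrite (negbTE ws).
apply/seteqP; split => x /=; rewrite inE; first by move=> /orP[/eqP|]; auto.
by move=> [|] ->; rewrite ?eqxx ?orbT.
Qed.

Variables (W : finType) (u : X -> W) (c : W -> W -> R).
Hypotheses (mu_ : forall w, measurable (u @^-1` [set w]))
  (c0 : forall w w', 0 <= c w w')
  (cl : forall w, \sum_w' c w w' = pr mu (u @^-1` [set w]))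
  (cr : forall w', \sum_w c w w' = pr mu (u @^-1` [set w'])).

(** Given the pair of cells, the two points are taken independent, each with the law [mu]
    conditioned on its cell. Null cells are harmless because [c] gives them no weight. *)
Lemma matrix_bimeasure : exists2 beta, bimeasure mu beta &
  forall Q Q' : pred W, beta [set x | Q (u x)] [set x | Q' (u x)] =
    \sum_(w | Q w) \sum_(w' | Q' w') c w w'.
Proof.
pose v w := pr mu (u @^-1` [set w]).
pose g A w := pr mu (A `&` u @^-1` [set w]) / v w.
pose beta A B := \sum_w \sum_w' c w w' * (g A w * g B w').
have g0 A w : 0 <= g A w by rewrite divr_ge0// pr_ge0.
have cv w w' : c w w' != 0 -> v w != 0 /\ v w' != 0.
  move=> cn0; have cp : 0 < c w w' by rewrite lt_neqAle eq_sym cn0 c0.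
  split; rewrite lt0r_neq0// /v; apply: lt_le_trans cp _.
    by rewrite -cl (bigD1 w')//= lerDl sumr_ge0.
  by rewrite -cr (bigD1 w)//= lerDl sumr_ge0.
have gQ (Q : pred W) w : v w != 0 -> g [set x | Q (u x)] w = (Q w)%:R.
  move=> v0; rewrite /g; case: (boolP (Q w)) => Qw.
    rewrite setIidr ?divff// => x /= ->; exact: Qw.
  rewrite (_ : _ `&` _ = set0) ?pr0 ?mul0r// -subset0 => x [/= Qx uw].
  by move: Qx; rewrite uw; exact/negP.
have gT w : v w != 0 -> g setT w = 1.
  by move=> v0; rewrite /g setTI divff.
have gU A A' w : measurable A -> measurable A' -> A `&` A' = set0 ->
    g (A `|` A') w = g A w + g A' w.
  move=> mA mA' AA'; rewrite /g setIUl prU ?mulrDl//; try exact: measurableI.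
  by rewrite setIACA AA' set0I.
have gv A w : measurable A -> v w * g A w = pr mu (A `&` u @^-1` [set w]).
  move=> mA; rewrite /g; have [v0|v0] := eqVneq (v w) 0; last by rewrite mulrC divfK.
  rewrite v0 mul0r; apply/esym/(pr_sub0 (measurableI _ _ mA (mu_ w)) (mu_ w)) => //.
exists beta; last first.
  move=> Q Q'; rewrite [RHS]big_mkcond; apply: eq_bigr => w _.
  transitivity (\sum_w' (if Q w && Q' w' then c w w' else 0)).
    apply: eq_bigr => w' _; have [->|cn0] := eqVneq (c w w') 0.
      by rewrite mul0r if_same.
    have [v0 v0'] := cv _ _ cn0; rewrite !gQ//.
    by case: (Q w); case: (Q' w'); rewrite /= ?mulr0 ?mul0r ?mulr1 ?mulr0.
  by case: (Q w) => /=; [rewrite -big_mkcond|rewrite big1_eq].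
split.
- move=> A B _ _; apply: sumr_ge0 => w _; apply: sumr_ge0 => w' _.
  by apply: mulr_ge0 => //; exact: mulr_ge0.
- move=> A A' B mA mA' mB AA'; rewrite -big_split /=; apply: eq_bigr => w _.
  rewrite -big_split /=; apply: eq_bigr => w' _.
  by rewrite gU// mulrDl mulrDr.
- move=> A B B' mA mB mB' BB'; rewrite -big_split /=; apply: eq_bigr => w _.
  rewrite -big_split /=; apply: eq_bigr => w' _.
  by rewrite gU// mulrDr mulrDr.
- move=> A mA; rewrite (pr_fin_partition mu mA mu_); apply: eq_bigr => w _.
  rewrite -gv// /v -cl mulr_suml; apply: eq_bigr => w' _.
  have [->|cn0] := eqVneq (c w w') 0; first by rewrite !mul0r.
  by rewrite gT ?mulr1//; case: (cv _ _ cn0).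
- move=> A mA; rewrite (pr_fin_partition mu mA mu_) /beta exchange_big /=.
  apply: eq_bigr => w' _; rewrite -gv// /v -cr mulr_suml; apply: eq_bigr => w _.
  have [->|cn0] := eqVneq (c w w') 0; first by rewrite !mul0r.
  by rewrite gT ?mul1r//; case: (cv _ _ cn0).
Qed.

End matrix_bimeasure.

Section automorphism.
Context {d : measure_display} {X : measurableType d} {R : realType}.
Variables (mu : probability X R) (T : X -> X).
Hypothesis autT : isAut mu T.

Lemma measurable_iter_pre n A : measurable A -> measurable (iter n T @^-1` A).
Proof.
case: autT => _ mT _ _; elim: n A => [|n ih] A mA.
  by rewrite (_ : _ @^-1` _ = A).
rewrite (_ : _ @^-1` _ = iter n T @^-1` (T @^-1` A))//.
by apply: ih; exact: measurable_preimage.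
Qed.

Lemma pr_iter_pre n A : measurable A -> pr mu (iter n T @^-1` A) = pr mu A.
Proof.
case: autT => _ mT _ pT; elim: n A => [|n ih] A mA.
  by rewrite (_ : _ @^-1` _ = A).
rewrite (_ : _ @^-1` _ = iter n T @^-1` (T @^-1` A))//.
rewrite ih; last exact: measurable_preimage.
by rewrite /pr pT.
Qed.

Lemma iter_pre_image n (A : set X) : iter n T @^-1` (iter n T @` A) = A.
Proof.
have Tinj : injective T by case: autT => /bij_inj.
have ninj : injective (iter n T).
  by elim: n => // n ih x y /= /Tinj /ih.
apply/seteqP; split => x /=; last by exists x.
by move=> [y Ay /ninj <-].
Qed.

Lemma measurable_iter_image n A : measurable A -> measurable (iter n T @` A).
Proof.
case: autT => _ _ imT _ mA; elim: n => [|n ih].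
  rewrite (_ : _ @` _ = A)//; apply/seteqP; split => x; first by move=> [y ? <-].
  by exists x.
rewrite (_ : _ @` _ = T @` (iter n T @` A)); first exact: imT.
by rewrite -image_comp.
Qed.

End automorphism.

(** * Simultaneous realisation of couplings in a K-system *)

Section K_chain.
Context {d : measure_display} {X : measurableType d} {R : realType}.
Variables (mu : probability X R) (T : X -> X).
Hypotheses (autT : isAut mu T) (KT : Ksystem mu T).

(** The step [n] is fixed before the length [L] and the targets [rho], so arbitrarily long chains
    share one step and one error; the Cesaro limit relies on this order. *)
Lemma K_chain (N : nat) (A B : nat -> set X) (e : R) :
  (forall i, measurable (A i)) -> (forall i, measurable (B i)) -> 0 < e ->
  exists2 n, (0 < n)%N & forall L (rho : nat -> set X -> set X -> R),
    (forall k, bimeasure mu (rho k)) -> exists2 beta, bimeasure mu beta &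
    forall k i, (k < L)%N -> (i < N)%N ->
      `|beta (iter k (iter n T) @^-1` A i) (iter k (iter n T) @^-1` B i) -
        rho k (A i) (B i)| < e.
Proof.
move=> mA mB e0; have [K [[sK Km] [KS [Kgen Ktail]]]] := KT.
have KC Z : K Z -> K (~` Z) by case: sK => _ + _ KZ => /(_ _ KZ); rewrite setTD.
have KU (Z : nat -> set X) : (forall k, K (Z k)) -> K (\bigcup_k Z k).
  by case: sK => _ _; exact.
have K0 : K set0 by case: sK.
have KU2 Z Z' : K Z -> K Z' -> K (Z `|` Z').
  by move=> KZ KZ'; rewrite -bigcup2E; apply: KU => -[|[|k]].
have KI Z Z' : K Z -> K Z' -> K (Z `&` Z').
  by move=> KZ KZ'; rewrite -[_ `&` _]setCK setCI; apply/KC/KU2; exact: KC.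
have Kit n Z : K Z -> K (iter n T @^-1` Z).
  elim: n Z => // n ih Z KZ; rewrite (_ : _ @^-1` _ = iter n T @^-1` (T @^-1` Z))//.
  exact/ih/KS.
pose F n := [set E | exists Z, K Z /\ E = iter n T @^-1` Z].
have sF n : sigma_algebra setT (F n).
  split; first by exists set0; split => //; rewrite preimage_set0.
    by move=> _ [Z [KZ ->]]; exists (~` Z); split; [exact: KC|rewrite setTD].
  move=> Z FZ; have /choice[Z' /all_and2[KZ' ZE]] := FZ.
  exists (\bigcup_k Z' k); split; first exact: KU.
  by rewrite preimage_bigcup; apply: eq_bigcupr => k _.
have Fm n : F n `<=` measurable.
  by move=> _ [Z [KZ ->]]; apply: (measurable_iter_pre autT); exact: Km.
have Fdec n : F n.+1 `<=` F n.
  by move=> _ [Z [KZ ->]]; exists (T @^-1` Z); split; [exact: KS|].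
have Fle n m : (n <= m)%N -> F m `<=` F n.
  move=> /subnK <-; elim: (m - n)%N => // k ih Z; rewrite addSn => /Fdec; exact: ih.
have Ftail E : (forall n, F n E) -> pr mu E = 0 \/ pr mu E = 1.
  by move=> /Ktail; rewrite /pr => -[] ->; [left|right].
(* [C m] consists of the images of members of [K] under [T^m]. These algebras increase, their union
   is dense, and pulling back by [T^m] brings a set of [C m] into [K]. *)
pose C m := [set Z | measurable Z /\ K (iter m T @^-1` Z)].
have CS m : C m `<=` C m.+1.
  move=> Z [mZ KZ]; split => //.
  rewrite (_ : _ @^-1` _ = T @^-1` (iter m T @^-1` Z)); first exact: KS.
  by apply/seteqP; split => x /=; rewrite -iterS iterSr.
have Cle m m' : (m <= m')%N -> C m `<=` C m'.
  by move=> /subnK <-; elim: (m' - m)%N => // k ih Z /ih; rewrite addSn => /CS.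
have CU m Z Z' : C m Z -> C m Z' -> C m (Z `|` Z').
  move=> [mZ KZ] [mZ' KZ']; split; first exact: measurableU.
  by rewrite preimage_setU; exact: KU2.
have CC m Z : C m Z -> C m (~` Z).
  by move=> [mZ KZ]; split; [exact: measurableC|exact: (KC _ KZ)].
have CI m Z Z' : C m Z -> C m Z' -> C m (Z `&` Z').
  by move=> CZ CZ'; rewrite -[_ `&` _]setCK setCI; apply/CC/CU; exact: CC.
have C0 m : C m set0 by split => //; rewrite preimage_set0.
have CT m : C m setT by rewrite -setC0; exact/CC.
pose G := [set Z | exists m, C m Z].
have approx Z r : measurable Z -> 0 < r -> exists2 Z', G Z' & dist mu Z' Z < r.
  apply: (generates_approx _ _ _ _ _ Kgen).
  - by move=> Z' [m []].
  - by exists 0%N.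
  - by move=> Z' [m CZ]; exists m; exact: CC.
  - move=> Z1 Z2 [m1 C1] [m2 C2]; exists (maxn m1 m2); apply: CU.
      exact: Cle (leq_maxl _ _) _ C1.
    exact: Cle (leq_maxr _ _) _ C2.
  - move=> _ [n [Z' [KZ' ->]]]; exists n; split.
      by apply: (measurable_iter_image autT); exact: Km.
    by rewrite (iter_pre_image autT).
(* Replacing the sets by approximants costs less than [e / 4] in [beta] and in [rho k]; the
   remaining [e / 2] is for the chain, and [eta] below makes [8 * #|J| * eta] at most that. *)
have e80 : 0 < e / 8 by rewrite divr_gt0.
have /choice[A' /all_and2[GA' dA']] : forall i, exists Z, G Z /\ dist mu Z (A i) < e / 8.
  by move=> i; have [Z] := approx _ _ (mA i) e80; exists Z.
have /choice[B' /all_and2[GB' dB']] : forall i, exists Z, G Z /\ dist mu Z (B i) < e / 8.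
  by move=> i; have [Z] := approx _ _ (mB i) e80; exists Z.
have [m Cm] : exists m, forall i : 'I_N, C m (A' i) /\ C m (B' i).
  have /choice[mi mC] : forall i, exists m, C m (A' i) /\ C m (B' i).
    move=> i; have [m1 C1] := GA' i; have [m2 C2] := GB' i.
    exists (maxn m1 m2); split.
      exact: Cle (leq_maxl _ _) _ C1.
    exact: Cle (leq_maxr _ _) _ C2.
  exists (\max_(i < N) mi i)%N => i; have [c1 c2] := mC i.
  have h : (mi i <= \max_(i < N) mi i)%N by exact: (leq_bigmax (F := fun j : 'I_N => mi j)).
  by split; [exact: Cle h _ c1|exact: Cle h _ c2].
(* The partition generated by all approximants; its cells lie in a single [C m]. *)
pose P x := [ffun i : 'I_N => (x \in A' i, x \in B' i)].
have CP a : C m (P @^-1` [set a]).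
  rewrite (_ : _ @^-1` _ = [set x | forall i, i \in enum 'I_N -> P x i = a i]); last first.
    apply/seteqP; split => x /=; first by move=> ->.
    by move=> h; apply/ffunP => i; apply: h; rewrite mem_enum.
  elim: (enum 'I_N) => [|i s ih].
    by rewrite (_ : [set _ | _] = setT)//; apply/seteqP; split.
  rewrite (_ : [set _ | _] = (if (a i).1 then A' i else ~` A' i) `&`
    (if (a i).2 then B' i else ~` B' i) `&`
    [set x | forall i, i \in s -> P x i = a i]).
    have [c1 c2] := Cm i.
    by apply: (CI) => //; apply: CI; case: ifP => _ //; exact: CC.
  have asb (Z : set X) (b : bool) x : (x \in Z) = b <-> (if b then Z else ~` Z) x.
    case: b; first by split => [/set_mem//|/mem_set].
    by split => [/negbT/negP h Zx|h]; [apply: h; exact/mem_set|apply/negbTE/negP => /set_mem].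
  apply/seteqP; split => x /=.
    move=> h; split; last by move=> j js; apply: h; rewrite inE js orbT.
    have := h i (mem_head _ _); rewrite /P ffunE; case: (a i) => a1 a2 [h1 h2] /=.
    by split; apply/asb.
  move=> [[/asb h1 /asb h2] h] j; rewrite inE => /orP[/eqP->|]; last exact: h.
  by rewrite /P ffunE h1 h2; case: (a i).
have mP a : measurable (P @^-1` [set a]) by case: (CP a).
pose J := {ffun 'I_N -> bool * bool}.
pose eta := e / (16 * (#|J|%:R + 1)).
have J0 : 0 < #|J|%:R + 1 :> R by rewrite ltr_wpDl.
have eta0 : 0 < eta by rewrite divr_gt0// mulr_gt0.
have [n0 mixn0] : exists n0, forall (a : J) Z, F n0 Z ->
    `|covar mu (P @^-1` [set a]) Z| <= eta.
  have /choice[na mna] : forall a : J, exists n, forall Z, F n Z ->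
      `|covar mu (P @^-1` [set a]) Z| <= eta.
    by move=> a; exact: (tail_mixing sF Fm Fdec Ftail (mP a) eta0).
  exists (\max_a na a)%N => a Z FZ; apply: mna; apply: Fle FZ.
  exact: leq_bigmax.
(* [m] steps bring sets of [C m] into [K], and [n0] further steps reach the mixing range; the
   additional one makes the step positive. *)
exists (n0.+1 + m)%N => // L rho hrho; pose S := iter (n0.+1 + m)%N T.
pose r k a b := rho k (P @^-1` [set a]) (P @^-1` [set b]).
have rE k (Q Q' : pred J) : \sum_(a | Q a) \sum_(b | Q' b) r k a b =
    rho k [set x | Q (P x)] [set x | Q' (P x)].
  have mQ' : measurable [set x | Q' (P x)].
    suff [] : C m [set x | Q' (P x)] by [].
    by apply: C_fin_preimage => //; exact: CU.
  rewrite (dom_fin_preimage Q (bimeasure_doml (hrho k) mQ') mP).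
  apply: eq_bigr => a _.
  by rewrite (dom_fin_preimage Q' (bimeasure_domr (hrho k) (mP a)) mP).
have itC i j x : iter i T (iter j T x) = iter j T (iter i T x).
  by rewrite -!iterD addnC.
have [W [u [pi_ [c [[Cu piE] c0 cl cr cb]]]]] : exists (W : finType) (u : X -> W)
    (pi_ : nat -> W -> J) (c : W -> W -> R),
    chain_matrix mu P S (C m) eta L r u pi_ c.
  apply: chain_exists.
  - by move=> Z [].
  - exact: CI.
  - exact: CU.
  - exact: C0.
  - exact: CT.
  - move=> Z [mZ KZ]; split; first exact: (measurable_iter_pre autT).
    rewrite (_ : _ @^-1` _ = S @^-1` (iter m T @^-1` Z)); first exact: Kit.
    by apply/funext => x; rewrite /preimage /= itC.
  - exact: CP.
  - by move=> Z mZ; exact: (pr_iter_pre autT).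
  - move=> a Z [mZ KZ]; apply: mixn0; apply: Fdec; exists (iter m T @^-1` Z); split => //.
    by apply/funext => x; rewrite /preimage /= /S iterD itC.
  - by move=> k a b; case: (hrho k) => h _ _ _ _; exact: h.
  - move=> k a; have := dom_fin_preimage xpredT (bimeasure_domr (hrho k) (mP a)) mP.
    by move=> <-; case: (hrho k) => _ _ _ h _; rewrite -h//; congr rho; apply/seteqP; split.
  - move=> k b; have := dom_fin_preimage xpredT (bimeasure_doml (hrho k) (mP b)) mP.
    by move=> <-; case: (hrho k) => _ _ _ _ h; rewrite -h//; congr rho; apply/seteqP; split.
have mu_ w : measurable (u @^-1` [set w]) by case: (Cu w).
have [beta hb betaE] := matrix_bimeasure mu_ c0 cl cr.
exists beta => // k i kL iN; pose oi := Ordinal iN.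
pose Q := [pred a : J | (a oi).1]; pose Q' := [pred a : J | (a oi).2].
have QE : [set x | Q (P x)] = A' i.
  by apply/seteqP; split => x; rewrite /Q /P /= ffunE /=; [move/set_mem|move/mem_set].
have Q'E : [set x | Q' (P x)] = B' i.
  by apply/seteqP; split => x; rewrite /Q' /P /= ffunE /=; [move/set_mem|move/mem_set].
have mA'i : measurable (A' i) by case: (GA' i) => ? [].
have mB'i : measurable (B' i) by case: (GB' i) => ? [].
have SkE Z : iter k S @^-1` Z = iter (k * (n0.+1 + m)) T @^-1` Z.
  by rewrite /S; congr (_ @^-1` Z); apply/funext => x; rewrite iterM.
have mS Z : measurable Z -> measurable (iter k S @^-1` Z).
  by move=> mZ; rewrite SkE; exact: (measurable_iter_pre autT).
have dS Z Z' : measurable Z -> measurable Z' ->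
    dist mu (iter k S @^-1` Z) (iter k S @^-1` Z') = dist mu Z Z'.
  move=> mZ mZ'; rewrite /dist -[RHS](pr_iter_pre autT (k * (n0.+1 + m))) ?SkE//.
  exact: measurable_symdiff.
have h1 : `|beta (iter k S @^-1` A' i) (iter k S @^-1` B' i) - rho k (A' i) (B' i)| <= e / 2.
  rewrite -QE -Q'E -rE.
  have -> : iter k S @^-1` [set x | Q (P x)] = [set x | [pred w | Q (pi_ k w)] (u x)].
    by apply/seteqP; split => x /=; rewrite piE.
  have -> : iter k S @^-1` [set x | Q' (P x)] = [set x | [pred w | Q' (pi_ k w)] (u x)].
    by apply/seteqP; split => x /=; rewrite piE.
  rewrite betaE.
  have -> : \sum_(w | [pred w | Q (pi_ k w)] w) \sum_(w' | [pred w | Q' (pi_ k w)] w') c w w'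
    = \sum_(a | Q a) \sum_(b | Q' b)
      \sum_(w | pi_ k w == a) \sum_(w' | pi_ k w' == b) c w w'.
    rewrite (partition_big (pi_ k) Q)//=; apply: eq_bigr => a Qa.
    rewrite [RHS]exchange_big /=; apply: eq_big.
      by move=> w; case: eqP => [->|]; rewrite ?andbF// andbT.
    move=> w _; rewrite (partition_big (pi_ k) Q')//=; apply: eq_bigr => b Qb.
    by apply: eq_bigl => w'; case: eqP => [->|]; rewrite ?andbF// andbT.
  rewrite -sumrB; apply: le_trans (ler_norm_sum _ _ _) _.
  apply: (@le_trans _ _ (8 * #|J|%:R * eta)); last first.
    rewrite /eta mulrA ler_pdivrMr ?mulr_gt0//.
    rewrite (_ : e / 2 * (16 * (#|J|%:R + 1)) = 8 * #|J|%:R * e + 8 * e); last by field.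
    by rewrite lerDl mulr_ge0// ltW.
  apply: le_trans (cb k kL); rewrite [leRHS](bigID Q) /=.
  rewrite -[leLHS]addr0; apply: lerD; last by do 2!(apply: sumr_ge0 => ? _).
  apply: ler_sum => a _; rewrite -sumrB; apply: le_trans (ler_norm_sum _ _ _) _.
  rewrite [leRHS](bigID Q') /= -[leLHS]addr0; apply: lerD => //.
  by apply: sumr_ge0.
have h2 := bimeasure_dist hb (mS _ (mA i)) (mS _ mA'i) (mS _ (mB i)) (mS _ mB'i).
have h3 := bimeasure_dist (hrho k) (mA i) mA'i (mB i) mB'i.
rewrite !dS// in h2.
have := dA' i; have := dB' i; rewrite (distC mu _ (A i)) (distC mu _ (B i)).
move: h1 h2 h3; rewrite -/S; set x := beta _ _; set y := rho k _ _; set z := beta _ _.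
set t := rho k _ _ => h1 h2 h3 h4 h5.
rewrite (_ : z - t = (z - x) + (x - y) + - (t - y)); last by ring.
apply: le_lt_trans (ler_normD _ _) _; rewrite normrN.
have := ler_normD (z - x) (x - y); lra.
Qed.

End K_chain.

(** The limit along an ultrafilter finer than [\oo]: a bounded sequence stays in a compact segment,
    so its image ultrafilter converges. *)
Lemma ultralimit (R : realType) : exists lm : (nat -> R) -> R,
  [/\ forall s t M, (forall n, `|s n| <= M) -> (forall n, `|t n| <= M) ->
        lm (fun n => s n + t n) = lm s + lm t,
      forall s a b, (forall n, a <= s n <= b) -> a <= lm s <= b &
      forall s M, (forall n, `|s n| <= M) ->
        (forall e, 0 < e -> exists N, forall n, (N <= n)%N -> `|s n| <= e) ->
        lm s = 0].
Proof.
have [U [UU ooU]] := @ultraFilterLemma nat \oo _.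
have PU : ProperFilter U by exact: ultra_proper.
have cvgU (s : nat -> R) M : (forall n, `|s n| <= M) -> cvg (s @ U).
  move=> sM; have := @segment_compact R (- M) M.
  have US : UltraFilter (s @ U).
    split; first exact: fmap_proper_filter.
    move=> G PG sG; apply/seteqP; split => // A GA.
    have [//|nA] := in_ultra_setVsetC (s @^-1` A) UU.
    have GnA : G (~` A) by exact: sG.
    have G0 : G set0 by rewrite -(setICr A); exact: filterI.
    by have [x []] := filter_ex G0.
  have SI : (s @ U) `[- M, M]%classic.
    suff : U (s @^-1` `[- M, M]%classic) by [].
    by apply: filterE => n /=; rewrite in_itv /= -ler_norml.
  rewrite compact_ultra => /(_ _ US SI) [p [_ sp]].
  by apply/cvg_ex; exists p.
exists (fun s => lim (s @ U)); split.
- move=> s t M sM tM; apply: cvg_lim => //.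
  by apply: cvgD; [exact: cvgU sM|exact: cvgU tM].
- move=> s a b sab.
  have sM n : `|s n| <= `|a| + `|b|.
    have /andP[h1 h2] := sab n; rewrite ler_norml; apply/andP; split.
      have := ler_norm (- a); rewrite normrN; have := normr_ge0 b; lra.
    have := ler_norm b; have := normr_ge0 a; lra.
  have sc := cvgU _ _ sM; apply/andP; split.
    by apply: limr_ge => //; apply: filterE => n; case/andP: (sab n).
  by apply: limr_le => //; apply: filterE => n; case/andP: (sab n).
- move=> s M sM s0; apply: cvg_lim => //.
  apply: (@cvg_trans _ (s @ \oo)); first by move=> A; exact: ooU.
  apply/cvgr0Pnorm_le => e e0; have [N hN] := s0 _ e0; near=> n; apply: hN.
  by near: n; exact: nbhs_infty_ge.
Unshelve. all: by end_near. Qed.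

(** * The dynamics of the lens *)

Section lens.
Context {d : measure_display} {X : measurableType d} {R : realType}.
Variables (mu : probability X R) (T : X -> X).
Hypotheses (stX : @standard_Borel d X R) (autT : isAut mu T).

Lemma cvalE (rho : probability (X * X)%type R) A B :
  measurable A -> measurable B -> rho (A `*` B) = (cval rho A B)%:E.
Proof.
by move=> mA mB; rewrite /cval fineK// fin_num_measure//; exact: measurableX.
Qed.

Lemma coupling_bimeasure rho : coupling mu rho -> bimeasure mu (cval rho).
Proof.
move=> [hl hr]; split.
- by move=> A B _ _; exact: (pr_ge0 rho).
- move=> A A' B mA mA' mB AA'; rewrite /cval -[LHS]/(pr rho _).
  have -> : (A `|` A') `*` B = A `*` B `|` A' `*` B.
    apply/seteqP; split => -[x y] /=; first by move=> [[|] ? ?]; [left|right].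
    by move=> [[]|[]]; split => //; [left|right].
  rewrite prU//; try exact: measurableX.
  rewrite -subset0 => -[x y] [[/= Ax _] [/= A'x _]].
  by have : (A `&` A') x by []; rewrite AA'.
- move=> A B B' mA mB mB' BB'; rewrite /cval -[LHS]/(pr rho _).
  have -> : A `*` (B `|` B') = A `*` B `|` A `*` B'.
    apply/seteqP; split => -[x y] /=; first by move=> [? [|] ?]; [left|right].
    by move=> [[]|[]]; split => //; [left|right].
  rewrite prU//; try exact: measurableX.
  rewrite -subset0 => -[x y] [[/= _ By] [/= _ B'y]].
  by have : (B `&` B') y by []; rewrite BB'.
- by move=> A mA; rewrite /cval hl.
- by move=> B mB; rewrite /cval hr.
Qed.

Lemma bimeasure_coupling beta : bimeasure mu beta ->
  exists2 xi, coupling mu xi &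
    forall A B, measurable A -> measurable B -> cval xi A B = beta A B.
Proof.
move=> hb; have [f [finj [mf fim]]] := stX.
have [xi xiE] := bimeasure_realization hb finj mf fim; exists xi => //.
have [_ _ _ bml bmr] := hb; split.
- by move=> A mA; rewrite cvalE// xiE// bml// -prE.
- by move=> B mB; rewrite cvalE// xiE// bmr// -prE.
Qed.

Lemma bimeasure_shift beta n : bimeasure mu beta ->
  bimeasure mu (fun A B => beta (iter n T @^-1` A) (iter n T @^-1` B)).
Proof.
move=> [b0 bl br bml bmr].
have mI A : measurable A -> measurable (iter n T @^-1` A).
  by move=> mA; exact: (measurable_iter_pre autT).
split.
- by move=> A B mA mB; apply: b0; exact: mI.
- move=> A A' B mA mA' mB AA'; rewrite preimage_setU bl//; try exact: mI.
  by rewrite -preimage_setI AA' preimage_set0.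
- move=> A B B' mA mB mB' BB'; rewrite preimage_setU br//; try exact: mI.
  by rewrite -preimage_setI BB' preimage_set0.
- by move=> A mA; rewrite preimage_setT bml ?(pr_iter_pre autT)//; exact: mI.
- by move=> B mB; rewrite preimage_setT bmr ?(pr_iter_pre autT)//; exact: mI.
Qed.

Lemma lens_iter_cval n (rho xi : probability (X * X)%type R) :
  (forall A B, measurable A -> measurable B ->
    cval xi A B = cval rho (iter n T @^-1` A) (iter n T @^-1` B)) ->
  lens_iter T n rho xi.
Proof.
move=> h A B mA mB; rewrite cvalE// h// -cvalE//;
  exact: (measurable_iter_pre autT).
Qed.

Hypothesis KT : Ksystem mu T.

Lemma K_transitive : lens_transitive mu T.
Proof.
move=> U V [Uc Uo] [Vc Vo] [rho0 Urho0] [xi0 Vxi0].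
have [k1 [A1 [B1 [e1 [e10 [m1 U1]]]]]] := Uo _ Urho0.
have [k2 [A2 [B2 [e2 [e20 [m2 V2]]]]]] := Vo _ Vxi0.
(* Both neighbourhoods are tested by one list: the first [k1] entries belong to [U], the next [k2]
   to [V]. *)
pose A i := if (i < k1)%N then A1 i else A2 (i - k1)%N.
pose B i := if (i < k1)%N then B1 i else B2 (i - k1)%N.
have mA i : measurable (A i).
  by rewrite /A; case: ifP => _; [case: (m1 i)|case: (m2 (i - k1)%N)].
have mB i : measurable (B i).
  by rewrite /B; case: ifP => _; [case: (m1 i)|case: (m2 (i - k1)%N)].
have e0 : 0 < Num.min e1 e2 by rewrite lt_min e10 e20.
have [n n0 /(_ 2%N)] := K_chain autT KT (k1 + k2) mA mB e0.
move=> /(_ (fun k => if k is 0%N then cval rho0 else cval xi0)) [].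
  by case=> [|k]; apply: coupling_bimeasure; [exact: Uc|exact: Vc].
move=> beta hb near; exists n; split => //.
have [rho crho rhoE] := bimeasure_coupling hb.
have [xi cxi xiE] := bimeasure_coupling (bimeasure_shift n hb).
exists rho, xi; split; [|split].
- apply: U1; split => // i ik; have := near 0%N i isT (ltn_addr _ ik).
  rewrite /A /B ik /= lt_min => /andP[+ _].
  by have [? ?] := m1 i; rewrite -rhoE.
- apply: V2; split => // i ik; have ik' : (k1 + i < k1 + k2)%N by rewrite ltn_add2l.
  have := near 1%N _ isT ik'.
  rewrite /A /B ltnNge leq_addr /= addKn lt_min => /andP[_].
  by have [? ?] := m2 i; rewrite -xiE.
- by apply: lens_iter_cval => A' B' mA' mB'; rewrite xiE// rhoE//;
    exact: (measurable_iter_pre autT).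
Qed.

Lemma bimeasure_le1 beta A B : bimeasure mu beta -> measurable A ->
  measurable B -> 0 <= beta A B <= 1.
Proof.
move=> hb mA mB; have /andP[-> h] := (bimeasure_doml hb mB).1 _ mA.
by apply: le_trans h _; exact: pr_le1.
Qed.

(* The limit is taken along an ultrafilter, so that it is additive and converges
   on all rectangles at once. *)
Lemma cesaro_limit n (beta : nat -> set X -> set X -> R) :
  (forall L, bimeasure mu (beta L)) ->
  exists gamma, [/\ bimeasure mu gamma,
    forall A B, measurable A -> measurable B ->
      gamma (iter n T @^-1` A) (iter n T @^-1` B) = gamma A B &
    forall A B (a e : R), measurable A -> measurable B ->
      (forall L k, (k <= L)%N -> `|beta L (iter k (iter n T) @^-1` A)
         (iter k (iter n T) @^-1` B) - a| <= e) -> `|gamma A B - a| <= e].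
Proof.
move=> hb; have [lm [lmD lmb lm0]] := ultralimit R.
pose sh k (A : set X) := iter k (iter n T) @^-1` A.
have shE k A : sh k A = iter (k * n) T @^-1` A.
  by apply/funext => x; rewrite /sh /preimage /= iterM.
have msh k A : measurable A -> measurable (sh k A).
  by move=> mA; rewrite shE; exact: (measurable_iter_pre autT).
have hsh L k : bimeasure mu (fun A B => beta L (sh k A) (sh k B)).
  have := bimeasure_shift (k * n) (hb L); congr bimeasure.
  by apply/funext => A; apply/funext => B; rewrite !shE.
(* The average over the [L.+1] times [k <= L] is taken of [beta L], which the closeness assumption
   controls at exactly these times. *)
pose av A B L := (\sum_(k < L.+1) beta L (sh k A) (sh k B)) / L.+1%:R.
have avb A B a b L : (forall k : 'I_L.+1, a <= beta L (sh k A) (sh k B) <= b) ->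
    a <= av A B L <= b.
  move=> h; have L0 : 0 < L.+1%:R :> R by [].
  rewrite ler_pdivlMr// ler_pdivrMr// !mulr_natr; apply/andP; split.
    rewrite -[X in _ *+ X]card_ord -sumr_const.
    by apply: ler_sum => k _; case/andP: (h k).
  rewrite -[X in _ *+ X]card_ord -sumr_const.
  by apply: ler_sum => k _; case/andP: (h k).
have av01 A B L : measurable A -> measurable B -> 0 <= av A B L <= 1.
  move=> mA mB; apply: avb => k.
  by apply: (bimeasure_le1 (hsh L k)).
have avn A B L : measurable A -> measurable B -> `|av A B L| <= 1.
  by move=> mA mB; have /andP[h1 h2] := av01 A B L mA mB; rewrite ger0_norm.
exists (fun A B => lm (av A B)); split.
- split.
  + move=> A B mA mB.
    by have /andP[] := lmb (av A B) 0 1 (fun L => av01 A B L mA mB).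
  + move=> A A' B mA mA' mB AA'.
    rewrite -(lmD _ _ 1); [|by move=> L; exact: avn|by move=> L; exact: avn].
    congr lm; apply/funext => L; rewrite /av -mulrDl -big_split /=.
    congr (_ / _); apply: eq_bigr => k _.
    by case: (hsh L k) => _ bl _ _ _; exact: bl.
  + move=> A B B' mA mB mB' BB'.
    rewrite -(lmD _ _ 1); [|by move=> L; exact: avn|by move=> L; exact: avn].
    congr lm; apply/funext => L; rewrite /av -mulrDl -big_split /=.
    congr (_ / _); apply: eq_bigr => k _.
    by case: (hsh L k) => _ _ br _ _; exact: br.
  + move=> A mA; apply/eqP; rewrite eq_le andbC.
    apply: lmb => L; apply: avb => k.
    by case: (hsh L k) => _ _ _ -> // _; rewrite lexx.
  + move=> B mB; apply/eqP; rewrite eq_le andbC.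
    apply: lmb => L; apply: avb => k.
    by case: (hsh L k) => _ _ _ _ -> //; rewrite lexx.
- move=> A B mA mB; have mA1 := measurable_iter_pre autT n mA.
  have mB1 := measurable_iter_pre autT n mB.
  pose t L := av (iter n T @^-1` A) (iter n T @^-1` B) L - av A B L.
  have shS k C : sh k (iter n T @^-1` C) = sh k.+1 C by [].
  (* The shift replaces time 0 by time [L.+1] in the sum, so only two boundary terms remain and the
     difference is at most [1 / L.+1]. *)
  have tE L : t L = (beta L (sh L.+1 A) (sh L.+1 B) - beta L (sh 0%N A) (sh 0%N B)) / L.+1%:R.
    rewrite /t /av -mulrBl; congr (_ / _); rewrite -sumrB.
    rewrite -(telescope_sumr (fun k => beta L (sh k A) (sh k B)) (leq0n L.+1)).
    by rewrite big_mkord.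
  have tb L : `|t L| <= 1 / L.+1%:R.
    rewrite tE normrM [`|_^-1|]ger0_norm ?invr_ge0// ler_wpM2r ?invr_ge0//.
    have /andP[] := bimeasure_le1 (hsh L L.+1) mA mB.
    have /andP[] := bimeasure_le1 (hsh L 0%N) mA mB.
    by rewrite ler_norml => *; apply/andP; split; lra.
  have tb1 L : `|t L| <= 1.
    by apply: le_trans (tb L) _; rewrite ler_pdivrMr// mul1r ler1n.
  have -> : av (iter n T @^-1` A) (iter n T @^-1` B) = fun L => av A B L + t L.
    by apply/funext => L; rewrite /t addrCA subrr addr0.
  rewrite (lmD _ _ 1)//; last by move=> L; exact: avn.
  rewrite (lm0 t 1) ?addr0// => e e0.
  exists (Num.truncn e^-1).+1 => L NL; apply: le_trans (tb L) _.
  rewrite ler_pdivrMr// -ler_pdivrMl// mulr1.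
  apply: le_trans (ltW (truncnS_gt _)) _.
  by rewrite ler_nat; exact: ltnW.
- move=> A B a e mA mB h.
  have : a - e <= lm (av A B) <= a + e.
    apply: lmb => L; apply: avb => k; have := h L k (ltn_ord k).
    by rewrite -/(sh k A) -/(sh k B) ler_norml => /andP[? ?]; apply/andP; split; lra.
  by move=> /andP[? ?]; rewrite ler_norml; apply/andP; split; lra.
Qed.

Lemma K_periodic_dense : c2_dense mu (Jinfty mu T).
Proof.
move=> U [Uc Uo] [rho0 Urho0].
have [N [A [B [e [e0 [mAB U1]]]]]] := Uo _ Urho0.
(* The limit keeps only the weak inequality; half of [e] makes it strict again. *)
have e20 : 0 < e / 2 by rewrite divr_gt0.
have [n n0 chain] := K_chain autT KT N (fun i => (mAB i).1) (fun i => (mAB i).2) e20.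
have hrho0 : bimeasure mu (cval rho0) by apply: coupling_bimeasure; exact: Uc.
have /choice[beta /all_and2[hb near]] : forall L, exists beta, bimeasure mu beta /\
    forall k i, (k < L.+1)%N -> (i < N)%N ->
      `|beta (iter k (iter n T) @^-1` A i) (iter k (iter n T) @^-1` B i) -
        cval rho0 (A i) (B i)| < e / 2.
  by move=> L; have [beta hb h] := chain L.+1 (fun=> cval rho0) (fun=> hrho0); exists beta.
have [gamma [hg ginv gnear]] := cesaro_limit n hb.
have [xi cxi xiE] := bimeasure_coupling hg.
exists xi; split.
  apply: U1; split => // i iN; have [mAi mBi] := mAB i; rewrite xiE//.
  apply: (@le_lt_trans _ _ (e / 2)); last by lra.
  by apply: gnear => // L k kL; rewrite ltW//; exact: near.
split => //; exists n; split => //; apply: lens_iter_cval => A' B' mA' mB'.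
by rewrite !xiE ?ginv//; exact: (measurable_iter_pre autT).
Qed.

End lens.

(** * Rearranging words *)

Section matching.
Context {R : realType} {V J : finType}.
Variable L' : nat.
Local Notation L := L'.+1.
Local Notation W := {ffun 'I_L -> V}.

Definition act (w : W) (s : {perm 'I_L}) : W := [ffun i => w (s i)].

Lemma actM w s t : act (act w s) t = act w (t * s)%g.
Proof. by apply/ffunP => i; rewrite !ffunE permM. Qed.

Lemma act1 w : act w 1%g = w.
Proof. by apply/ffunP => i; rewrite !ffunE perm1. Qed.

(** The classes consist of the words with the same number of each letter; an i.i.d. law is constant
    on each of them. *)
Definition sim (u w : W) := [exists s, w == act u s].

Lemma simP u w : reflect (exists s, w = act u s) (sim u w).
Proof. exact: 'exists_eqP. Qed.

Lemma sim_refl u : sim u u.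
Proof. by apply/simP; exists 1%g; rewrite act1. Qed.

Lemma sim_sym u w : sim u w = sim w u.
Proof.
by apply/simP/simP => -[s ->]; exists s^-1%g; rewrite actM mulVg act1.
Qed.

Lemma sim_trans v u w : sim u v -> sim v w -> sim u w.
Proof.
by move=> /simP[s ->] /simP[t ->]; apply/simP; exists (t * s)%g; rewrite actM.
Qed.

Lemma simL u w v : sim u w -> sim u v = sim w v.
Proof.
move=> uw; apply/idP/idP; last exact: sim_trans.
by apply: sim_trans; rewrite sim_sym.
Qed.

Definition class_size (w : W) : R := \sum_(u | sim w u) 1.

Lemma class_size_gt0 w : 0 < class_size w.
Proof.
rewrite /class_size (bigD1 w) ?sim_refl//=.
by rewrite (@lt_le_trans _ _ 1)// lerDl sumr_ge0.
Qed.

(** Transposing positions 0 and [r] permutes the class, so all positions contribute equally, while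
    the sum over the positions is the same for every word of the class. *)
Lemma class_average (g : V -> R) (w : W) :
  L%:R * \sum_(u | sim w u) g (u ord0) = class_size w * \sum_r g (w r).
Proof.
have H r : \sum_(u | sim w u) g (u r) = \sum_(u | sim w u) g (u ord0).
  rewrite (reindex_inj (h := fun u => act u (tperm ord0 r))) /=; last first.
    by apply: can_inj (fun u => act u (tperm ord0 r)) _ => u;
      rewrite actM tperm2 act1.
  apply: eq_big => u; last by rewrite ffunE tpermR.
  rewrite sim_sym [RHS]sim_sym; apply: simL.
  by rewrite sim_sym; apply/simP; exists (tperm ord0 r).
transitivity (\sum_r \sum_(u | sim w u) g (u r)).
  under [RHS]eq_bigr do rewrite H.
  by rewrite sumr_const card_ord mulr_natl.
rewrite exchange_big /= /class_size mulr_suml; apply: eq_bigr => u /simP[s ->].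
rewrite mul1r [RHS](reindex_inj (@perm_inj _ s)) /=.
by apply: eq_bigr => r _; rewrite ffunE.
Qed.

Variables (p q : V -> J).
Definition matched (f : {perm W}) : {set W} :=
  finset (fun w : W => p (w ord0) == q (f w ord0)).

(** [f] maximises the number of matched words. If some word of the class with source [j] is
    unmatched, then every target [j] of the class is used by a source [j], so the unmatched sources
    are exactly the surplus. *)
Lemma best_matching : exists f : {perm W}, (forall w, sim w (f w)) /\
  forall w j, \sum_(u | sim w u && (p (u ord0) == j)) (u \notin matched f)%:R <=
   `|\sum_(u | sim w u) ((p (u ord0) == j)%:R - (q (u ord0) == j)%:R)| :> R.
Proof.
pose ok (f : {perm W}) := [forall w, sim w (f w)].
have ok1 : ok 1%g by apply/forallP => w; rewrite perm1 sim_refl.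
case: (arg_maxnP (fun f => #|matched f|) ok1) => f /forallP okf fmax.
exists f; split => // w j.
pose bad : {set W} :=
  finset (fun u => [&& sim w u, p (u ord0) == j & u \notin matched f]).
have [bad0|[r]] := set_0Vmem bad.
  rewrite big1 ?normr_ge0// => u /andP[wu pu]; case: (boolP (u \in _)) => // nu.
  by have : u \in bad; [rewrite inE wu pu nu|rewrite bad0 finset.in_set0].
rewrite inE => /and3P[wr /eqP pr_ nr].
(* Otherwise [s] is unmatched, and exchanging the images of [r] and [s] matches [r] without losing
   any match. *)
have key s : sim w s -> q (f s ord0) = j -> p (s ord0) = j.
  move=> ws qs; apply/eqP/negPn/negP => ps.
  have rs : sim r s by rewrite -(simL _ wr).
  pose f' := (tperm r s * f)%g.
  have okf' : ok f'.
    apply/forallP => u; rewrite permM; case: tpermP => [->|->|_ _]; last exact: okf.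
      exact: sim_trans (okf s).
    by apply: sim_trans (okf r); rewrite sim_sym.
  have := fmax _ okf'; rewrite /= leqNgt => /negP; apply; apply: proper_card.
  apply/fintype.properP; split.
    apply/fintype.subsetP => u; rewrite !inE permM; case: tpermP => // -> h.
      by move: nr; rewrite inE h.
    by move: ps; rewrite (eqP h) qs eqxx.
  by exists r => //; rewrite inE permM tpermL pr_ qs.
have -> : \sum_(u | sim w u && (p (u ord0) == j)) (u \notin matched f)%:R =
   \sum_(u | sim w u) ((p (u ord0) == j)%:R - (q (u ord0) == j)%:R) :> R; last first.
  exact: ler_norm.
rewrite sumrB [X in _ - X](reindex_inj (@perm_inj _ f)) /=.
have simf u : sim w (f u) = sim w u.
  by rewrite sim_sym [RHS]sim_sym; apply/esym/simL; exact: okf.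
rewrite [X in _ - X](eq_bigl (sim w)); last by move=> u; rewrite simf.
rewrite -sumrB big_mkcondr; apply: eq_bigr => u wu.
rewrite inE; case: eqP => [->|pj] /=.
  by rewrite eq_sym; case: eqP => _; rewrite ?subrr ?subr0.
by case: eqP => [/(key _ wu)//|]; rewrite subrr.
Qed.

Variable pw : V -> R.
Hypotheses (pw0 : forall v, 0 <= pw v) (pwsum : \sum_v pw v = 1).

Definition wt (w : W) : R := \prod_r pw (w r).

Lemma wt_ge0 w : 0 <= wt w. Proof. exact: prodr_ge0. Qed.

Lemma wt_sim u w : sim u w -> wt u = wt w.
Proof.
move=> /simP[s ->]; rewrite /wt (reindex_inj (@perm_inj _ s)) /=.
by apply: eq_bigr => r _; rewrite ffunE.
Qed.

Definition gap j v : R := (p v == j)%:R - (q v == j)%:R.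

(** The weight is constant on classes, so each term may be replaced by its class average.
    [best_matching] bounds the number of unmatched words by a class sum of [gap j], which
    [class_average] turns into the empirical mean of [gap j] along [w]. *)
Lemma matching_le : exists s : W -> {perm 'I_L},
  injective (fun w => act w (s w)) /\
  \sum_w wt w * (p (w ord0) != q (act w (s w) ord0))%:R <=
  \sum_j \sum_w wt w * (`|\sum_r gap j (w r)| / L%:R).
Proof.
have [f [fs fm]] := best_matching.
have /choice[s sE] : forall w, exists s, f w = act w s by move=> w; exact/simP.
exists s; split; first by move=> u w; rewrite -!sE => /perm_inj.
under eq_bigr do rewrite -sE.
pose bad u : R := (u \notin matched f)%:R.
have -> : \sum_w wt w * (p (w ord0) != q (f w ord0))%:R =
    \sum_w wt w / class_size w * \sum_(u | sim w u) bad u.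
  under [RHS]eq_bigr do rewrite mulr_sumr.
  rewrite (exchange_big_dep xpredT) //=; apply: eq_bigr => u _.
  have -> : wt u * (p (u ord0) != q (f u ord0))%:R =
      wt u / class_size u * bad u * class_size u.
    rewrite /bad inE [RHS]mulrAC -(mulrA (wt u)) mulVf ?mulr1//.
    by rewrite gt_eqF// class_size_gt0.
  rewrite {3}/class_size mulr_sumr; apply: eq_big => w; first by rewrite sim_sym.
  rewrite sim_sym mulr1 => wu; rewrite (wt_sim wu); congr (_ / _ * _).
  by rewrite /class_size; apply: eq_bigl => v; rewrite (simL v wu).
rewrite exchange_big /=; apply: ler_sum => w _; rewrite -mulr_sumr -mulrA.
rewrite ler_wpM2l ?wt_ge0// mulrC ler_pdivrMr ?class_size_gt0//.
rewrite (partition_big (fun u : W => p (u ord0)) xpredT)//= mulr_suml.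
apply: ler_sum => j _; apply: le_trans (fm w j) _.
have := class_average (gap j) w.
have L0 : L%:R != 0 :> R by rewrite pnatr_eq0.
move=> /(congr1 (fun x => x / L%:R)); rewrite mulrAC divff// mul1r => ->.
rewrite !normrM (ger0_norm (ltW (class_size_gt0 w))).
by rewrite [`|_^-1|]ger0_norm ?invr_ge0// -mulrA mulrC.
Qed.

Lemma wt_prod (F : 'I_L -> V -> R) :
  \sum_(w : W) wt w * \prod_r F r (w r) = \prod_r \sum_v pw v * F r v.
Proof.
by rewrite bigA_distr_bigA /=; apply: eq_bigr => w _; rewrite -big_split.
Qed.

Lemma wt_sum : \sum_(w : W) wt w = 1.
Proof.
transitivity (\sum_(w : W) wt w * \prod_(r < L) 1).
  by apply: eq_bigr => w _; rewrite big1_eq mulr1.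
rewrite (wt_prod (fun _ _ => 1)) big1// => r _.
by under eq_bigr do rewrite mulr1.
Qed.

Lemma wt_cov (h : V -> R) r s : \sum_v pw v * h v = 0 ->
  \sum_(w : W) wt w * (h (w r) * h (w s)) = if r == s then \sum_v pw v * h v ^+ 2 else 0.
Proof.
move=> h0.
pose F i v := (if i == r then h v else 1) * (if i == s then h v else 1).
transitivity (\sum_(w : W) wt w * \prod_i F i (w i)).
  apply: eq_bigr => w _; congr (_ * _); rewrite big_split /=.
  rewrite -!big_mkcond !big_pred1_eq //.
rewrite wt_prod (bigD1 r)//=; case: eqP => [rs|/eqP rs].
  rewrite [X in _ * X]big1 ?mulr1; first by apply: eq_bigr => v _; rewrite /F eqxx -rs eqxx expr2.
  move=> i ir; rewrite -pwsum; apply: eq_bigr => v _.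
  by rewrite /F -rs (negbTE ir) !mulr1.
rewrite (eq_bigr (fun v => pw v * h v)) ?h0 ?mul0r// => v _.
by rewrite /F eqxx (negbTE rs) mulr1.
Qed.

(** The law of large numbers in mean: independence removes the mixed terms, so the centred sum has
    second moment at most [L]. *)
Lemma wt_mean_abs (g : V -> R) (e : R) : (forall v, `|g v| <= 1) -> 0 < e ->
  1 <= L%:R * e ^+ 2 ->
  \sum_w wt w * (`|\sum_r g (w r)| / L%:R) <= `|\sum_v pw v * g v| + e.
Proof.
move=> g1 e0 Le; set m := \sum_v pw v * g v.
have L0 : 0 < L%:R :> R by rewrite ltr0n.
pose h v := g v - m.
have h0 : \sum_v pw v * h v = 0.
  under eq_bigr do rewrite mulrBr.
  by rewrite sumrB -mulr_suml pwsum mul1r subrr.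
have var : \sum_v pw v * h v ^+ 2 <= 1.
  have -> : \sum_v pw v * h v ^+ 2 = \sum_v pw v * g v ^+ 2 - m ^+ 2.
    rewrite (eq_bigr (fun v => pw v * g v ^+ 2 - (2 * m) * (pw v * g v) + m ^+ 2 * pw v)).
      by rewrite big_split /= sumrB -!mulr_sumr pwsum -/m; ring.
    by move=> v _; rewrite /h; ring.
  apply: (@le_trans _ _ (\sum_v pw v * g v ^+ 2)); first by rewrite gerBl sqr_ge0.
  rewrite -pwsum; apply: ler_sum => v _; rewrite ler_piMr// -real_normK ?num_real//.
  by rewrite exprn_ile1.
have second : \sum_w wt w * (\sum_r h (w r)) ^+ 2 <= L%:R.
  have -> : \sum_w wt w * (\sum_r h (w r)) ^+ 2 =
     \sum_r \sum_s \sum_(w : W) wt w * (h (w r) * h (w s)).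
    under [RHS]eq_bigr do rewrite exchange_big /=.
    rewrite [RHS]exchange_big /=; apply: eq_bigr => w _.
    rewrite expr2 big_distrl /= mulr_sumr; apply: eq_bigr => r _.
    by rewrite mulr_sumr mulr_sumr; apply: eq_bigr => s _.
  rewrite -[leRHS]mul1r mulr_natr -[X in _ *+ X]card_ord -sumr_const.
  apply: ler_sum => r _; under eq_bigr do rewrite wt_cov//.
  by rewrite -big_mkcond /= (big_pred1 r) // => s; rewrite eq_sym.
have pt (w : W) : `|\sum_r g (w r)| / L%:R <=
    `|m| + e / 2 + (\sum_r h (w r)) ^+ 2 / (2 * e * L%:R ^+ 2).
  have -> : \sum_r g (w r) = \sum_r h (w r) + L%:R * m.
    have -> : L%:R * m = \sum_(r < L) m by rewrite sumr_const card_ord mulr_natl.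
    by rewrite -big_split /=; apply: eq_bigr => r _; rewrite subrK.
  set t := \sum_r h (w r).
  have h1 : `|t + L%:R * m| / L%:R <= `|t| / L%:R + `|m|.
    rewrite -[`|m|](mulfK (lt0r_neq0 L0)) -mulrDl ler_wpM2r ?invr_ge0//.
    by apply: le_trans (ler_normD _ _) _; rewrite normrM ger0_norm// mulrC.
  (* The inequality [2 * y * e <= y ^+ 2 + e ^+ 2] replaces the passage to the square root of the
     variance. *)
  have h2 : `|t| / L%:R <= e / 2 + t ^+ 2 / (2 * e * L%:R ^+ 2).
    have := sqr_ge0 (`|t| / L%:R - e).
    have -> : t ^+ 2 / (2 * e * L%:R ^+ 2) = (`|t| / L%:R) ^+ 2 / (2 * e).
      by rewrite -(real_normK (num_real t)); field; rewrite !lt0r_neq0.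
    set y := `|t| / L%:R => hy.
    rewrite -subr_ge0 (_ : _ - _ = (y - e) ^+ 2 / (2 * e)); last by field; rewrite lt0r_neq0.
    by rewrite divr_ge0// mulr_ge0// ltW.
  by apply: le_trans h1 _; rewrite addrC -addrA lerD2l.
apply: (@le_trans _ _ (\sum_w (wt w * (`|m| + e / 2) +
    wt w * (\sum_r h (w r)) ^+ 2 / (2 * e * L%:R ^+ 2)))).
  apply: ler_sum => w _; rewrite -mulrA -mulrDr ler_wpM2l ?wt_ge0//.
rewrite big_split /= -!mulr_suml wt_sum mul1r -addrA lerD2l.
apply: (@le_trans _ _ (e / 2 + L%:R / (2 * e * L%:R ^+ 2))).
  by rewrite lerD2l ler_wpM2r// invr_ge0 !mulr_ge0// ltW.
have -> : L%:R / (2 * e * L%:R ^+ 2) = 1 / (2 * e * L%:R) :> R.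
  by field; rewrite !lt0r_neq0.
have : 1 / (2 * e * L%:R) <= e / 2.
  rewrite ler_pdivrMr ?mulr_gt0//.
  by rewrite (_ : e / 2 * _ = L%:R * e ^+ 2)//; field.
by move=> ?; rewrite [leRHS]splitr lerD2l.
Qed.

End matching.

Lemma matching (R : realType) (V J : finType) (p q : V -> J) (pw : V -> R) (e : R) :
  (forall v, 0 <= pw v) -> \sum_v pw v = 1 -> 0 < e ->
  exists (L' : nat) (s : {ffun 'I_L'.+1 -> V} -> {perm 'I_L'.+1}),
  injective (fun w => act w (s w)) /\
  \sum_w wt pw w * (p (w ord0) != q (act w (s w) ord0))%:R <=
  \sum_j (`|\sum_v pw v * gap p q j v| + e).
Proof.
move=> pw0 pwsum e0; have [L' hL] : exists L', 1 <= L'.+1%:R * e ^+ 2.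
  exists (Num.truncn (e ^- 2)); rewrite -ler_pdivrMr ?exprn_gt0// div1r ltW//.
  exact: truncnS_gt.
have [s [sinj sle]] := matching_le L' p q pw0; exists L', s; split => //.
apply: le_trans sle _; apply: ler_sum => j _; apply: wt_mean_abs => // v.
rewrite /gap; case: (_ == _); case: (_ == _) => /=;
  by rewrite ?subrr ?subr0 ?sub0r ?normrN ?normr0 ?normr1.
Qed.

(** * Coding of Bernoulli systems *)

Section orbit_coding.
Context {d : measure_display} {X : measurableType d} {R : realType}.
Variables (mu : probability X R) (T Ti : X -> X) (P0 : set (set X)).
Hypotheses (TK : cancel T Ti) (TiK : cancel Ti T).
Hypothesis sP : sigma_algebra setT P0.
Hypothesis mtimg : forall z A, P0 A -> measurable (timg T z A).
Hypothesis ind : forall (n : nat) (f : nat -> int) (A : nat -> set X),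
  {in [pred i | (i < n)%N] &, injective f} -> (forall i, P0 (A i)) ->
  pr mu (\bigcap_(i in [set i | (i < n)%N]) timg T (f i) (A i)) =
  \prod_(i < n) pr mu (A i).

(** This is [T^(-z) x]; with this sign a point belongs to [timg T z A] exactly when its coordinate
    [z] lies in [A]. *)
Definition orb (x : X) (z : int) : X :=
  match z with Posz n => iter n Ti x | Negz n => iter n.+1 T x end.

Lemma timgE z A : timg T z A = [set x | A (orb x z)].
Proof.
case: z => n //=; apply/seteqP; split => x /=.
  move=> [y Ay <-]; suff -> : iter n Ti (iter n T y) = y by [].
  by elim: n => // n ih; rewrite iterSr /= TK ih.
move=> Ax; exists (iter n Ti x) => //.
by elim: n {Ax} x => // n ih x; rewrite iterSr /= TiK ih.
Qed.

Lemma orb_step x z : orb (T x) z = orb x (z - 1).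
Proof.
case: z => [[|n]|n] //.
- rewrite (_ : _ - 1 = n%:Z); last by lia.
  by rewrite /orb iterSr TK.
- rewrite (_ : _ - 1 = Negz n.+1); last by lia.
  by rewrite /orb -iterSr.
Qed.

Lemma orb_iter n x z : orb (iter n T x) z = orb x (z - n%:Z).
Proof.
elim: n z => [|n ih] z /=; first by rewrite subr0.
by rewrite orb_step ih; congr (orb x _); lia.
Qed.

Variables (I : eqType) (i0 : I) (zeta : I -> int).
Hypothesis zinj : injective zeta.

(** Coordinates are points of [X] observed only through [P0]: independence is available for [P0]
    alone, not for the full sigma-algebra of [X]. *)
Definition cyl : set (set (I -> X)) :=
  [set E | exists i A, P0 A /\ E = [set y | A (y i)]].

Local Notation Y := (g_sigma_algebraType cyl).

Definition Phi (x : X) : Y := fun i => orb x (zeta i).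

Lemma measurable_cyl i A : P0 A -> measurable ([set y | A (y i)] : set Y).
Proof. by move=> PA; apply: sub_sigma_algebra; exists i, A. Qed.

Lemma measurable_to_Y dZ (Z : measurableType dZ) (g : Z -> Y) :
  (forall i A, P0 A -> measurable [set z | A (g z i)]) -> measurable_fun setT g.
Proof.
move=> mg; apply: (@measurability _ _ _ _ setT g cyl) => //.
by move=> _ [_ [i [A [PA ->]]] <-]; rewrite setTI; exact: mg.
Qed.

Lemma measurable_Phi : measurable_fun setT Phi.
Proof.
apply: measurable_to_Y => i A PA; have := mtimg (zeta i) PA.
by rewrite timgE.
Qed.

Definition boxes : set (set Y) := [set E | exists (A : I -> set X) (s : seq I),
  [/\ uniq s, forall i, P0 (A i), forall i, i \notin s -> A i = setT &
      E = [set y | forall i, A i (y i)]]].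

Let P0T : P0 setT.
Proof. by case: sP => h1 h2 _; have := h2 _ h1; rewrite setD0. Qed.

Let P0I A B : P0 A -> P0 B -> P0 (A `&` B).
Proof.
case: sP => p0 pD pU PA PB.
have pC C : P0 C -> P0 (~` C) by move=> /pD; rewrite setTD.
rewrite -[A `&` B]setCK setCI; apply: (pC).
rewrite -bigcup2E; apply: pU => -[|[|k]] /=; [exact: pC|exact: pC|exact: p0].
Qed.

Lemma boxes_generate : @measurable _ Y = <<s boxes >>.
Proof.
apply/seteqP; split.
  apply: smallest_sub; first exact: smallest_sigma_algebra.
  move=> _ [i [A [PA ->]]]; apply: sub_sigma_algebra.
  exists (fun j => if j == i then A else setT), [:: i]; split => //.
  - by move=> j; case: ifP.
  - by move=> j; rewrite inE => /negbTE ->.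
  - apply/seteqP; split => y /=; last by move=> /(_ i); rewrite eqxx.
    by move=> Ay j; case: eqP => // ->.
apply: smallest_sub; first exact: sigma_algebra_measurable.
move=> _ [A [s [_ PA As ->]]].
rewrite (_ : [set _ | _] = [set y | forall i, i \in s -> A i (y i)]); last first.
  apply/seteqP; split => y /=; first by move=> h i _; exact: h.
  by move=> h i; have [/h//|/As ->] := boolP (i \in s).
elim: s {As} => [|i s ih]; first by rewrite (_ : [set _ | _] = setT)// -subTset.
rewrite (_ : [set _ | _] =
  [set y | A i (y i)] `&` [set y | forall i, i \in s -> A i (y i)]).
  by apply: measurableI => //; exact: measurable_cyl.
apply/seteqP; split => y /=.
  by move=> h; split => [|j js]; apply: h; rewrite in_cons ?eqxx ?js ?orbT.
by move=> [hi h] j; rewrite inE => /orP[/eqP->//|]; exact: h.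
Qed.

Lemma boxes_setI_closed : setI_closed boxes.
Proof.
move=> _ _ [A [s [us PA As ->]]] [B [t [ut PB Bt ->]]].
exists (fun i => A i `&` B i), (undup (s ++ t)); split.
- exact: undup_uniq.
- by move=> i; exact: P0I.
- move=> i; rewrite mem_undup mem_cat negb_or => /andP[/As -> /Bt ->].
  exact: setTI.
- by apply/seteqP; split => y /=; [move=> [ha hb] i|move=> h; split => i; case: (h i)].
Qed.

Lemma pr_box A (s : seq I) : uniq s -> (forall i, P0 (A i)) ->
  (forall i, i \notin s -> A i = setT) ->
  pr mu (Phi @^-1` [set y | forall i, A i (y i)]) = \prod_(i <- s) pr mu (A i).
Proof.
move=> us PA As; rewrite (big_nth i0) big_mkord.
rewrite -(ind (f := fun k => zeta (nth i0 s k)) (A := fun k => A (nth i0 s k)))//.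
  congr pr; apply/seteqP; split => x /=.
    by move=> h k _; rewrite timgE; exact: h.
  move=> h i; have [si|/As ->//] := boolP (i \in s).
  have := h (index i s); rewrite /= index_mem => /(_ si).
  by rewrite timgE nth_index.
move=> k l; rewrite !inE => ks ls /zinj /eqP.
by rewrite nth_uniq// => /eqP.
Qed.

Variable nu : probability Y R.
Hypothesis nuE : forall E, nu E = mu (Phi @^-1` E).

Lemma pr_nu E : pr nu E = pr mu (Phi @^-1` E).
Proof. by rewrite /pr nuE. Qed.

Definition reidx (p : I -> I) (y : Y) : Y := fun i => y (p i).

Lemma measurable_reidx p : measurable_fun setT (reidx p).
Proof. by apply: measurable_to_Y => i A PA; exact: measurable_cyl. Qed.

(** A bijection of the indices permutes the sides of a box, and by independence the measure of a box
    is a product over its sides. Boxes are a generating pi-system. *)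
Lemma exchangeable (p p' : I -> I) (E : set Y) : cancel p p' -> cancel p' p ->
  measurable E -> pr nu (reidx p @^-1` E) = pr nu E.
Proof.
move=> pK p'K mE.
apply: (@preimage_unique _ _ _ _ _ _ _ nu nu (reidx p) id _ _ boxes) => //.
- exact: measurable_reidx.
- exact: boxes_generate.
- exact: boxes_setI_closed.
move=> _ [A [s [us PA As ->]]]; rewrite !pr_nu preimage_id (pr_box us)//.
rewrite (_ : _ @^-1` _ = Phi @^-1` [set y | forall i, A (p' i) (y i)]); last first.
  apply/seteqP; split => x /= h i; first by have := h (p' i); rewrite /reidx p'K.
  by have := h (p i); rewrite /reidx pK.
rewrite (@pr_box (fun i => A (p' i)) (map p s))//.
- by rewrite big_map; apply: eq_bigr => i _; rewrite pK.
- by rewrite map_inj_uniq//; exact: can_inj pK.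
- move=> i ni; apply: As; apply: contra ni => si.
  by apply/mapP; exists (p' i).
Qed.

End orbit_coding.

(** * Permutations inside the blocks of an exchangeable process *)

Section block_maps.
Context {d : measure_display} {X : measurableType d} {R : realType}.
Variable P0 : set (set X).
Hypotheses (sP : sigma_algebra setT P0).
Variables (K A : finType) (alpha : X -> A).
Hypothesis Palpha : forall a, P0 (alpha @^-1` [set a]).

Local Notation I := (int * K)%type.
Local Notation Y := (g_sigma_algebraType (@cyl d X P0 I)).
Local Notation Wd := {ffun K -> A}.

Definition wd (y : I -> X) (b : int) : Wd := [ffun k => alpha (y (b, k))].

Lemma measurable_wd b w : measurable ([set y | wd y b = w] : set Y).
Proof.
rewrite (_ : [set _ | _] =
  [set y | forall k, k \in enum K -> alpha (y (b, k)) = w k]); last first.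
  apply/seteqP; split => y /=; first by move=> <- k _; rewrite ffunE.
  by move=> h; apply/ffunP => k; rewrite ffunE h// mem_enum.
elim: (enum K) => [|k s ih]; first by rewrite (_ : [set _ | _] = setT)// -subTset.
rewrite (_ : [set _ | _] = [set y : I -> X | (alpha @^-1` [set w k]) (y (b, k))] `&`
  [set y | forall k, k \in s -> alpha (y (b, k)) = w k]).
  by apply: measurableI => //; exact: measurable_cyl.
apply/seteqP; split => y /=.
  by move=> h; split => [|j js]; apply: h; rewrite in_cons ?eqxx ?js ?orbT.
by move=> [hk h] j; rewrite in_cons => /orP[/eqP->//|]; exact: h.
Qed.

Variable sigma : Wd -> {perm K}.

Definition phi (w : Wd) : Wd := [ffun k => w (sigma w k)].

(** The permutation of a block depends on the word found there. Restricting the action to the blocks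
    in [F] allows an induction on the number of blocks. *)
Definition block_map (F : pred int) (y : Y) : Y :=
  fun i => if F i.1 then y (i.1, sigma (wd y i.1) i.2) else y i.

Lemma wd_block_map F y b : wd (block_map F y) b =
  if F b then phi (wd y b) else wd y b.
Proof.
by apply/ffunP => k; rewrite ffunE /block_map /=; case: ifP => _; rewrite !ffunE.
Qed.

Lemma measurable_block_map F : measurable_fun setT (block_map F).
Proof.
apply: measurable_to_Y => -[b k] B PB; rewrite /block_map /=; case: (F b); last first.
  exact: measurable_cyl.
rewrite (_ : [set _ | _] = \bigcup_(w in [set: Wd])
  ([set y | wd y b = w] `&` [set y : I -> X | B (y (b, sigma w k))])).
  apply: fin_bigcup_measurable; first exact: finite_finset.
  by move=> w _; apply: measurableI; [exact: measurable_wd|exact: measurable_cyl].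
apply/seteqP; split => y /=; first by move=> By; exists (wd y b).
by move=> [w _ [-> ]].
Qed.

Variable nu : probability Y R.
Hypothesis exch : forall (p p' : I -> I) (E : set Y), cancel p p' -> cancel p' p ->
  measurable E -> pr nu (@reidx d X P0 I p @^-1` E) = pr nu E.
Hypothesis phi_inj : injective phi.

(* On each set [wd y b = w] the map is a fixed permutation of coordinates, and
   these sets are permuted by [phi]. *)
Lemma block_map1_pr b (E : set Y) : measurable E ->
  pr nu (block_map (pred1 b) @^-1` E) = pr nu E.
Proof.
move=> mE.
have mw w : measurable ((fun y : Y => wd y b) @^-1` [set w]) by exact: measurable_wd.
have mB : measurable (block_map (pred1 b) @^-1` E).
  by apply: measurable_preimage => //; exact: measurable_block_map.
rewrite (pr_fin_partition nu mB mw) (pr_fin_partition nu mE mw).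
rewrite [RHS](reindex_inj phi_inj) /=; apply: eq_bigr => w _.
pose p (s : {perm K}) (i : I) := if i.1 == b then (i.1, s i.2) else i.
have pK s : cancel (p s) (p s^-1%g).
  move=> [b' k]; rewrite /p /=; have [->|nb] := eqVneq b' b.
    by rewrite /= eqxx permK.
  by rewrite /= (negbTE nb).
have pK' s : cancel (p s^-1%g) (p s).
  move=> [b' k]; rewrite /p /=; have [->|nb] := eqVneq b' b.
    by rewrite /= eqxx permKV.
  by rewrite /= (negbTE nb).
rewrite -[RHS](exch (pK (sigma w)) (pK' (sigma w))); last first.
  by apply: measurableI => //; exact: mw.
congr pr; apply/seteqP; split => y /=.
  move=> [Ey wy]; have e : block_map (pred1 b) y = reidx (p (sigma w)) y.
    apply/funext => -[b' k]; rewrite /block_map /reidx /p /=; case: eqP => // ->.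
    by rewrite wy.
  by rewrite -e; split => //; rewrite wd_block_map /= eqxx wy.
move=> [Ey wy].
have wyb : wd y b = w.
  apply/ffunP => k; move/ffunP : wy => /(_ ((sigma w)^-1%g k)).
  by rewrite !ffunE /reidx /p /= eqxx permKV.
split => //; suff -> : block_map (pred1 b) y = reidx (p (sigma w)) y by [].
apply/funext => -[b' k]; rewrite /block_map /reidx /p /=; case: eqP => // ->.
by rewrite wyb.
Qed.

(** Distinct blocks do not interact, so the map is a composition of maps acting on one block. *)
Lemma block_map_seq_pr (s : seq int) (E : set Y) : uniq s -> measurable E ->
  pr nu (block_map (mem s) @^-1` E) = pr nu E.
Proof.
elim: s E => [|b s ih] E; first by move=> _ mE; congr pr; apply/seteqP; split.
move=> /= /andP[bs us] mE.
have mB : measurable (block_map (pred1 b) @^-1` E).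
  by apply: measurable_preimage => //; exact: measurable_block_map.
rewrite -(block_map1_pr b mE) -(ih _ us mB); congr (pr nu (_ @^-1` E)).
apply/funext => y; apply/funext => -[b' k].
rewrite /= {2}/block_map /= wd_block_map {1 3}/block_map /= in_cons.
have [->|_] //= := eqVneq b' b.
by rewrite (negbTE bs) /block_map /= (negbTE bs).
Qed.

(** A box constrains finitely many blocks, so on boxes the full map has the same effect as a map
    acting on a finite list of blocks. *)
Lemma block_map_pr (E : set Y) : measurable E -> pr nu (block_map xpredT @^-1` E) = pr nu E.
Proof.
move=> mE; have mB := measurable_block_map xpredT.
apply: (@preimage_unique _ _ _ _ _ _ _ nu nu (block_map xpredT) id mB _
  (@boxes d X P0 I)) => //.
- exact: boxes_generate.
- exact: boxes_setI_closed.
move=> C [B [s [us PB Bs CE]]].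
have mC : measurable C.
  by rewrite boxes_generate//; apply: sub_sigma_algebra; exists B, s.
rewrite preimage_id -(block_map_seq_pr (undup_uniq (map fst s)) mC) CE.
congr pr; apply/seteqP; split => y /= h i; have := h i; rewrite /block_map /=.
  have [//|ni] := boolP (i.1 \in undup (map fst s)).
  rewrite (Bs i)//; apply: contra ni => si; rewrite mem_undup; exact: map_f.
have [//|ni] := boolP (i.1 \in undup (map fst s)).
rewrite (Bs i)//; apply: contra ni => si; rewrite mem_undup; exact: map_f.
Qed.

End block_maps.

Section block_inverse.
Context {d : measure_display} {X : measurableType d}.
Variables (P0 : set (set X)) (K A : finType) (alpha : X -> A).
Local Notation Wd := {ffun K -> A}.
Variable sigma : Wd -> {perm K}.
Hypothesis phi_inj : injective (phi sigma).

(** As [phi sigma] is injective on a finite set, the permuted word determines the original one and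
    hence the permutation to be undone; the inverse is again a block map. *)
Lemma block_inverse : exists sigma' : Wd -> {perm K},
  [/\ injective (phi sigma'),
    forall y, block_map (P0 := P0) alpha sigma' xpredT
      (block_map alpha sigma xpredT y) = y &
    forall y, block_map (P0 := P0) alpha sigma xpredT
      (block_map alpha sigma' xpredT y) = y].
Proof.
pose sigma' w := (sigma (invF phi_inj w))^-1%g.
have s'phi w : sigma' (phi sigma w) = (sigma w)^-1%g by rewrite /sigma' invF_f.
have phi'K v : phi sigma' (phi sigma v) = v.
  by apply/ffunP => k; rewrite ffunE s'phi ffunE permKV.
have phi' w : phi sigma' w = invF phi_inj w.
  by rewrite -{1}(f_invF phi_inj w) phi'K.
have sphi' w : sigma (phi sigma' w) = (sigma' w)^-1%g.
  by rewrite phi' /sigma' invgK.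
exists sigma'; split.
- by move=> u w; rewrite !phi'; exact: can_inj (f_invF phi_inj) _ _.
- move=> y; apply/funext => -[b k].
  by rewrite {1}/block_map /= wd_block_map /= s'phi /block_map /= permKV.
- move=> y; apply/funext => -[b k].
  by rewrite {1}/block_map /= wd_block_map /= sphi' /block_map /= permKV.
Qed.

End block_inverse.

(** * From almost everywhere inverses to automorphisms *)

Section realized_automorphism.
Context {d : measure_display} {X : measurableType d} {R : realType}.
Variable mu : probability X R.
Variable f : X -> R.
Hypotheses (finj : injective f) (mf : measurable_fun setT f).
Hypothesis fim : forall A : set X, measurable A -> measurable (f @` A).

Lemma measurable_neq dZ (Z : measurableType dZ) (U V : Z -> X) :
  measurable_fun setT U -> measurable_fun setT V ->
  measurable [set z | U z <> V z].
Proof.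
move=> mU mV.
rewrite (_ : [set _ | _] = \bigcup_q symdiff (U @^-1` ray f q) (V @^-1` ray f q)).
  apply: bigcupT_measurable_rat => q.
  by apply: measurable_symdiff; apply: measurable_preimage => //; exact: measurable_ray.
apply/seteqP; split => z /=; last first.
  by move=> [q _ [] [/= h1 h2] e]; rewrite e in h1 h2.
move=> UV; have : f (U z) <> f (V z) by move=> /finj.
case: (ltgtP (f (U z)) (f (V z))) => // uv _.
  have [q] := rat_in_itvoo uv; rewrite in_itv /= => /andP[h1 h2].
  by exists q => //; left; split => //=; apply/negP; rewrite -leNgt ltW.
have [q] := rat_in_itvoo uv; rewrite in_itv /= => /andP[h1 h2].
by exists q => //; right; split => //=; apply/negP; rewrite -leNgt ltW.
Qed.

Lemma realize_aut (S1 S2 : X -> X) :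
  measurable_fun setT S1 -> measurable_fun setT S2 ->
  (forall A, measurable A -> pr mu (S1 @^-1` A) = pr mu A) ->
  (forall A, measurable A -> pr mu (S2 @^-1` A) = pr mu A) ->
  pr mu [set x | S2 (S1 x) <> x] = 0 -> pr mu [set x | S1 (S2 x) <> x] = 0 ->
  exists S N, [/\ isAut mu S, measurable N, pr mu N = 0 &
    forall x, ~ N x -> S x = S1 x].
Proof.
move=> mS1 mS2 p1 p2 i21 i12.
have m1 A : measurable A -> measurable (S1 @^-1` A) by move=> *; exact: measurable_preimage.
have m2 A : measurable A -> measurable (S2 @^-1` A) by move=> *; exact: measurable_preimage.
pose bad0 := [set x | S2 (S1 x) <> x] `|` [set x | S1 (S2 x) <> x].
have mbad0 : measurable bad0.
  by apply: measurableU; apply: measurable_neq => //; exact: measurableT_comp.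
have pbad0 : pr mu bad0 = 0.
  by apply: prU0 => //; apply: measurable_neq => //; exact: measurableT_comp.
(* Saturation under both preimages keeps the exceptional set null and makes its complement invariant
   under [S1] and [S2]. On the saturated set the maps are replaced by the identity. *)
pose bad := fix bad n := if n is n'.+1 then
  bad n' `|` (S1 @^-1` bad n' `|` S2 @^-1` bad n') else bad0.
have mbad n : measurable (bad n).
  elim: n => // n ih /=; apply: measurableU => //.
  by apply: measurableU; [exact: m1|exact: m2].
have pbad n : pr mu (bad n) = 0.
  elim: n => // n ih /=; apply: prU0 => //.
    by apply: measurableU; [exact: m1|exact: m2].
  by apply: prU0; [exact: m1|exact: m2|rewrite p1|rewrite p2].
pose N := \bigcup_n bad n.
have mN : measurable N by exact: bigcup_measurable.
have pN : pr mu N = 0 by exact: pr_bigcup0.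
have N1 x : ~ N x -> ~ N (S1 x).
  by move=> nx [n _ bn]; apply: nx; exists n.+1 => //=; right; left.
have N2 x : ~ N x -> ~ N (S2 x).
  by move=> nx [n _ bn]; apply: nx; exists n.+1 => //=; right; right.
have K21 x : ~ N x -> S2 (S1 x) = x.
  by move=> nx; apply: contrapT => h; apply: nx; exists 0%N => //; left.
have K12 x : ~ N x -> S1 (S2 x) = x.
  by move=> nx; apply: contrapT => h; apply: nx; exists 0%N => //; right.
pose fix_ (U : X -> X) x := if x \in N then x else U x.
have fE U x : ~ N x -> fix_ U x = U x by move=> nx; rewrite /fix_ memNset.
have fN U x : N x -> fix_ U x = x by move=> nx; rewrite /fix_ mem_set.
have mfix U A : measurable_fun setT U -> measurable A -> measurable (fix_ U @^-1` A).
  move=> mU mA; rewrite (_ : _ @^-1` _ = (N `&` A) `|` (U @^-1` A `\` N)).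
    apply: measurableU; first exact: measurableI.
    by apply: measurableD => //; exact: measurable_preimage.
  apply/seteqP; split => x /=; rewrite /fix_.
    by case: ifPn => [/set_mem Nx|/negP Nx] Ax; [left|right; split => // /mem_set].
  by move=> [[Nx Ax]|[Ax nN]]; [rewrite mem_set|rewrite memNset].
have K1 : cancel (fix_ S1) (fix_ S2).
  move=> x; case: (pselect (N x)) => Nx; first by rewrite !fN.
  by rewrite (fE S1)// fE ?K21//; exact: N1.
have K2 : cancel (fix_ S2) (fix_ S1).
  move=> x; case: (pselect (N x)) => Nx; first by rewrite !fN.
  by rewrite (fE S2)// fE ?K12//; exact: N2.
exists (fix_ S1), N; split => //; last by move=> x; exact: fE.
split.
- by exists (fix_ S2).
- by move=> _ A mA; rewrite setTI; exact: mfix.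
- move=> A mA; rewrite (_ : _ @` _ = fix_ S2 @^-1` A); first exact: mfix.
  apply/seteqP; split => x /=; first by move=> [y Ay <-]; rewrite K1.
  by move=> Ax; exists (fix_ S2 x).
- move=> A mA; have mfA := mfix S1 A mS1 mA; rewrite !prE//; congr EFin.
  rewrite -(p1 A mA); apply: dist0_pr => //; first exact: m1.
  apply: pr_sub0 pN => //; first by apply: measurable_symdiff => //; exact: m1.
  move=> x [] [/= h1 h2]; apply: contrapT => Nx; apply: h2.
    by rewrite -(fE S1).
  by rewrite fE.
Qed.

End realized_automorphism.

Section coded_automorphism.
Context {d : measure_display} {X : measurableType d} {R : realType}.
Variables (mu : probability X R) (T Ti : X -> X) (P0 : set (set X)).
Hypothesis autT : isAut mu T.
Variable f : X -> R.
Hypotheses (finj : injective f) (mf : measurable_fun setT f).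
Hypothesis fim : forall A : set X, measurable A -> measurable (f @` A).
Hypotheses (TK : cancel T Ti) (TiK : cancel Ti T).
Hypotheses (sP : sigma_algebra setT P0).
Hypothesis mtimg : forall z A, P0 A -> measurable (timg T z A).
Hypothesis ind : forall (n : nat) (f : nat -> int) (A : nat -> set X),
  {in [pred i | (i < n)%N] &, injective f} -> (forall i, P0 (A i)) ->
  pr mu (\bigcap_(i in [set i | (i < n)%N]) timg T (f i) (A i)) =
  \prod_(i < n) pr mu (A i).
Hypothesis gen : generates_mod0 mu [set E | exists z A, P0 A /\ E = timg T z A].
Variables (K A : finType) (k0 : K) (alpha : X -> A).
Hypothesis Palpha : forall a, P0 (alpha @^-1` [set a]).
Variables (zeta : int * K -> int) (N : nat).
Hypotheses (zinj : injective zeta) (zsurj : forall z, exists i, zeta i = z)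
  (zshift : forall b k, zeta (b, k) - N%:Z = zeta (b - 1, k)).
Variable sigma : {ffun K -> A} -> {perm K}.
Hypothesis phi_inj : injective (phi sigma).

Local Notation I := (int * K)%type.
Local Notation Y := (g_sigma_algebraType (@cyl d X P0 I)).
Local Notation Phi := (@Phi d X T Ti P0 I zeta : X -> Y).

(** The block map acts on codes; it is carried to [X] by coding with [Phi], permuting, and decoding
    with an almost everywhere inverse of [Phi]. *)
Lemma coded_aut : exists S Z, [/\ isAut mu S, measurable Z, pr mu Z = 0,
  forall x, ~ Z x -> S (iter N T x) = iter N T (S x) &
  forall x, ~ Z x -> wd alpha (Phi (S x)) 0 = phi sigma (wd alpha (Phi x) 0)].
Proof.
have mPhi : measurable_fun setT Phi by exact: measurable_Phi.
have [nu nuE] := push_probability mu mPhi.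
have pnu E : pr nu E = pr mu (Phi @^-1` E) by rewrite /pr nuE.
have exch := exchangeable TK TiK sP ind (0, k0) zinj nuE.
have mpre E : measurable E -> measurable (Phi @^-1` E).
  by move=> mE; exact: measurable_preimage.
(* Since the [T^z P0] generate modulo null sets, the code of a point determines almost surely the
   rays that contain it; [decode] then yields a left inverse [h] of [Phi] almost everywhere. *)
have /choice[D /all_and2[mD dD]] : forall q, exists E : set Y,
    measurable E /\ dist mu (Phi @^-1` E) (ray f q) = 0.
  move=> q; have [C [sC dC]] := gen (measurable_ray mf q).
  suff [E mE EC] : exists2 E : set Y, measurable E & C = Phi @^-1` E.
    exists E; split => //; rewrite -EC; apply/pr_eq0P => //.
    apply: measurable_symdiff; first by rewrite EC; exact: mpre.
    exact: measurable_ray.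
  move: C sC {dC}; apply: smallest_sub.
    split; first by exists set0 => //; rewrite preimage_set0.
      by move=> _ [E mE ->]; exists (~` E); [exact: measurableC|rewrite setTD].
    move=> F HF; have /choice[E HE] : forall n, exists E : set Y,
        measurable E /\ F n = Phi @^-1` E.
      by move=> n; have [E] := HF n; exists E.
    exists (\bigcup_n E n); first by apply: bigcup_measurable => n _; case: (HE n).
    by rewrite preimage_bigcup; apply: eq_bigcupr => n _; case: (HE n).
  move=> _ [z [B [PB ->]]]; have [i <-] := zsurj z.
  exists [set y | B (y i)]; first exact: measurable_cyl.
  by rewrite (timgE TK TiK).
have mr q : measurable (ray f q) by exact: measurable_ray.
have [||h [mh ph dh]] := decode finj mf fim (mu := mu) (nu := nu) mD.
- by move=> q; rewrite pnu; apply: dist0_pr => //; exact: mpre.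
- move=> q q' qq'; rewrite pnu; have ms q0 : measurable (symdiff (Phi @^-1` D q0) (ray f q0)).
    by apply: measurable_symdiff => //; exact: mpre.
  apply: (@pr_sub0 _ _ _ mu _ (symdiff (Phi @^-1` D q) (ray f q) `|`
    symdiff (Phi @^-1` D q') (ray f q'))).
  + by apply: mpre; exact: measurableD.
  + exact: measurableU.
  + move=> x [/= Dq nDq']; case: (pselect (ray f q x)) => rq; last by left; left.
    by right; right; split => //; exact: ray_mono rq.
  + by apply: prU0 => //; [exact: dD|exact: dD].
have mhPhi : measurable_fun setT (h \o Phi) by exact: measurableT_comp.
have [N0 [mN0 pN0 hPhi]] : exists N0, [/\ measurable N0, pr mu N0 = 0 &
    forall x, ~ N0 x -> h (Phi x) = x].
  apply: (rays_ae_eq finj mf (U := h \o Phi) (V := id)) => // q.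
  have mhr : measurable (h @^-1` ray f q) by exact: measurable_preimage.
  apply/eqP; rewrite eq_le dist_ge0 andbT preimage_id.
  apply: le_trans (dist_triangle mu (mpre _ mhr) (mpre _ (mD q)) (mr q)) _.
  by rewrite dD addr0 distC -(dh q) /dist pnu.
have [sigma' [phi'_inj K1 K2]] := block_inverse P0 alpha phi_inj.
pose hS := block_map (P0 := P0) alpha sigma xpredT.
pose hS' := block_map (P0 := P0) alpha sigma' xpredT.
have mhS : measurable_fun setT hS by exact: measurable_block_map.
have mhS' : measurable_fun setT hS' by exact: measurable_block_map.
have phS E : measurable E -> pr nu (hS @^-1` E) = pr nu E.
  by move=> mE; exact: block_map_pr.
have phS' E : measurable E -> pr nu (hS' @^-1` E) = pr nu E.
  by move=> mE; exact: block_map_pr.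
have null E : measurable E -> (forall x, ~ N0 x -> ~ E (Phi x)) -> pr nu E = 0.
  move=> mE h0; rewrite pnu; apply: (pr_sub0 (mpre _ mE) mN0 _ pN0) => x Ex.
  by apply: contrapT => /h0; exact.
pose S1 := h \o hS \o Phi; pose S2 := h \o hS' \o Phi.
have mS1 : measurable_fun setT S1 by apply: measurableT_comp => //; exact: measurableT_comp.
have mS2 : measurable_fun setT S2 by apply: measurableT_comp => //; exact: measurableT_comp.
have mPh : measurable_fun setT (Phi \o h) by exact: measurableT_comp.
have mneq := measurable_neq finj mf.
(* [g (Phi x)] need not be the code of a point, so [Phi \o h] may alter it. Since [g] preserves
   [nu], it meets the exceptional set only with probability 0. *)
have g12 (g g' : Y -> Y) : measurable_fun setT g -> measurable_fun setT g' ->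
    (forall E, measurable E -> pr nu (g @^-1` E) = pr nu E) ->
    (forall y, g' (g y) = y) ->
    pr mu [set x | h (g' (Phi (h (g (Phi x))))) <> x] = 0.
  move=> mg mg' pg gg'.
  have mA1 : measurable_fun setT (h \o g' \o (Phi \o h)).
    by apply: measurableT_comp => //; exact: measurableT_comp.
  have mA2 : measurable_fun setT (h \o g') by exact: measurableT_comp.
  pose E := [set y | (h \o g' \o (Phi \o h)) y <> (h \o g') y].
  have mE : measurable E by exact: mneq.
  have pE : pr nu E = 0.
    by apply: null => // x /hPhi e; rewrite /E /= e.
  have mgE : measurable (g @^-1` E) by exact: measurable_preimage.
  apply: (@pr_sub0 _ _ _ mu _ (Phi @^-1` (g @^-1` E) `|` N0)).
  - have -> : [set x | h (g' (Phi (h (g (Phi x))))) <> x] =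
        [set x | (h \o g' \o (Phi \o h) \o g \o Phi) x <> id x] by [].
    apply: mneq => //; apply: measurableT_comp => //; exact: measurableT_comp.
  - by apply: measurableU => //; exact: mpre.
  - move=> x /= ne; apply: contrapT => /not_orP[nE nN]; apply: nE => /= e.
    apply: ne; transitivity ((h \o g') (g (Phi x))); first exact: e.
    by rewrite /= gg' hPhi.
  - by apply: prU0 => //; [exact: mpre|rewrite -pnu pg].
have pS g B : (forall E, measurable E -> pr nu (g @^-1` E) = pr nu E) ->
    measurable B -> pr mu ((h \o g \o Phi) @^-1` B) = pr mu B.
  move=> pg mB; have mhB : measurable (h @^-1` B) by exact: measurable_preimage.
  by rewrite -(ph B mB) -(pg _ mhB) pnu.
have [S [Z [autS mZ pZ SE]]] := realize_aut finj mf mS1 mS2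
  (fun B => pS hS B phS) (fun B => pS hS' B phS')
  (g12 _ _ mhS mhS' phS K1) (g12 _ _ mhS' mhS phS' K2).
(* On codes, [T^N] moves the blocks by one place; all blocks follow the same rule [sigma], so the
   block map commutes with this shift. *)
pose sh (y : Y) : Y := fun i => y (i.1 - 1, i.2).
have msh : measurable_fun setT sh.
  by apply: measurable_to_Y => -[b k] B PB; exact: measurable_cyl.
have shPhi x : Phi (iter N T x) = sh (Phi x).
  apply/funext => -[b k].
  by rewrite -[LHS]/(orb T Ti (iter N T x) (zeta (b, k))) (orb_iter TK) zshift.
have shS y : hS (sh y) = sh (hS y).
  apply/funext => -[b k]; rewrite /hS /sh /block_map /=.
  by congr (y (_, sigma _ _)); apply/ffunP => j; rewrite !ffunE.
have mTN : measurable_fun setT (iter N T).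
  by move=> _ B mB; rewrite setTI; exact: (measurable_iter_pre autT).
pose E1 := [set y | (h \o sh) y <> (iter N T \o h) y].
have mE1 : measurable E1 by apply: mneq; exact: measurableT_comp.
(* The last conclusion reads the code of a decoded point; [E2] is where decoding and coding again
   changes the word of block 0. *)
pose E2 := [set y : Y | wd alpha (Phi (h y)) 0 <> wd alpha y 0].
have mE2 : measurable E2.
  rewrite (_ : E2 = \bigcup_(w in [set: {ffun K -> A}])
    ([set y | wd alpha y 0 = w] `\` (Phi \o h) @^-1` [set y | wd alpha y 0 = w])).
    apply: fin_bigcup_measurable; first exact: finite_finset.
    move=> w _; apply: measurableD; first exact: measurable_wd.
    by apply: measurable_preimage => //; exact: measurable_wd.
  apply/seteqP; split => y /=.
    by move=> ne; exists (wd alpha y 0).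
  by move=> [w _ /= [<- ne]].
have N1 : exists N1, [/\ measurable N1, pr mu N1 = 0 & forall x, ~ N1 x ->
    h (Phi (iter N T x)) = iter N T x /\ h (Phi x) = x].
  exists (iter N T @^-1` N0 `|` N0); split.
  - by apply: measurableU => //; exact: (measurable_iter_pre autT).
  - apply: prU0 => //; first exact: (measurable_iter_pre autT).
    by rewrite (pr_iter_pre autT).
  - by move=> x /not_orP[n1 n2]; split; exact: hPhi.
have [{}N1 [mN1 pN1 hN1]] := N1.
have pE1 : pr nu E1 = 0.
  rewrite pnu; apply: (pr_sub0 (mpre _ mE1) mN1 _ pN1) => x /= ne.
  by apply: contrapT => /hN1[e1 e2]; apply: ne; rewrite /= -shPhi e1 e2.
have pE2 : pr nu E2 = 0.
  by apply: null => // x /hPhi e; rewrite /E2 /= e.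
have mpreS E : measurable E -> measurable (Phi @^-1` (hS @^-1` E)).
  by move=> mE; apply: (mpre); exact: measurable_preimage.
have mTZ := measurable_iter_pre autT N mZ.
exists S, (Z `|` iter N T @^-1` Z `|` (Phi @^-1` (hS @^-1` E1) `|` Phi @^-1` (hS @^-1` E2))).
split => //.
- apply: measurableU; first exact: measurableU.
  by apply: measurableU; exact: mpreS.
- apply: prU0.
  + exact: measurableU.
  + by apply: measurableU; exact: mpreS.
  + by apply: prU0 => //; rewrite (pr_iter_pre autT).
  + apply: prU0; [exact: mpreS|exact: mpreS| |].
      by rewrite -pnu phS.
    by rewrite -pnu phS.
- move=> x /not_orP[/not_orP[z1 z2] /not_orP[n1 _]].
  rewrite !SE// /S1 /= shPhi shS.
  by apply: contrapT => ne; apply: n1.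
- move=> x /not_orP[/not_orP[z1 z2] /not_orP[_ n2]].
  rewrite SE// /S1 /=.
  have -> : wd alpha (Phi (h (hS (Phi x)))) 0 = wd alpha (hS (Phi x)) 0.
    by apply: contrapT => ne; apply: n2.
  by rewrite wd_block_map.
Qed.

End coded_automorphism.

(** * Division of the time axis into blocks and windows *)

Section block_index.

Lemma euclid_int_uniq (M : nat) (a a' : int) (j j' : 'I_M) :
  a * M%:Z + j%:Z = a' * M%:Z + j'%:Z -> a = a' /\ j = j'.
Proof.
move=> e; have lj := ltn_ord j; have lj' := ltn_ord j'.
have aa : a = a'.
  have M0 : M%:Z != 0 by lia.
  have := congr1 (fun z => (z %/ M%:Z)%Z) e; rewrite !divzMDl// !divz_small ?addr0//; lia.
split => //; apply: val_inj => /=; move: e; rewrite aa => /addrI; lia.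
Qed.

Lemma euclid_int_ex (M : nat) (z : int) : (0 < M)%N ->
  exists (a : int) (j : 'I_M), z = a * M%:Z + j%:Z.
Proof.
move=> M0; have h0 : 0 <= (z %% M%:Z)%Z by apply: modz_ge0; lia.
have h1 : (z %% M%:Z)%Z < M%:Z by apply: ltz_pmod.
have lt : (`|(z %% M%:Z)%Z| < M)%N by lia.
exists (z %/ M%:Z)%Z, (Ordinal lt) => /=.
by rewrite gez0_abs//; exact: divz_eq.
Qed.

Variables (L' m : nat).
Local Notation L := L'.+1.
Local Notation M := m.*2.+1.

(** Euclidean division of time by the window length and then by the number of windows in a block.
    The offset [m] centres the first window of block 0 at time 0. *)
Definition block_index (i : int * ('I_L * 'I_M)) : int :=
  (i.1 * L%:Z + i.2.1%:Z) * M%:Z + i.2.2%:Z - m%:Z.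

Lemma block_index_inj : injective block_index.
Proof.
move=> [b [r j]] [b' [r' j']]; rewrite /block_index /= => /addIr /euclid_int_uniq[].
by move=> /euclid_int_uniq[-> ->] ->.
Qed.

Lemma block_index_surj z : exists i, block_index i = z.
Proof.
have [a [j e]] := @euclid_int_ex M (z + m%:Z) isT.
have [b [r e']] := @euclid_int_ex L a isT.
by exists (b, (r, j)); rewrite /block_index /= -e' -e addrK.
Qed.

Lemma block_index_shift b k :
  block_index (b, k) - (L * M)%N%:Z = block_index (b - 1, k).
Proof. by rewrite /block_index /= PoszM; ring. Qed.

End block_index.

Section names.
Context {d : measure_display} {X : measurableType d} {R : realType}.
Variables (mu : probability X R) (T Ti : X -> X) (P0 : set (set X)).
Hypotheses (TK : cancel T Ti) (TiK : cancel Ti T).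
Hypothesis mtimg : forall z A, P0 A -> measurable (timg T z A).
Hypothesis ind : forall (n : nat) (f : nat -> int) (A : nat -> set X),
  {in [pred i | (i < n)%N] &, injective f} -> (forall i, P0 (A i)) ->
  pr mu (\bigcap_(i in [set i | (i < n)%N]) timg T (f i) (A i)) =
  \prod_(i < n) pr mu (A i).
Variables (A : finType) (alpha : X -> A).
Hypothesis Palpha : forall a, P0 (alpha @^-1` [set a]).
Variables (J : finType) (zz : J -> int).

Definition name (x : X) : {ffun J -> A} := [ffun j => alpha (orb T Ti x (zz j))].

Lemma name_pre w : name @^-1` [set w] =
  [set x | forall j, (alpha @^-1` [set w j]) (orb T Ti x (zz j))].
Proof.
apply/seteqP; split => x /=; first by move=> <- j; rewrite ffunE.
by move=> h; apply/ffunP => j; rewrite ffunE h.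
Qed.

Lemma measurable_name w : measurable (name @^-1` [set w]).
Proof.
rewrite name_pre (_ : [set _ | _] =
  \bigcap_(j in [set: J]) timg T (zz j) (alpha @^-1` [set w j])).
  apply: fin_bigcap_measurable; first exact: finite_finset.
  by move=> j _; exact: mtimg.
apply/seteqP; split => x /=.
  by move=> h j _; rewrite (timgE TK TiK); exact: h.
by move=> h j; have := h j Logic.I; rewrite (timgE TK TiK).
Qed.

Lemma pr_name (j0 : J) w : injective zz ->
  pr mu (name @^-1` [set w]) = \prod_j pr mu (alpha @^-1` [set w j]).
Proof.
move=> zinj; rewrite name_pre -[RHS]big_enum.
have := @pr_box _ _ _ mu T Ti P0 TK TiK ind J j0 zz zinj
  (fun j => alpha @^-1` [set w j]) (enum J) (enum_uniq _).
move=> <- //; first by move=> j; rewrite mem_enum.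
Qed.

End names.

Section determined.
Context {d : measure_display} {X : measurableType d}.
Variables (T Ti : X -> X) (P0 : set (set X)).
Hypothesis sP : sigma_algebra setT P0.

Definition determined_by (A : finType) (alpha : X -> A) (s : seq int) (C : set X) :=
  forall x x', (forall z, z \in s -> alpha (orb T Ti x z) = alpha (orb T Ti x' z)) ->
  C x -> C x'.

(** The dense algebra for the approximation: finitely many times and one finite partition with cells
    in [P0], both allowed to depend on the set. *)
Definition determined (C : set X) : Prop := measurable C /\
  exists (A : finType) (alpha : X -> A) (s : seq int),
    (forall a, P0 (alpha @^-1` [set a])) /\ determined_by alpha s C.

Let P0T : P0 setT.
Proof. by case: sP => h1 h2 _; have := h2 _ h1; rewrite setD0. Qed.

Let P0C A : P0 A -> P0 (~` A).
Proof. by case: sP => _ + _ PA => /(_ _ PA); rewrite setTD. Qed.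

Let P0I A B : P0 A -> P0 B -> P0 (A `&` B).
Proof.
case: sP => p0 _ pU PA PB; rewrite -[A `&` B]setCK setCI; apply: P0C.
rewrite -bigcup2E; apply: pU => -[|[|k]] /=; [exact: P0C|exact: P0C|exact: p0].
Qed.

(** The product of the partitions together with the concatenated list of times serves all the sets
    at once. *)
Lemma determined_common (C : nat -> set X) n : (forall i, determined (C i)) ->
  exists (A : finType) (alpha : X -> A) (s : seq int),
    (forall a, P0 (alpha @^-1` [set a])) /\
    forall i, (i < n)%N -> determined_by alpha s (C i).
Proof.
move=> dC; elim: n => [|n [A [alpha [s [PA dA]]]]].
  exists unit, (fun=> tt), [::]; split => // -[].
  by rewrite (_ : _ @^-1` _ = setT)//; apply/seteqP; split.
have [_ [B [beta [t [PB dB]]]]] := dC n.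
exists (A * B)%type, (fun x => (alpha x, beta x)), (s ++ t); split.
  move=> [a b]; rewrite (_ : _ @^-1` _ = alpha @^-1` [set a] `&` beta @^-1` [set b]).
    exact: P0I.
  by apply/seteqP; split => x /=; [move=> [-> ->]|move=> [-> ->]].
move=> i; rewrite ltnS leq_eqVlt => /orP[/eqP->|/dA dAi] x x' h.
  by apply: dB => z zt; have := h z; rewrite mem_cat zt orbT => /(_ isT) [].
by apply: dAi => z zs; have := h z; rewrite mem_cat zs => /(_ isT) [].
Qed.

Lemma determined0 : determined set0.
Proof.
split => //; exists unit, (fun=> tt), [::]; split => // -[].
by rewrite (_ : _ @^-1` _ = setT)//; apply/seteqP; split.
Qed.

Lemma determinedC C : determined C -> determined (~` C).
Proof.
move=> [mC [A [alpha [s [PA dA]]]]]; split; first exact: measurableC.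
exists A, alpha, s; split => // x x' h nC Cx'; apply: nC; apply: dA Cx'.
by move=> z zs; rewrite h.
Qed.

Lemma determinedU C D : determined C -> determined D -> determined (C `|` D).
Proof.
move=> dC dD.
have [|A [alpha [s [PA dA]]]] := @determined_common
  (fun i => if i is 0%N then C else D) 2; first by case.
split; first by apply: measurableU; [case: dC|case: dD].
exists A, alpha, s; split => // x x' h [Cx|Dx].
  by left; exact: (dA 0%N isT _ _ h).
by right; exact: (dA 1%N isT _ _ h).
Qed.

Lemma determined_timg (TK : cancel T Ti) (TiK : cancel Ti T) z A :
  measurable (timg T z A) -> P0 A -> determined (timg T z A).
Proof.
move=> mA PA; split => //; exists bool, (fun x => x \in A), [:: z]; split.
  case; [rewrite (_ : _ @^-1` _ = A)//|rewrite (_ : _ @^-1` _ = ~` A); first exact: P0C];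
  apply/seteqP; split => x /=.
  - by move/set_mem.
  - by move/mem_set.
  - by move=> /negbT /negP nA Ax; apply: nA; exact/mem_set.
  - by move=> nA; apply/negbTE/negP => /set_mem.
move=> x x' /(_ z (mem_head _ _)) e; rewrite (timgE TK TiK) /=.
by move/mem_set; rewrite e => /set_mem.
Qed.

End determined.

(** * Density of the centralizers in the Bernoulli case *)

Section bernoulli.
Context {d : measure_display} {X : measurableType d} {R : realType}.
Variables (mu : probability X R) (T : X -> X).
Hypotheses (stX : @standard_Borel d X R) (autT : isAut mu T).

Lemma pr_aut_pre S A : isAut mu S -> measurable A -> pr mu (S @^-1` A) = pr mu A.
Proof. by move=> [_ _ _ h] mA; rewrite /pr h. Qed.

Lemma dist_aut_pre S A B : isAut mu S -> measurable A -> measurable B ->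
  dist mu (S @^-1` A) (S @^-1` B) = dist mu A B.
Proof.
by move=> aS mA mB; rewrite /dist -[RHS](pr_aut_pre aS)//; exact: measurable_symdiff.
Qed.

Lemma pr_bigcup_ltn_le (F : nat -> set X) (e : R) n :
  (forall i, measurable (F i)) -> (forall i, pr mu (F i) <= e) ->
  pr mu (\bigcup_(i in [set i | (i < n)%N]) F i) <= n%:R * e.
Proof.
move=> mF Fe; elim: n => [|n ih].
  by rewrite (_ : \bigcup_(_ in _) _ = set0) ?pr0 ?mul0r// -subset0 => x [].
rewrite bigcup_ltnS -natr1 mulrDl mul1r.
by apply: le_trans (prU_le mu (bigcup_ltn_measurable n mF) (mF n)) _; exact: lerD.
Qed.

(** Names the atom of the first [k] sets that contains [x]; matching patterns moves all [k] sets
    together. *)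
Definition pattern k (A : nat -> set X) (x : X) : {ffun 'I_k -> bool} :=
  [ffun i : 'I_k => x \in A i].

Lemma measurable_pattern k A j : (forall i, measurable (A i)) ->
  measurable (pattern k A @^-1` [set j]).
Proof.
move=> mA; rewrite (_ : _ @^-1` _ =
  \bigcap_(i in [set: 'I_k]) (if j i then A i else ~` A i)).
  apply: fin_bigcap_measurable; first exact: finite_finset.
  by move=> i _; case: ifP => _ //; exact: measurableC.
apply/seteqP; split => x /=.
  move=> <- i _; rewrite ffunE; case: ifPn => [/set_mem//|/negP nA Ax].
  by apply: nA; exact/mem_set.
move=> h; apply/ffunP => i; have := h i Logic.I; rewrite ffunE.
by case: (j i) => [/mem_set//|nA]; apply/negbTE/negP => /set_mem.
Qed.

Lemma pattern_dist k A A' j (e : R) : (forall i, measurable (A i)) ->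
  (forall i, measurable (A' i)) -> (forall i, dist mu (A' i) (A i) <= e) ->
  `|pr mu (pattern k A' @^-1` [set j]) - pr mu (pattern k A @^-1` [set j])| <= k%:R * e.
Proof.
move=> mA mA' dA; apply: le_trans (pr_dist_le mu (measurable_pattern j mA')
  (measurable_pattern j mA)) _.
have ms i : measurable (symdiff (A' i) (A i)) by exact: measurable_symdiff.
apply: le_trans (pr_bigcup_ltn_le k ms dA); apply: le_pr.
- by apply: measurable_symdiff; exact: measurable_pattern.
- exact: bigcup_ltn_measurable.
move=> x ne; apply: contrapT => h.
have e' : pattern k A' x = pattern k A x.
  apply/ffunP => i; rewrite !ffunE.
  have nh : ~ symdiff (A' i) (A i) x.
    by move=> hs; apply: h; exists i => //=; exact: ltn_ord.
  apply/idP/idP => /set_mem Ax; apply/mem_set; apply: contrapT => nA; apply: nh.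
    by left.
  by right.
by case: ne => -[/= h1 h2]; rewrite e' in h1 h2.
Qed.

(** For most [x] the constructed [S'] must satisfy: [x] is in [A1 i] exactly when [S' x] is in
    [B1 i]. Both are read from the window at time 0, through [p] and [q], so it is enough to match
    source patterns with target patterns. *)
Lemma bernoulli_dense : Bernoulli mu T -> aut_dense mu (Cinfty mu T).
Proof.
move=> [P0 [[sP mP0] [ind0 gen]]] U [Uaut Uo] [S US].
have autS := Uaut _ US.
have [k [A0 [e [e0 [mA0 Usub]]]]] := Uo _ US.
have [f [finj [mf fim]]] := stX.
have [[Ti TK TiK] mT imT prT_] := autT.
have ind : forall (n : nat) (f : nat -> int) (A : nat -> set X),
  {in [pred i | (i < n)%N] &, injective f} -> (forall i, P0 (A i)) ->
  pr mu (\bigcap_(i in [set i | (i < n)%N]) timg T (f i) (A i)) =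
  \prod_(i < n) pr mu (A i) by exact: ind0.
have mtimg z A : P0 A -> measurable (timg T z A).
  move=> /mP0 mA; case: z => n /=; first exact: (measurable_iter_image autT).
  exact: (measurable_iter_pre autT n.+1).
pose J := {ffun 'I_k -> bool}.
have J1 : 1 <= #|J|%:R + 1 :> R by rewrite lerDr.
have k1 : 1 <= k%:R + 1 :> R by rewrite lerDr.
(* The final error is [2 * eta] from the approximations plus [#|J| * (2 * k * eta + e')] from the
   matching; these constants give three parts of at most [e / 4] each. *)
pose eta := e / (8 * (#|J|%:R + 1) * (k%:R + 1)).
pose e' := e / (4 * (#|J|%:R + 1)).
have eta0 : 0 < eta by rewrite divr_gt0// !mulr_gt0//; lra.
have e'0 : 0 < e' by rewrite divr_gt0// !mulr_gt0//; lra.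
pose B0 i := S @` A0 i.
have mB0 i : measurable (B0 i) by case: autS => _ _ h _; exact: h.
have approx C : measurable C -> exists C', determined T Ti P0 C' /\ dist mu C' C < eta.
  move=> mC; have [|||||C' dC' h] := @generates_approx _ _ _ mu _
    (determined T Ti P0) C eta _ _ _ _ _ gen mC eta0; last by exists C'.
  - by move=> Z [].
  - exact: determined0.
  - by move=> Z; exact: determinedC.
  - by move=> Z Z'; exact: determinedU.
  - by move=> _ [z [Z [PZ ->]]]; apply: determined_timg => //; exact: mtimg.
have /choice[A1 /all_and2[dA1 nA1]] : forall i, exists C',
    determined T Ti P0 C' /\ dist mu C' (A0 i) < eta by move=> i; exact: approx.
have /choice[B1 /all_and2[dB1 nB1]] : forall i, exists C',
    determined T Ti P0 C' /\ dist mu C' (B0 i) < eta by move=> i; exact: approx.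
have mA1 i : measurable (A1 i) by case: (dA1 i).
have mB1 i : measurable (B1 i) by case: (dB1 i).
pose C i := if (i < k)%N then A1 i else B1 (i - k)%N.
have dC i : determined T Ti P0 (C i) by rewrite /C; case: ifP.
have [Al [alpha [s [Palpha dets]]]] := determined_common sP (k + k) dC.
have detA i : (i < k)%N -> determined_by T Ti alpha s (A1 i).
  by move=> ik; have := dets i (ltn_addr _ ik); rewrite /C ik.
have detB i : (i < k)%N -> determined_by T Ti alpha s (B1 i).
  move=> ik; have := dets (k + i)%N; rewrite ltn_add2l => /(_ ik).
  by rewrite /C ltnNge leq_addr /= addKn.
(* The window from [-m] to [m] contains all the times in [s]. *)
pose m := (\max_(z <- s) `|z|)%N.
have sm z : z \in s -> (`|z| <= m)%N by move=> zs; exact: leq_bigmax_seq.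
pose zM (j : 'I_m.*2.+1) : int := j%:Z - m%:Z.
have zMinj : injective zM by move=> i j /addIr [] /val_inj.
pose nm := name T Ti alpha zM.
have detnm (Z : set X) x x' : determined_by T Ti alpha s Z -> nm x = nm x' -> Z x -> Z x'.
  move=> dZ /ffunP e1; apply: dZ => z zs.
  have lt : (absz (z + m%:Z)%R < m.*2.+1)%N by have := sm z zs; lia.
  have := e1 (Ordinal lt); rewrite !ffunE /zM /=.
  by rewrite (_ : (absz (z + m%:Z))%:Z - m%:Z = z)//; have := sm z zs; lia.
have mnm v : measurable (nm @^-1` [set v]) by exact: (measurable_name TK TiK mtimg).
pose V := {ffun 'I_m.*2.+1 -> Al}.
(* The window name decides the pattern; a name carried by no point gets the empty pattern. *)
pose dec (D : nat -> set X) (v : V) : J :=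
  [ffun i : 'I_k => `[< exists2 x, D i x & nm x = v >]].
have decE D x : (forall i, (i < k)%N -> determined_by T Ti alpha s (D i)) ->
    dec D (nm x) = pattern k D x.
  move=> dD; apply/ffunP => i; rewrite !ffunE; apply/idP/idP.
    by move=> /asboolP[x' Dx' e1]; apply/mem_set; exact: detnm (dD i (ltn_ord i)) e1 Dx'.
  by move=> /set_mem Dx; apply/asboolP; exists x.
pose p := dec A1; pose q := dec B1.
pose pw v := pr mu (nm @^-1` [set v]).
have pwsum : \sum_v pw v = 1.
  rewrite -(prT mu) (pr_fin_partition mu measurableT mnm).
  by apply: eq_bigr => v _; rewrite setTI.
have [L' [sg [sginj sgle]]] := matching p q (fun v => pr_ge0 mu _ : 0 <= pw v) pwsum e'0.
pose K := ('I_L'.+1 * 'I_m.*2.+1)%type.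
pose k0 : K := (ord0, ord0).
pose cur (w : {ffun K -> Al}) : {ffun 'I_L'.+1 -> V} := [ffun r => [ffun j => w (r, j)]].
have curinj : injective cur.
  move=> w w' /ffunP e1; apply/ffunP => -[r j].
  by have := e1 r; rewrite !ffunE => /ffunP /(_ j); rewrite !ffunE.
have pinj (t : {perm 'I_L'.+1}) : injective (fun i : K => (t i.1, i.2)).
  by move=> [r j] [r' j'] /= [/perm_inj -> ->].
(* [cur] reads a block as a word of windows; whole windows are permuted and the position inside a
   window is kept. *)
pose sigma (w : {ffun K -> Al}) : {perm K} := perm (pinj (sg (cur w))).
have curphi w : cur (phi sigma w) = act (cur w) (sg (cur w)).
  by apply/ffunP => r; rewrite !ffunE; apply/ffunP => j; rewrite !ffunE permE.
have phi_inj : injective (phi sigma).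
  by move=> w w' /(congr1 cur); rewrite !curphi => /sginj /curinj.
pose zeta : int * K -> int := @block_index L' m.
have zinj : injective zeta by exact: block_index_inj.
have [S' [Z [autS' mZ pZ SN Swd]]] := coded_aut autT finj mf fim TK TiK sP mtimg
  ind gen k0 Palpha zinj (@block_index_surj L' m) (@block_index_shift L' m) phi_inj.
pose u x := name T Ti alpha (fun i : K => zeta (0, i)) x.
have Su x : ~ Z x -> u (S' x) = phi sigma (u x) by move=> /Swd.
have mu_ w : measurable (u @^-1` [set w]) by exact: (measurable_name TK TiK mtimg).
have unm x : cur (u x) ord0 = nm x.
  by apply/ffunP => j; rewrite !ffunE; congr (alpha (orb _ _ _ _)).
have pru w : pr mu (u @^-1` [set w]) = wt pw (cur w).
  rewrite (pr_name TK TiK ind Palpha k0); last first.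
    by move=> i i' /zinj [].
  rewrite /wt; under [RHS]eq_bigr => r _.
    rewrite /pw (pr_name TK TiK ind Palpha ord0)//.
    over.
  by rewrite pair_bigA /=; apply: eq_bigr => -[r j] _; rewrite !ffunE.
pose Mis := [set x | p (nm x) <> q (nm (S' x))].
pose Mis' := [set x | [pred w | p (cur w ord0) != q (act (cur w) (sg (cur w)) ord0)] (u x)].
have mMis' : measurable Mis'.
  rewrite (_ : Mis' = \bigcup_(w in [set w | [pred w | p (cur w ord0) !=
     q (act (cur w) (sg (cur w)) ord0)] w]) u @^-1` [set w]).
    by apply: fin_bigcup_measurable; first exact: finite_finset.
  apply/seteqP; split => x /=; first by move=> h; exists (u x).
  by move=> [w /= h e1]; rewrite /Mis' /= e1.
have MisS : Mis `<=` Z `|` Mis'.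
  move=> x ne; case: (pselect (Z x)) => [|nZ]; [by left|right].
  rewrite /Mis' /=; apply/eqP => e1; apply: ne.
  by rewrite -!unm Su// curphi.
have prMis' : pr mu Mis' <= #|J|%:R * (2 * (k%:R * eta) + e').
  rewrite -[X in pr mu X]setTI (pr_fin_preimage mu _ measurableT mu_).
  under eq_bigr do rewrite setTI pru.
  have -> : \sum_(w | [pred w | p (cur w ord0) != q (act (cur w) (sg (cur w)) ord0)] w)
      wt pw (cur w) =
    \sum_(w : {ffun 'I_L'.+1 -> V}) wt pw w * (p (w ord0) != q (act w (sg w) ord0))%:R.
    have cur_onto : bijective cur.
      exists (fun w : {ffun 'I_L'.+1 -> V} => [ffun i : K => w i.1 i.2]) => w.
        by apply/ffunP => -[r j]; rewrite !ffunE.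
      by apply/ffunP => r; apply/ffunP => j; rewrite !ffunE.
    rewrite [RHS](reindex cur) /=; last exact: onW_bij.
    by rewrite big_mkcond; apply: eq_bigr => w _; case: ifP; rewrite ?mulr1 ?mulr0.
  apply: le_trans sgle _; rewrite mulr_natl -sumr_const.
  apply: ler_sum => j _; rewrite lerD2r.
  have gapE D : (forall i, (i < k)%N -> determined_by T Ti alpha s (D i)) ->
      \sum_v pw v * (dec D v == j)%:R = pr mu (pattern k D @^-1` [set j]).
    move=> dD; rewrite (_ : pattern k D @^-1` [set j] =
        setT `&` [set x | [pred v | dec D v == j] (nm x)]).
      rewrite (pr_fin_preimage mu _ measurableT mnm) [RHS]big_mkcond.
      by apply: eq_bigr => v _; rewrite setTI /=; case: (_ == _); rewrite ?mulr1 ?mulr0.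
    rewrite setTI; apply/seteqP; split => x /=; rewrite decE//; first by move=> ->.
    by move/eqP.
  have -> : \sum_v pw v * gap p q j v = pr mu (pattern k A1 @^-1` [set j]) -
      pr mu (pattern k B1 @^-1` [set j]).
    rewrite -(gapE A1 detA) -(gapE B1 detB) -sumrB.
    by apply: eq_bigr => v _; rewrite -mulrBr.
  (* The pattern of [S x] for the images equals the pattern of [x] for the given sets, and [S]
     preserves [mu]; hence source and target frequencies nearly agree and the mean of [gap] is
     small. *)
  have ePat : pr mu (pattern k B0 @^-1` [set j]) = pr mu (pattern k A0 @^-1` [set j]).
    rewrite -(pr_aut_pre autS (measurable_pattern j mB0)); congr pr.
    have -> : S @^-1` (pattern k B0 @^-1` [set j]) = (pattern k B0 \o S) @^-1` [set j] by [].
    congr (_ @^-1` [set j]); apply/funext => x; apply/ffunP => i; rewrite !ffunE.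
    have Sinj : injective S by case: autS => /bij_inj.
    apply/idP/idP => /set_mem h; apply/mem_set; last by exists x.
    by case: h => y Ay /Sinj <-.
  have h1 := pattern_dist j mA0 mA1 (fun i => ltW (nA1 i)).
  have h2 := pattern_dist j mB0 mB1 (fun i => ltW (nB1 i)).
  rewrite ePat in h2.
  move: h1 h2; set a1 := pr mu _; set a0 := pr mu _; set b1 := pr mu _.
  rewrite !ler_norml => /andP[? ?] /andP[? ?]; apply/andP; split; lra.
exists S'; split; last first.
  exists (L'.+1 * m.*2.+1)%N; split => //; split => //.
  exists Z; split => //; first by apply/pr_eq0P.
  by move=> x /= ne; apply: contrapT => nZ; apply: ne; exact: SN.
apply: Usub; split => // i ik.
have S'inj : injective S' by case: autS' => /bij_inj.
have mS'pre C1 : measurable C1 -> measurable (S' @^-1` C1).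
  by move=> mC1; case: autS' => _ h _ _; exact: measurable_preimage.
have mSA : measurable (S' @` A0 i) by case: autS' => _ _ h _; exact: h.
have preS : S' @^-1` (S' @` A0 i) = A0 i.
  by apply/seteqP; split => x /=; [move=> [y Ay /S'inj <-]|exists x].
rewrite -[ltLHS]/(dist mu (S' @` A0 i) (B0 i)) -(dist_aut_pre autS' mSA (mB0 i)) preS.
have d1 := dist_triangle mu (mA0 i) (mA1 i) (mS'pre _ (mB0 i)).
have d2 := dist_triangle mu (mA1 i) (mS'pre _ (mB1 i)) (mS'pre _ (mB0 i)).
rewrite (dist_aut_pre autS' (mB1 i) (mB0 i)) in d2.
have d3 : dist mu (A1 i) (S' @^-1` B1 i) <= pr mu Mis'.
  apply: (@le_trans _ _ (pr mu (Z `|` Mis'))); last first.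
    by apply: le_trans (prU_le mu mZ mMis') _; rewrite pZ add0r.
  apply: le_pr.
  - by apply: measurable_symdiff => //; exact: mS'pre.
  - exact: measurableU.
  apply: subset_trans MisS => x ne; rewrite /Mis /= /p /q !decE// => /ffunP /(_ (Ordinal ik)).
  rewrite !ffunE /= => e1.
  case: ne => -[/= h1 h2]; apply: h2.
    by apply/set_mem; rewrite -e1; exact/mem_set.
  by apply/set_mem; rewrite e1; exact/mem_set.
have c1 : eta <= e / 8.
  rewrite /eta ler_pdivrMr; last by rewrite !mulr_gt0//; lra.
  rewrite (_ : e / 8 * _ = e * ((#|J|%:R + 1) * (k%:R + 1))); last by field.
  by apply: ler_peMr; [exact: ltW|exact: mulr_ege1].
have nJ : #|J|%:R + 1 != 0 :> R by rewrite lt0r_neq0// ltr_wpDl.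
have nk : k%:R + 1 != 0 :> R by rewrite lt0r_neq0// ltr_wpDl.
have c2 : #|J|%:R * (2 * (k%:R * eta)) <= e / 4.
  rewrite /eta (_ : #|J|%:R * _ =
    (e / 4) * ((#|J|%:R / (#|J|%:R + 1)) * (k%:R / (k%:R + 1)))); last first.
    by move: (#|J|%:R : R) nJ => cJ nJ; field; rewrite nJ nk.
  apply: ler_piMr; first by rewrite divr_ge0// ltW.
  have frac01 (n : nat) : 0 <= (n%:R / (n%:R + 1) : R) <= 1.
    by rewrite divr_ge0 ?addr_ge0// ler_pdivrMr ?ltr_wpDl// mul1r lerDl ler01.
  by case/andP: (frac01 #|J|) => ? ?; case/andP: (frac01 k) => ? ?; exact: mulr_ile1.
have c3 : #|J|%:R * e' <= e / 4.
  rewrite /e' (_ : #|J|%:R * _ = (e / 4) * (#|J|%:R / (#|J|%:R + 1))); last first.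
    by move: (#|J|%:R : R) nJ => cJ nJ; field; rewrite nJ.
  apply: ler_piMr; first by rewrite divr_ge0// ltW.
  by rewrite ler_pdivrMr ?ltr_wpDl// mul1r lerDl ler01.
have := nA1 i; have := nB1 i; rewrite (distC mu (A1 i)).
move: prMis'; rewrite mulrDr; lra.
Qed.

End bernoulli.

Theorem mainTheorem9 (d : measure_display) (X : measurableType d)
  (R : realType) (mu : probability X R) (T : X -> X) :
  @standard_Borel d X R -> isAut mu T -> ergodic mu T ->
  (Bernoulli mu T -> aut_dense mu (Cinfty mu T)) /\
  (Ksystem mu T -> c2_dense mu (Jinfty mu T) /\ lens_Psystem mu T).
Proof.
move=> stX autT _; split; first exact: bernoulli_dense.
by move=> KT; have h := K_periodic_dense stX autT KT; do !split => //;
  exact: K_transitive.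
Qed.
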